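(* Let $d>d_c$ and $\theta=\theta(d)>2$, and assume that the family $(f_n,g_n,e_n)$ satisfies Assumptions $S$, $D$, $E_\theta$ and $G_\theta$ formulated in the context. Then there exist positive $L_0=L_0(d,\epsilon)$, $z_c=z_c(d,L)$, $A=A(d,L)$ and $v=v(d,L)$ such that for $L\ge L_0$ the following statements hold. (a) Fix $\gamma\in(0,1\wedge\epsilon)$ and $\delta\in(0,(1\wedge\epsilon)-\gamma)$. Then $$f_n\Big(\frac{k}{\sqrt{v\sigma^2 n}};z_c\Big)=A e^{-\frac{k^2}{2d}}\big[1+\mathcal{O}(k^2n^{-\delta})+\mathcal{O}(n^{-\theta+2})\big],$$ with the error estimate uniform in $\{k\in\mathbb{R}^d: k/\sqrt{v\sigma^2n}\in[-\pi,\pi]^d,\ a(k/\sqrt{v\sigma^2 n})\le\gamma n^{-1}\log n\}$. (b) With $\delta$ as in (a), $$-\frac{\nabla^2 f_n(0;z_c)}{f_n(0;z_c)}=v\sigma^2 n\,[1+\mathcal{O}(\beta n^{-\delta})].$$ (c) For all $p\ge1$ there is a constant $C$ such that $$\|\hat D^2 f_n(\cdot;z_c)\|_p\le\frac{C}{L^{\frac dp}\,n^{\frac{d}{2p}\wedge\theta}}.$$ (d) The constants $z_c$, $A$ and $v$ obey $$1=\sum_{m=1}^\infty g_m(0;z_c),\qquad A=\frac{1+\sum_{m=1}^\infty e_m(0;z_c)}{\sum_{m=1}^\infty m\,g_m(0;z_c)},\qquad v=-\frac{\sum_{m=1}^\infty\nabla^2 g_m(0;z_c)}{\sigma^2\sum_{m=1}^\infty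 m\,g_m(0;z_c)}.$$
   Context: **Setting.** $x\wedge y=\min\{x,y\}$. $d$ is a positive integer (dimension), $d_c$ is a fixed model-dependent number (the critical dimension), $d>d_c$; $\theta=\theta(d)>2$ is a model-dependent parameter; $p^*\ge1$ and a nonempty set $B\subset[1,p^*]$ are fixed. $L\ge1$ is a parameter, to be taken large, and $\beta=\beta(p^* )=L^{-d/p^*}$. For each $L$ there are given functions $f_n(k;z)$ ($n\ge0$), $g_n(k;z)$, $e_n(k;z)$ ($n\ge1$) of $k\in[-\pi,\pi]^d$, $z>0$ (dependence on $L$ suppressed), with $f_0(k;z)=1$ and, for $n\ge0$, $$f_{n+1}(k;z)=\sum_{m=1}^{n+1}g_m(k;z)f_{n+1-m}(k;z)+e_{n+1}(k;z).$$ $D=D_L$ is a function on $\mathbb{Z}^d$, $\hat D(k)=\sum_x e^{ik\cdot x}D(x)$, $a(k)=a_L(k)=1-\hat D(k)$, and $\sigma^2=\sigma_L^2=-\nabla^2\hat D(0)=\sum_x|x|^2D(x)$. $\nabla^2$ is the Laplacian in $k$, $k^2=|k|^2$ for the Euclidean norm, $\|k\|_\infty=\max_i|k_i|$, and for functions on $[-\pi,\pi]^d$, $\|h\|_p=\big(\int_{[-\pi,\pi]^d}|h(k)|^p\frac{d^dk}{(2\pi)^d}\big)^{1/p}$; $\hat D^2f$ denotes $\hat D(k)^2f(k)$. **Assumption $S$.** For every $n\in\mathbb{N}$ and $z>0$, $k\mapsto f_n(k;z)$ is symmetric under replacement of any component $k_i$ by $-k_i$ and under permutations of the components of $k$; the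 same holds for $e_n(\cdot;z)$ and $g_n(\cdot;z)$. For each $n$, $|f_n(k;z)|$ is bounded uniformly in $k\in[-\pi,\pi]^d$ and $z$ in a neighbourhood of $1$ (which may depend on $n$). $f_n$ and $g_n$ have continuous second derivatives (in $k$) in a neighbourhood of $0$ for every $n$. **Assumption $D$.** $D(x)\ge0$, $f_1(k;z)=z\hat D(k)$, $e_1(k;z)=0$ (so $g_1(k;z)=z\hat D(k)$). Moreover: (i) $\hat D(0)=1$ and, for some $\epsilon\in(0,\theta-2)$, $\sum_x|x|^{2+2\epsilon}D(x)<\infty$; (ii) there is a constant $C$ such that for all $L\ge1$, $\|D_L\|_\infty\le CL^{-d}$ and $\sigma_L^2\le CL^2$; (iii) there are constants $\eta,c_1,c_2>0$ (independent of $L$) with $c_1L^2k^2\le a_L(k)\le c_2L^2k^2$ for $\|k\|_\infty\le L^{-1}$, $a_L(k)>\eta$ for $\|k\|_\infty\ge L^{-1}$, and $a_L(k)<2-\eta$ for $k\in[-\pi,\pi]^d$. **Bounds (F).** For $m\ge1$, $z>0$ and a positive constant $K$, the bounds (F) are: for every $p\in B$, $$\|\hat D^2f_m(\cdot;z)\|_p\le\frac{K}{L^{d/p}m^{\frac{d}{2p}\wedge\theta}},\quad|f_m(0;z)|\le K,\quad|\nabla^2f_m(0;z)|\le K\sigma^2m.$$ **Assumption $E_\theta$.** There are $L_0$, an interval $I\subset[1-\alpha,1+\alpha]$ with $\alpha\in(0,1)$, and a function $K\mapsto C_e(K)$, such that if (F) holds for some $K>1$, $L\ge L_0$, $z\in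 I$ and for all $1\le m\le n$, then for that $L$ and $z$, all $k\in[-\pi,\pi]^d$ and all $2\le m\le n+1$, $$|e_m(k;z)|\le C_e(K)\beta m^{-\theta},\qquad|e_m(k;z)-e_m(0;z)|\le C_e(K)a(k)\beta m^{-\theta+1}.$$ **Assumption $G_\theta$.** There are $L_0$, an interval $I\subset[1-\alpha,1+\alpha]$ with $\alpha\in(0,1)$, and a function $K\mapsto C_g(K)$, such that if (F) holds for some $K>1$, $L\ge L_0$, $z\in I$ and for all $1\le m\le n$, then for that $L$ and $z$, all $k\in[-\pi,\pi]^d$ and all $2\le m\le n+1$, $$|g_m(k;z)|\le C_g(K)\beta m^{-\theta},\quad|\nabla^2g_m(0;z)|\le C_g(K)\sigma^2\beta m^{-\theta+1},\quad|\partial_zg_m(0;z)|\le C_g(K)\beta m^{-\theta+1},$$ $$|g_m(k;z)-g_m(0;z)-a(k)\sigma^{-2}\nabla^2g_m(0;z)|\le C_g(K)\beta a(k)^{1+\epsilon'}m^{-\theta+(1+\epsilon')},$$ the last bound for any $\epsilon'\in[0,\epsilon]$. **Constants.** $n\ge1$ throughout. Error constants are uniform in $n$; those in (a) may depend on $L$, while those in (b) and the constant $C$ in (c) do not depend on $L$ ($C$ in (c) may depend on $p$).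
   Formalization: In Assumptions E and G the interval I is required to be a neighbourhood of 1; as worded, I could be empty or miss z_c, the two assumptions would then be void and the theorem false. *)

(* Defs.v *)
From HB Require Import structures.
From mathcomp Require Import all_boot all_order all_algebra perm.
From mathcomp Require Import all_classical all_reals all_analysis.
From mathcomp Require Import complex.
Set Implicit Arguments.
Unset Strict Implicit.
Unset Printing Implicit Defensive.
Import Order.TTheory GRing.Theory Num.Theory.
Import numFieldNormedType.Exports.
Local Open Scope classical_set_scope.
Local Open Scope complex_scope.
Local Open Scope ring_scope.

Section TorusNorm.
Variable R : realType.

Definition tcons n (x : measurableTypeR R * n.-tuple (measurableTypeR R)) :
  n.+1.-tuple (measurableTypeR R) := [tuple of x.1 :: x.2].

Lemma measurable_tcons n : measurable_fun [set: _] (@tcons n).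
Proof. exact: measurable_cons. Qed.

HB.instance Definition _ n :=
  isMeasurableFun.Build _ _ _ _ (@tcons n) (@measurable_tcons n).

Lemma Npi_lt_pi : - pi < pi :> R.
Proof. by rewrite gtrN // pi_gt0. Qed.

(* The n-fold product of dt / (2 pi) on [-pi, pi], i.e. the measure
   d^n k / (2 pi)^n restricted to [-pi, pi]^n. *)
Fixpoint torus_measure n : probability (n.-tuple (measurableTypeR R)) R :=
  match n with
  | 0 => dirac [tuple]
  | n'.+1 =>
    distribution (uniform_prob Npi_lt_pi \x torus_measure n')%E (@tcons n')
  end.

(* ||h||_p, as an extended real; the value of h outside the cube is
   irrelevant since torus_measure gives no mass to it. *)
Definition torus_norm (d : nat) (p : R) (h : 'rV[R]_d -> R) : \bar R :=
  Lnorm (torus_measure d) p%:E (fun t => (h (\row_i tnth t i))%:E).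

End TorusNorm.

Section Calculus.
Variables (R : realType) (d : nat).
Implicit Types (h : 'rV[R]_d -> R) (k : 'rV[R]_d).

(* `|k| is the library's norm on row vectors, which is the sup norm;
   the square of the Euclidean norm is sqnorm. *)
Definition cube : set 'rV[R]_d := [set k | `|k| <= pi].

Definition sqnorm k : R := \sum_i k 0 i ^+ 2.

Definition partial (i : 'I_d) h : 'rV[R]_d -> R := 'D_'e_i h.

Definition laplacian h k : R := \sum_i partial i (partial i h) k.

Definition C2_near0 h : Prop :=
  \forall k \near (0 : 'rV[R]_d), forall i j : 'I_d,
    [/\ derivable h k 'e_i,
        derivable (partial i h) k 'e_j &
        {for k, continuous (partial j (partial i h))}].

Definition flip (i : 'I_d) k : 'rV[R]_d :=
  \row_j (if j == i then - k 0 j else k 0 j).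

Definition cube_symmetric h : Prop :=
  forall k, cube k ->
    (forall i, h (flip i k) = h k) /\ (forall s : 'S_d, h (col_perm s k) = h k).

End Calculus.

Section Lattice.
Variables (R : realType) (d : nat).
Implicit Types (D : 'rV[int]_d -> R) (k : 'rV[R]_d) (x : 'rV[int]_d).

(* Unconditional sum over Z^d; the library's esum is for terms >= 0. *)
Definition lattice_sum (u : 'rV[int]_d -> R) : R :=
  let U x := (u x)%:E in
  fine (\esum_(x in [set: 'rV[int]_d]) (U^\+)%E x) -
  fine (\esum_(x in [set: 'rV[int]_d]) (U^\-)%E x).

Definition lattice_sumC (u : 'rV[int]_d -> R[i]) : R[i] :=
  lattice_sum (fun x => complex.Re (u x)) +i* lattice_sum (fun x => complex.Im (u x)).

Definition expi (t : R) : R[i] := cos t +i* sin t.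

Definition fourier D k : R[i] :=
  lattice_sumC (fun x => expi (\sum_i k 0 i * (x 0 i)%:~R) * (D x)%:C).

(* The Fourier transform as a real function. Nothing is lost by taking the
   real part: assumption_D forces the transform to be real on the cube, as
   f_1(k;z) = z * fourier D k with f_1 real-valued. *)
Definition Dhat D k : R := complex.Re (fourier D k).

Definition akD D k : R := 1 - Dhat D k.

(* Also equal to the sum of |x|^2 D(x) when D has moments of order > 2. *)
Definition sigma2 D : R := - laplacian (Dhat D) 0.

Definition znorm x : R := Num.sqrt (\sum_i (x 0 i)%:~R ^+ 2).

End Lattice.

(* The parameter L ranges over the reals >= 1; f L n k z is f_n(k;z) for
   that L. The functions are total, but only their values for L >= 1,
   k in the cube and z > 0 are constrained or used (n >= 1 for g and e). *)
Section Assumptions.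
Variables (R : realType) (d : nat).
Implicit Types (f g e : R -> nat -> 'rV[R]_d -> R -> R).
Implicit Types (D : R -> 'rV[int]_d -> R) (B : set R).
Implicit Types (theta eps pstar L K z : R).

Definition beta pstar L : R := L `^ (- (d%:R / pstar)).

Definition recursion f g e : Prop :=
  forall L k z, 1 <= L -> cube k -> 0 < z ->
    f L 0%N k z = 1 /\
    forall n, f L n.+1 k z =
      \sum_(1 <= m < n.+2) g L m k z * f L (n.+1 - m)%N k z + e L n.+1 k z.

Definition assumption_S f g e : Prop :=
  forall L, 1 <= L ->
    [/\ forall n z, 0 < z -> cube_symmetric (fun k => f L n k z),
        forall n z, (1 <= n)%N -> 0 < z ->
          cube_symmetric (fun k => e L n k z) /\
          cube_symmetric (fun k => g L n k z),
        forall n, exists M : R, \forall z \near (1 : R),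
          forall k, cube k -> `|f L n k z| <= M &
        forall n z, 0 < z ->
          C2_near0 (fun k => f L n k z) /\
          ((1 <= n)%N -> C2_near0 (fun k => g L n k z))].

Definition assumption_D theta eps f g e D : Prop :=
  [/\ forall L, 1 <= L ->
        (forall x, 0 <= D L x) /\
        (forall k z, cube k -> 0 < z ->
          [/\ (f L 1%N k z)%:C = z%:C * fourier (D L) k,
              e L 1%N k z = 0 &
              (g L 1%N k z)%:C = z%:C * fourier (D L) k]),
      0 < eps < theta - 2 /\
      (forall L, 1 <= L ->
        fourier (D L) 0 = 1 /\
        (\esum_(x in [set: 'rV[int]_d])
            (znorm R x `^ (2 + 2 * eps) * D L x)%:E < +oo)%E),
      exists C : R, forall L, 1 <= L ->
        (forall x, `|D L x| <= C * L `^ (- d%:R)) /\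
        sigma2 (D L) <= C * L ^+ 2 &
      exists eta c1 c2 : R,
        [/\ 0 < eta, 0 < c1, 0 < c2 &
         forall L k, 1 <= L -> cube k ->
           [/\ `|k| <= L^-1 ->
                 c1 * L ^+ 2 * sqnorm k <= akD (D L) k
                   <= c2 * L ^+ 2 * sqnorm k,
               L^-1 <= `|k| -> eta < akD (D L) k &
               akD (D L) k < 2 - eta]]].

Definition bounds_F theta B f D K L z (m : nat) : Prop :=
  [/\ forall p, B p ->
        (torus_norm p (fun k => (Dhat (D L) k ^+ 2 * f L m k z)%R) <=
         (K / (L `^ (d%:R / p) *
               m%:R `^ Num.min (d%:R / (2 * p)) theta))%:E)%E,
      `|f L m 0 z| <= K &
      `|laplacian (fun k => f L m k z) 0| <= K * sigma2 (D L) * m%:R].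

(* The interval I has to be a neighbourhood of 1: with I empty, say, the
   implications in assumption_E and assumption_G would be void. *)
Definition parameter_interval (I : set R) : Prop :=
  [/\ is_interval I,
      nbhs (1 : R) I &
      exists2 alpha : R, 0 < alpha < 1 & I `<=` `[1 - alpha, 1 + alpha]].

Definition assumption_E theta pstar B f e D : Prop :=
  exists (L0 : R) (I : set R) (Ce : R -> R),
    parameter_interval I /\
    forall K L z (n : nat), 1 < K -> 1 <= L -> L0 <= L -> I z -> (1 <= n)%N ->
      (forall m, (1 <= m <= n)%N -> bounds_F theta B f D K L z m) ->
      forall k (m : nat), cube k -> (2 <= m <= n.+1)%N ->
        `|e L m k z| <= Ce K * beta pstar L * m%:R `^ (- theta) /\
        `|e L m k z - e L m 0 z| <=
          Ce K * akD (D L) k * beta pstar L * m%:R `^ (- theta + 1).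

Definition assumption_G theta eps pstar B f g D : Prop :=
  exists (L0 : R) (I : set R) (Cg : R -> R),
    parameter_interval I /\
    forall K L z (n : nat), 1 < K -> 1 <= L -> L0 <= L -> I z -> (1 <= n)%N ->
      (forall m, (1 <= m <= n)%N -> bounds_F theta B f D K L z m) ->
      forall k (m : nat), cube k -> (2 <= m <= n.+1)%N ->
        let s2 := sigma2 (D L) in
        let lap := laplacian (fun k' => g L m k' z) 0 in
        [/\ `|g L m k z| <= Cg K * beta pstar L * m%:R `^ (- theta),
            `|lap| <= Cg K * s2 * beta pstar L * m%:R `^ (- theta + 1),
            derivable (fun y => g L m 0 y) z 1,
            `|derive1 (fun y => g L m 0 y) z| <=
              Cg K * beta pstar L * m%:R `^ (- theta + 1) &
            forall eps', 0 <= eps' <= eps ->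
              `|g L m k z - g L m 0 z - akD (D L) k * s2^-1 * lap| <=
                Cg K * beta pstar L * akD (D L) k `^ (1 + eps') *
                m%:R `^ (- theta + (1 + eps'))].

End Assumptions.

(* Series indexed from 1. *)
Definition psum1 (R : realType) (u : nat -> R) : nat -> R :=
  fun N => \sum_(1 <= m < N) u m.

Definition summable1 (R : realType) (u : nat -> R) : Prop := cvgn (psum1 u).

Definition sum1 (R : realType) (u : nat -> R) : R := limn (psum1 u).

(* Main.v *)
Require Import Defs.
From mathcomp Require Import all_boot all_order all_algebra.
From mathcomp Require Import all_classical all_reals all_analysis.
From mathcomp Require Import measurable_realfun perm.
From mathcomp Require Import ring lra zify.
Set Implicit Arguments.
Unset Strict Implicit.
Unset Printing Implicit Defensive.
Import Order.TTheory GRing.Theory Num.Theory.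
Import numFieldNormedType.Exports.
Local Open Scope classical_set_scope.
Local Open Scope ring_scope.

(** For each [k] the sequence [f_n(k)] is a renewal sequence: with [F], [G], [E]
    the generating functions in [w] of [f_n(k)], [g_n(k)] and of 1 followed by
    [e_n(k)], the recursion says [F = E / (1 - G)]. For large [L] the kernel is a
    small perturbation of a single jump of length 1, with a summable tail of
    order [b m^(-theta)], where [b] is a multiple of [beta]. All of the theorem
    comes from three facts on such sequences.

    Bounds that do not deteriorate. Suppose that the masses
    [sum_(m <= j) g_m(0)] differ from 1 by at most [b j^(1 - theta)] for
    [j <= N]. Then the mass of the kernel at [k] is about [1 - a(k)], and
    [f_N(k)] is at most a constant times
    [(1 + a N)^(-M) + N^(2 - theta) (1 + a N)^(-2)], with a constant that does not
    depend on the bounds assumed for [g] and [e] as long as [b] is small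
    ([renewal_bound], [kernel_pointwise]). Integration over the torus
    ([lp_bound]) and the renewal equation for the second moments
    ([moment_bound]) then yield [bounds_F] at time [N] with a constant [K] that
    is chosen in advance ([near_critical_bounds]). As [bounds_F] up to time [N]
    bounds [g] and [e] up to time [N + 1], the induction closes for every [z]
    whose masses stay near 1. Such a [z] exists: the mass of the truncated
    kernel is increasing in [z], and the tolerance [b j^(1 - theta)] shrinks more
    slowly than the mass can move when one term is added, so there are nested
    intervals of admissible [z] ([critical_point]). Their common point is [z_c]
    ([critical_expansion]); this gives (c), and the masses tend to 1.

    Convergence at the critical point. There [1 - G(w) = (1 - w) T(w)] at
    [k = 0], where the coefficients of [T] are the tails of the kernel and [T(1)]
    is its mean [mu]. Since [T] is close to 1, the coefficients of [1 / T], which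
    are the increments of the resolvent, decay like those of [T]
    ([critical_increment]), so the resolvent tends to [1 / mu] at the rate
    [n^(2 - theta)] ([critical_rate]). Hence [f_n(0)] tends to [A]
    ([critical_f_rate]), and the second moments, divided by [sigma^2], are
    [- v A n] up to [n^(1 - delta)] ([critical_moment_rate]); their ratio is (b),
    and the formulas in (d) are those for the limits.

    The Gaussian. Multiplying [f_n(k)] by [expR (v a n)], with [a = a(k)], gives
    again a renewal sequence. The value of [v] is the one for which the mass of
    its kernel has no term of first order in [a], so this kernel differs from the
    critical one by [a^(1 + t)] in total mass ([tilt_kernel]); the restriction
    [a n <= gamma ln n] ensures that the tilt costs no more than a factor
    [m^(v gamma)] in its decay ([tilt_growth]). Comparison with the critical
    sequence ([tilt_close], [gaussian_tilt]) shows that [expR (v a n) f_n(k)] is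
    close to [f_n(0)], hence to [A]. Finally [v a n] is replaced by its quadratic
    part ([gaussian_replace]), using that the symmetries make the quadratic part
    of [a] isotropic: [a(k) = sigma^2 |k|^2 / 2d + O(|k|^(2 + 2 eps))] for
    [eps <= 1] ([akD_quad], [quad_sigma2]). *)

Ltac nlia :=
  repeat match goal with
  | H : is_true (leq _ _) |- _ => revert H
  | H : is_true (andb (leq _ _) (leq _ _)) |- _ => revert H
  | H : is_true (negb (leq _ _)) |- _ => revert H
  end;
  repeat match goal with H : ?T |- _ => lazymatch T with nat => fail | _ => clear H end end;
  intros; lia.

Ltac only_lra :=
  repeat match goal with H : ?T |- _ => lazymatch type of T with Prop => clear H end end;
  intros; lra.

(** * Power sums and sequences that do not vary much on dyadic blocks *)

Section PowerSums.
Variable R : realType.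
Implicit Types (s t x y : R).

Lemma powR_sub1 x s : 0 < x -> x `^ (- s) = x * x `^ (- s - 1).
Proof.
move=> x0; have xn := lt0r_neq0 x0.
by rewrite (@powRB _ x (- s) 1) ?xn ?implybT// powRr1 ?ltW// mulrC divfK.
Qed.

(** Bernoulli's inequality for a small or large exponent alike: both sides come
    from [ln y <= y - 1] and [1 + y <= expR y]. *)
Lemma powR_1D_ge x t : 0 <= x -> 0 < t -> 1 + t * (x / (1 + x)) <= (1 + x) `^ t.
Proof.
move=> x0 t0; have x1 : 0 < 1 + x by lra.
rewrite /powR gt_eqF//; apply: le_trans (expR_ge1Dx _).
rewrite lerD2l ler_wpM2l ?(ltW t0)//.
have x2 : -1 < - (x / (1 + x)) by rewrite ltrN2 ltr_pdivrMr// mul1r; lra.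
have := le_ln1Dx x2.
have -> : 1 - x / (1 + x) = (1 + x)^-1 by field; rewrite gt_eqF.
by rewrite lnV ?posrE// lerN2.
Qed.

(** A discrete mean value inequality; it makes power sums telescope. *)
Lemma powR_succ_diff t n : 0 < t -> (0 < n)%N ->
  t * n.+1%:R `^ (- t - 1) <= n%:R `^ (- t) - n.+1%:R `^ (- t) :> R.
Proof.
move=> t0 n0.
have n0' : 0 < n%:R :> R by rewrite ltr0n.
have nS : 0 < n.+1%:R :> R by rewrite ltr0n.
have E : n.+1%:R = n%:R * (1 + n%:R^-1) :> R.
  by rewrite mulrDr divff ?gt_eqF// mulr1 -natr1.
have x0 : 0 <= n%:R^-1 :> R by rewrite invr_ge0 ltW.
have := powR_1D_ge x0 t0.
have -> : n%:R^-1 / (1 + n%:R^-1) = n.+1%:R^-1 :> R.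
  by rewrite -natr1; field; rewrite !gt_eqF// natr1.
move=> H.
have EP : n%:R `^ (- t) = n.+1%:R `^ (- t) * (1 + n%:R^-1) `^ t :> R.
  rewrite [in RHS]E powRM ?addr_ge0// ?ltW// -mulrA -powRD ?addNr ?powRr0 ?mulr1//.
  by rewrite eqxx /= gt_eqF// ltr_pwDl.
rewrite EP -[X in _ <= _ - X]mulr1 -mulrBr.
have -> : t * n.+1%:R `^ (- t - 1) = n.+1%:R `^ (- t) * (t * n.+1%:R^-1) :> R.
  by rewrite (powR_sub1 t nS) [in RHS]mulrC -mulrA mulKf// gt_eqF.
by rewrite ler_wpM2l ?powR_ge0// lerBrDr addrC.
Qed.

Lemma sum_powR_tail s n N : 1 < s -> (0 < n)%N ->
  \sum_(n.+1 <= m < N) m%:R `^ (- s) <= (s - 1)^-1 * n%:R `^ (- (s - 1)) :> R.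
Proof.
move=> s1 n0; have t0 : 0 < s - 1 by lra.
have [Nn|nN] := leqP N n.+1.
  by rewrite big_geq// mulr_ge0 ?invr_ge0 ?powR_ge0// ltW.
rewrite -(subnKC nN); move: (N - n.+2)%N => k; rewrite addSnnS addnS.
apply: (@le_trans _ _ ((s - 1)^-1 *
    (n%:R `^ (- (s - 1)) - (n.+1 + k)%:R `^ (- (s - 1))))).
  elim: k => [|k IH].
    rewrite addn0 big_nat1 ler_pdivlMl//.
    apply: le_trans (powR_succ_diff t0 n0).
    by rewrite opprB addrAC subrr sub0r.
  rewrite addnS big_nat_recr/=; last by rewrite -addnS leq_addr.
  have Hs : (s - 1)^-1 * ((s - 1) * (n.+1 + k).+1%:R `^ (- s)) <=
      (s - 1)^-1 * ((n.+1 + k)%:R `^ (- (s - 1)) - (n.+1 + k).+1%:R `^ (- (s - 1))) :> R.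
    rewrite ler_wpM2l// ?invr_ge0 ?(ltW t0)//.
    apply: le_trans (powR_succ_diff t0 _) => //.
    by rewrite opprB addrAC subrr sub0r.
  rewrite mulKf ?gt_eqF// in Hs.
  apply: le_trans (lerD IH Hs) _.
  by rewrite -mulrDr addrA subrK.
rewrite ler_wpM2l ?invr_ge0 ?(ltW t0)//.
by rewrite lerBlDr lerDl powR_ge0.
Qed.

Lemma sum_powR_le s N : 1 < s ->
  \sum_(1 <= m < N) m%:R `^ (- s) <= 1 + (s - 1)^-1 :> R.
Proof.
move=> s1; have t0 : 0 <= (s - 1)^-1 by rewrite invr_ge0; lra.
case: N => [|[|N]]; [by rewrite big_geq//; lra|by rewrite big_geq//; lra|].
rewrite big_ltn// powR1; rewrite lerD2l.
by apply: le_trans (sum_powR_tail N.+2 s1 (ltn0Sn 0)) _; rewrite powR1 mulr1.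
Qed.

Lemma powR_double s i j : 0 <= s -> (i <= j <= i.*2)%N ->
  i%:R `^ (- s) <= 2 `^ s * j%:R `^ (- s) :> R.
Proof.
move=> s0 /andP[ij ji]; case: i ij ji => [|i] ij ji.
  by move: ji; rewrite leqn0 => /eqP ->; rewrite ler_peMl ?powR_ge0// -[leLHS](powRr0 2) ler_powR// ler1n.
rewrite !powRN ler_pdivlMr ?powR_gt0 ?ltr0n ?(leq_trans _ ij)//.
rewrite ler_pdivrMl ?powR_gt0//.
rewrite -powRM ?ler0n// ge0_ler_powR// ?nnegrE ?mulr_ge0 ?ler0n//.
by rewrite -natrM ler_nat muln2.
Qed.

Lemma powR_nat_anti s i j : 0 <= s -> (0 < i)%N -> (i <= j)%N ->
  j%:R `^ (- s) <= i%:R `^ (- s) :> R.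
Proof.
move=> s0 i0 ij; rewrite !powRN lef_pV2 ?posrE ?powR_gt0 ?ltr0n// ?(leq_trans i0)//.
by rewrite ge0_ler_powR ?nnegrE ?ler0n// ler_nat.
Qed.

Lemma powR_nat_le1 s i : 0 <= s -> (0 < i)%N -> i%:R `^ (- s) <= 1 :> R.
Proof. move=> s0 i0; have := powR_nat_anti s0 (ltn0Sn 0) i0.
by rewrite powR1. Qed.

Lemma sum_powR_slow t n : 0 < t < 1 ->
  \sum_(1 <= i < n.+1) i%:R `^ (- t) <= (1 + 2 / (1 - t)) * n%:R `^ (1 - t) :> R.
Proof.
move=> /andP[t0 t1]; have u0 : 0 < 1 - t by lra.
elim: n => [|n IH].
  by rewrite big_geq// mulr_ge0 ?powR_ge0// addr_ge0 ?divr_ge0// ltW.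
rewrite big_nat_recr//=.
have nS : 0 < n.+1%:R :> R by rewrite ltr0n.
have S1 : n.+1%:R `^ (1 - t) = n.+1%:R * n.+1%:R `^ (- t) :> R.
  by rewrite powRB ?(lt0r_neq0 nS) ?implybT// powRr1 ?ltW// powRN.
case: n IH nS S1 => [|n] IH nS S1.
  by rewrite big_geq// add0r !powR1 mulr1 lerDl divr_ge0// ltW.
apply: le_trans (lerD IH (lexx _)) _.
have n0 : 0 < n.+1%:R :> R by rewrite ltr0n.
have x0 : 0 <= n.+1%:R^-1 :> R by rewrite invr_ge0 ltW.
have := powR_1D_ge x0 u0.
have -> : n.+1%:R^-1 / (1 + n.+1%:R^-1) = n.+2%:R^-1 :> R.
  by rewrite -[n.+2%:R]natr1; field; rewrite !gt_eqF// ?natr1 ltr0n.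
have E : n.+2%:R = n.+1%:R * (1 + n.+1%:R^-1) :> R.
  by rewrite mulrDr divff ?gt_eqF// mulr1 -[n.+2%:R]natr1.
move=> H.
have H1 : n.+1%:R `^ (1 - t) * (1 + (1 - t) * n.+2%:R^-1) <= n.+2%:R `^ (1 - t) :> R.
  rewrite [X in _ <= X `^ _]E powRM ?addr_ge0// ?(ltW n0)//.
  by rewrite ler_wpM2l ?powR_ge0.
have H2 : 2^-1 * n.+2%:R `^ (- t) <= n.+1%:R `^ (1 - t) * n.+2%:R^-1 :> R.
  have -> : n.+1%:R `^ (1 - t) = n.+1%:R * n.+1%:R `^ (- t) :> R.
    by rewrite powRB ?(lt0r_neq0 n0) ?implybT// powRr1 ?ltW// powRN.
  rewrite mulrAC; apply: ler_pM; rewrite ?powR_ge0 ?invr_ge0//.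
    rewrite ler_pdivlMr// ler_pdivrMl//.
    by rewrite -natrM ler_nat; lia.
  by rewrite powR_nat_anti// ltW.
have K0 : 0 < 2 / (1 - t) by rewrite divr_gt0.
have H3 : n.+2%:R `^ (- t) <= 2 / (1 - t) * ((1 - t) * n.+2%:R^-1) * n.+1%:R `^ (1 - t) :> R.
  rewrite mulrA divfK ?gt_eqF//.
  move: H2; rewrite ler_pdivrMl// => /le_trans; apply.
  by rewrite -mulrA [n.+2%:R^-1 * _]mulrC.
apply: (@le_trans _ _ ((1 + 2 / (1 - t)) * (n.+1%:R `^ (1 - t) * (1 + (1 - t) * n.+2%:R^-1)))); last first.
  by rewrite ler_wpM2l//; lra.
have q0 : 0 <= (1 - t) * n.+2%:R^-1 * n.+1%:R `^ (1 - t).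
  by rewrite !mulr_ge0 ?powR_ge0 ?invr_ge0// ltW.
set K := 2 / (1 - t) in H3 *; set A := n.+1%:R `^ _ in H3 q0 *.
set q := (1 - t) * _ in H3 q0 *; set B := n.+2%:R `^ _ in H3 *.
rewrite [leRHS](_ : _ = (1 + K) * A + (q * A + K * q * A)); last by ring.
by rewrite lerD2l (le_trans H3)// lerDr.
Qed.

(** In every term of a convolution one of the two indices is at least half of
    the total, and may be replaced by the total. *)
Lemma conv_doubling (A B : nat -> R) c n : 0 <= c ->
  (forall i, 0 <= A i) -> (forall i, 0 <= B i) ->
  (forall i, (i <= n <= i.*2)%N -> A i <= c * A n) ->
  (forall i, (i <= n <= i.*2)%N -> B i <= c * B n) ->
  forall m1 m2, (m2 <= n.+1)%N ->
  \sum_(m1 <= i < m2) A i * B (n - i)%N <=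
  c * (A n * (\sum_(m1 <= i < m2) B (n - i)%N) + B n * (\sum_(m1 <= i < m2) A i)).
Proof.
move=> c0 A0 B0 dA dB m1 m2 m2n; rewrite !mulr_sumr -big_split/= mulr_sumr.
apply: ler_sum_nat => i /andP[_ im2].
have iN : (i <= n)%N by rewrite -ltnS (leq_trans im2).
have [ni|ni] := leqP n i.*2.
  apply: (@le_trans _ _ (c * (A n * B (n - i)%N))).
    by rewrite mulrA ler_wpM2r// dA// iN ni.
  by rewrite ler_wpM2l// lerDl mulr_ge0.
apply: (@le_trans _ _ (c * (B n * A i))).
  rewrite [leRHS]mulrA mulrC ler_wpM2r// dB// leq_subr/=.
  by clear -ni; lia.
by rewrite ler_wpM2l// lerDr mulr_ge0.
Qed.

End PowerSums.

(** * Convolution of sequences and renewal equations *)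

Section Convolution.
Variable R : comPzRingType.
Implicit Types (u v w g f s phi : nat -> R) (n : nat).

Definition conv u v n : R := \sum_(i < n.+1) u i * v (n - i)%N.

Definition unit_seq n : R := (n == 0)%:R.

Lemma conv0 u v : conv u v 0 = u 0%N * v 0%N.
Proof. by rewrite /conv big_ord1. Qed.

Lemma convE u v n : conv u v n = \sum_(0 <= i < n.+1) u i * v (n - i)%N.
Proof. by rewrite big_mkord. Qed.

Lemma conv_recl u v n :
  conv u v n = u 0%N * v n + \sum_(1 <= i < n.+1) u i * v (n - i)%N.
Proof. by rewrite convE big_ltn// subn0. Qed.

Lemma convC u v : conv u v = conv v u.
Proof.
apply/funext => n; rewrite !convE big_nat_rev/=.
apply: eq_big_nat => i /andP[_ ilt]; rewrite add0n subSS mulrC.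
by rewrite subKn// -ltnS.
Qed.

Lemma conv_unit u : conv unit_seq u = u.
Proof.
apply/funext => n; rewrite conv_recl /unit_seq mul1r big_nat_cond big1 ?addr0//.
by move=> [|i]//=; rewrite mul0r.
Qed.

Lemma convBl u v w : conv (u - v) w = conv u w - conv v w.
Proof.
apply/funext => n; rewrite -[RHS]/(conv u w n - conv v w n) -sumrB.
by apply: eq_bigr => i _; rewrite -mulrBl.
Qed.

Lemma convBr u v w : conv w (u - v) = conv w u - conv w v.
Proof. by rewrite convC convBl !(convC w). Qed.

End Convolution.
Arguments unit_seq {R}.

Section ConvolutionAssoc.
Variable R : comNzRingType.
Implicit Types (u v w g f s phi : nat -> R) (n : nat).

Lemma coef_conv u v n j : (j <= n)%N ->
  ((\poly_(i < n.+1) u i) * (\poly_(i < n.+1) v i))`_j = conv u v j.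
Proof.
move=> jn; rewrite coefM; apply: eq_bigr => i _; rewrite !coef_poly.
have ij : (i <= j)%N by rewrite -ltnS.
by rewrite ltnS (leq_trans ij jn) ltnS (leq_trans (leq_subr _ _) jn).
Qed.

(** Only finitely many terms enter each value, so associativity is inherited
    from the product of polynomials. *)
Lemma convA u v w : conv u (conv v w) = conv (conv u v) w.
Proof.
apply/funext => n; pose P (x : nat -> R) := \poly_(i < n.+1) x i.
transitivity ((P u * (P v * P w))`_n).
  rewrite coefM; apply: eq_bigr => i _.
  by rewrite (coef_conv _ _ (leq_subr _ _)) coef_poly ltn_ord.
rewrite mulrA coefM; apply: eq_bigr => i _.
rewrite (coef_conv _ _ (_ : i <= n)%N) ?coef_poly; last by rewrite -ltnS.
by rewrite ltnS leq_subr.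
Qed.

(** [phi] has the generating function [1 / (1 - G(w))]. *)
Lemma renewal_unique g f s phi :
  conv (unit_seq - g) phi = unit_seq -> f = conv g f + s -> f = conv phi s.
Proof.
move=> Hphi Hf; rewrite -[f]conv_unit -Hphi convC convA (convC f) convBl conv_unit.
by rewrite {1}Hf addrAC subrr add0r convC.
Qed.

(** The value at [n] of the [k]-th Picard iterate is stationary once [k > n]. *)
Lemma resolvent_exists g : g 0%N = 0 -> exists phi, conv (unit_seq - g) phi = unit_seq.
Proof.
move=> g0; pose Psi (u : nat -> R) := unit_seq + conv g u.
pose it k := iter k Psi 0.
have st k n : (n < k)%N -> it k.+1 n = it k n.
  elim: k n => // k IH n nk.
  rewrite -[LHS]/(unit_seq n + conv g (it k.+1) n) -[RHS]/(unit_seq n + conv g (it k) n).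
  congr (_ + _); rewrite !conv_recl !g0 !mul0r !add0r; apply: eq_big_nat => i /andP[i0 ilt].
  by rewrite IH//; lia.
have st2 k n : (n < k)%N -> it k n = it n.+1 n.
  elim: k => // k IH; rewrite ltnS leq_eqVlt => /predU1P[->//|nk].
  by rewrite st// IH.
exists (fun n => it n.+1 n); rewrite convBl conv_unit.
apply/funext => n; apply/eqP; rewrite -[X in X == _]/(it n.+1 n - conv g _ n) subr_eq.
apply/eqP; rewrite -[LHS]/(unit_seq n + conv g (it n) n); congr (_ + _).
rewrite !conv_recl !g0 !mul0r !add0r; apply: eq_big_nat => i /andP[i0 ilt].
by rewrite st2//; lia.
Qed.

Lemma renewal_recursion g e f c : f 0%N = c ->
  (forall n, f n.+1 = \sum_(1 <= m < n.+2) g m * f (n.+1 - m)%N + e n.+1) ->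
  f = conv (fun m => if m is 0 then 0 else g m) f + (fun n => if n is 0 then c else e n).
Proof.
move=> f0 H; apply/funext => -[|n].
  by rewrite -[RHS]/(conv _ f 0 + c) conv0 mul0r add0r.
rewrite -[RHS]/(conv _ f n.+1 + e n.+1) conv_recl mul0r add0r H; congr (_ + _).
by apply: eq_big_nat => -[].
Qed.

(** Dividing by [1 - rho w] a power series with constant term 1. *)
Lemma geometric_conv (rho : R) :
  conv (unit_seq - (fun n => if n == 1%N then rho else 0)) (fun n => rho ^+ n) = unit_seq.
Proof.
rewrite convBl conv_unit; apply/funext => -[|n].
  by rewrite -[LHS]/(1 - conv _ _ 0) conv0 mul0r subr0.
rewrite -[LHS]/(rho ^+ n.+1 - conv _ _ n.+1) conv_recl mul0r add0r big_ltn//= subn1/= -exprS.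
by rewrite big_nat_cond big1 ?addr0 ?subrr// => -[|[|i]]//=; rewrite mul0r.
Qed.

End ConvolutionAssoc.

(** * Renewal sequences with almost all mass at index one *)

Section PerturbedUnit.
Variable R : realType.
Implicit Types (x e p w : nat -> R) (b c S : R).

(** A summable weight that varies little on dyadic blocks is submultiplicative
    up to a constant for convolution, so a small multiple of it stays
    under control when [1 + x] is inverted. *)
Lemma perturbed_unit_bound x e p w b c S N : 0 <= b -> 0 <= c ->
  (forall i, 0 <= w i) ->
  (forall i j, (i <= j <= i.*2)%N -> w i <= c * w j) ->
  (forall j, (j <= N)%N -> \sum_(1 <= i < j.+1) w i <= S) ->
  6 * b * c * S <= 1 ->
  p 0%N = 1 ->
  (forall j, (1 <= j <= N)%N -> p j = e j - \sum_(1 <= i < j.+1) x i * p (j - i)%N) ->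
  (forall j, (1 <= j <= N)%N -> `|x j| <= b * w j) ->
  (forall j, (1 <= j <= N)%N -> `|e j| <= b * w j) ->
  forall j, (1 <= j <= N)%N -> `|p j| <= 3 * b * w j.
Proof.
move=> b0 c0 w0 dw Sw small p0 Hp Hx He.
elim/ltn_ind => j IH /andP[j1 jN].
rewrite Hp ?j1// big_nat_recr//= subnn p0 mulr1.
have S1 : \sum_(1 <= i < j) w i <= S.
  apply: le_trans (Sw j jN); rewrite (big_nat_recr j)//=.
  by rewrite lerDl.
have S2 : \sum_(1 <= i < j) w (j - i)%N <= S.
  apply: le_trans S1; rewrite [leLHS]big_nat_rev/=.
  rewrite le_eqVlt; apply/orP; left; apply/eqP; apply: eq_big_nat => i /andP[i1 ij].
  by congr w; nlia.
have K : `|\sum_(1 <= i < j) x i * p (j - i)%N| <= b * w j.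
  apply: (@le_trans _ _ (\sum_(1 <= i < j) 3 * b * b * (w i * w (j - i)%N))).
    apply: le_trans (ler_norm_sum _ _ _) _; apply: ler_sum_nat => i /andP[i1 ij].
    rewrite normrM (_ : _ * _ * _ * _ = b * w i * (3 * b * w (j - i)%N)); last by ring.
    apply: ler_pM => //; first by rewrite Hx// i1/= (leq_trans _ jN)// ltnW.
    by apply: IH; nlia.
  rewrite -mulr_sumr.
  have := @conv_doubling R w w c j c0 w0 w0 (fun i => dw i j) (fun i => dw i j) 1 j (leqnSn j).
  move=> H.
  apply: (@le_trans _ _ (3 * b * b * (c * (w j * S + w j * S)))).
    apply: ler_wpM2l; first by rewrite !mulr_ge0.
    apply: le_trans H _; apply: ler_wpM2l => //.
    by apply: lerD; apply: ler_wpM2l.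
  rewrite (_ : _ * _ = (6 * b * c * S) * (b * w j)); last by ring.
  by rewrite ler_piMl// mulr_ge0.
rewrite opprD addrCA; apply: le_trans (ler_normD _ _) _.
rewrite normrN (_ : 3 * b * w j = b * w j + (b * w j + b * w j)); last by ring.
apply: lerD => //; apply: le_trans (ler_normD _ _) _; rewrite normrN.
by apply: lerD; [exact: He (introT andP (conj j1 jN))|exact: Hx (introT andP (conj j1 jN))].
Qed.

End PerturbedUnit.

Section RenewalBound.
Variable R : realType.
Variables (theta R0 : R) (M : nat).
Hypotheses (theta2 : 2 < theta) (M2 : (2 <= M)%N) (R01 : 1 <= R0).

(** [lam alpha i] compares [i] with the time [1 / alpha] at which a walk with
    killing rate [alpha] is killed. *)
Definition lam (alpha : R) (i : nat) : R := (1 + alpha * i%:R)^-1.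

(** The weight that controls the coefficients of [(1 - G) / (1 - rho w)]: the
    first part comes from indices far below [j], the second from those close
    to [j]. *)
Definition rweight (alpha : R) (j : nat) : R :=
  alpha * lam alpha j ^+ M + j%:R `^ (- (theta - 1)) * lam alpha j.

Variable alpha : R.
Hypotheses (alpha0 : 0 < alpha) (alpha3 : alpha <= 3).

Let th1 : 0 <= theta - 1. Proof. by have := theta2; lra. Qed.

Let den_gt0 i : 0 < 1 + alpha * i%:R.
Proof. by rewrite ltr_wpDr ?mulr_ge0// ltW. Qed.

Lemma lam_gt0 i : 0 < lam alpha i.
Proof. by rewrite invr_gt0. Qed.

Lemma lam_ge0 i : 0 <= lam alpha i.
Proof. exact/ltW/lam_gt0. Qed.

Lemma lam_le1 i : lam alpha i <= 1.
Proof. by rewrite invf_le1// lerDl mulr_ge0// ltW. Qed.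

Lemma lam_double i j : (j <= i.*2)%N -> lam alpha i <= 2 * lam alpha j.
Proof.
move=> ji; rewrite /lam ler_pdivlMr// ler_pdivrMl// mulrDr mulr1.
have : j%:R <= 2 * i%:R :> R by rewrite -natrM ler_nat mul2n.
move=> /(ler_wpM2l (ltW alpha0)) H.
by nra.
Qed.

Lemma lamX_le2 i k : (2 <= k)%N -> lam alpha i ^+ k <= lam alpha i ^+ 2.
Proof. by move=> k2; rewrite ler_wiXn2l// ?lam_ge0// lam_le1. Qed.

Lemma lamX_le1 i k : (1 <= k)%N -> lam alpha i ^+ k <= lam alpha i.
Proof. by move=> k2; rewrite -[leRHS]expr1 ler_wiXn2l// ?lam_ge0// lam_le1. Qed.

Lemma sum_lam2 n : \sum_(1 <= i < n.+1) lam alpha i ^+ 2 <= n%:R * lam alpha n.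
Proof.
elim: n => [|n IH]; first by rewrite big_geq// mul0r.
rewrite big_nat_recr//=; apply: le_trans (lerD IH (lexx _)) _.
have d0 := den_gt0 n; have d1 := den_gt0 n.+1.
have -> : n.+1%:R * lam alpha n.+1 = n%:R * lam alpha n + lam alpha n * lam alpha n.+1.
  rewrite /lam; have -> : n.+1%:R = n%:R + 1 :> R by rewrite natr1.
  by field; rewrite !gt_eqF//; move: d1; rewrite -natr1.
rewrite lerD2l expr2 ler_wpM2r ?lam_ge0// /lam lef_pV2 ?posrE// lerD2l.
by rewrite ler_wpM2l ?(ltW alpha0)// ler_nat.
Qed.

Lemma lam_lower n : (1 <= n)%N -> 1 <= 4 * (n%:R * lam alpha n).
Proof.
move=> n1; rewrite /lam mulrA ler_pdivlMr// mul1r.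
have : 1 <= n%:R :> R by rewrite ler1n.
by move: alpha0 alpha3 => h h' h2; nra.
Qed.

Lemma sum_lam_rev n : (1 <= n)%N ->
  \sum_(1 <= i < n.+1) lam alpha (n - i) ^+ M <= 5 * (n%:R * lam alpha n).
Proof.
move=> n1.
apply: (@le_trans _ _ (1 + \sum_(1 <= i < n.+1) lam alpha i ^+ 2)).
  rewrite big_nat_recr//= subnn addrC.
  apply: lerD; first by rewrite exprn_ile1 ?lam_ge0 ?lam_le1.
  rewrite [leLHS]big_nat_rev/= (big_nat_recr n)//=.
  rewrite ler_wpDr ?exprn_ge0 ?lam_ge0//; apply: ler_sum_nat => i /andP[i1 ij].
  rewrite (_ : (n - (1 + n - i.+1))%N = i); last by nlia.
  exact: lamX_le2.
have := sum_lam2 n; have := lam_lower n1; lra.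
Qed.

Lemma rweight_ge0 i : 0 <= rweight alpha i.
Proof.
by rewrite addr_ge0// mulr_ge0 ?exprn_ge0 ?lam_ge0 ?powR_ge0// ltW.
Qed.

Let cD : R := 2 ^+ M + 2 * 2 `^ (theta - 1).

Lemma lamX_double i j k : (j <= i.*2)%N -> lam alpha i ^+ k <= 2 ^+ k * lam alpha j ^+ k.
Proof. by move=> ij; rewrite -exprMn lerXn2r ?nnegrE ?mulr_ge0 ?lam_ge0// lam_double. Qed.

Lemma rweight_double i j : (i <= j <= i.*2)%N -> rweight alpha i <= cD * rweight alpha j.
Proof.
move=> ij; have /andP[_ ji] := ij.
have a1 : 0 <= alpha * lam alpha j ^+ M by rewrite mulr_ge0 ?exprn_ge0 ?lam_ge0// ltW.
have a2 : 0 <= j%:R `^ (- (theta - 1)) * lam alpha j by rewrite mulr_ge0 ?powR_ge0 ?lam_ge0.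
have b1 : alpha * lam alpha i ^+ M <= 2 ^+ M * (alpha * lam alpha j ^+ M).
  by rewrite mulrCA ler_wpM2l ?(ltW alpha0)// lamX_double.
have b2 : i%:R `^ (- (theta - 1)) * lam alpha i <=
    2 * 2 `^ (theta - 1) * (j%:R `^ (- (theta - 1)) * lam alpha j).
  rewrite -mulrA mulrCA mulrA [X in _ <= X]mulrACA.
  rewrite mulrA; apply: le_trans (ler_pM (powR_ge0 _ _) (lam_ge0 _) (powR_double th1 ij) (lam_double ji)) _.
  by rewrite le_eqVlt; apply/orP; left; apply/eqP; ring.
have p1 : 0 <= 2 ^+ M :> R by rewrite exprn_ge0.
have p2 : 0 <= 2 * 2 `^ (theta - 1) :> R by rewrite mulr_ge0 ?powR_ge0.
rewrite /rweight /cD; nra.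
Qed.

Let S := 2 + (theta - 2)^-1.

Lemma sum_rweight n : \sum_(1 <= i < n.+1) rweight alpha i <= S.
Proof.
rewrite /rweight big_split/=.
have A : \sum_(1 <= i < n.+1) alpha * lam alpha i ^+ M <= 1.
  rewrite -mulr_sumr; apply: (@le_trans _ _ (alpha * (n%:R * lam alpha n))).
    rewrite ler_wpM2l ?(ltW alpha0)//; apply: le_trans (sum_lam2 n).
    by apply: ler_sum_nat => i _; exact: lamX_le2.
  by rewrite /lam mulrA ler_pdivrMr// mul1r lerDr.
have B : \sum_(1 <= i < n.+1) i%:R `^ (- (theta - 1)) * lam alpha i <= 1 + (theta - 2)^-1.
  have -> : theta - 2 = (theta - 1) - 1 by ring.
  apply: le_trans (sum_powR_le n.+1 (_ : 1 < theta - 1)); last by have := theta2; lra.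
  by apply: ler_sum_nat => i _; rewrite ler_piMr ?powR_ge0// lam_le1.
by rewrite /S; lra.
Qed.

Lemma natr_powR j : (1 <= j)%N ->
  j%:R * j%:R `^ (- theta) = j%:R `^ (- (theta - 1)) :> R.
Proof.
move=> j1; rewrite (powR_sub1 (theta - 1)) ?ltr0n//; congr (_ * _ `^ _); ring.
Qed.

Variables (b rho : R) (N : nat) (g : nat -> R).
Hypotheses (b0 : 0 <= b)
  (Hrho : forall i, (i <= N)%N -> `|rho| ^+ i <= R0 * lam alpha i ^+ M)
  (H1rho : `|1 - rho| <= R0 * alpha)
  (Drho : rho = \sum_(1 <= i < N.+1) g i)
  (Hg : forall i, (2 <= i <= N)%N -> `|g i| <= b * i%:R `^ (- theta)).

Let T1 : R := 2 * R0 * R0 * 2 `^ theta.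
Let T2 : R := 2 ^+ M * R0 ^+ 3.
Let C1 : R := 5 * T1 + T2 * S + 4 * R0.

Let R00 : 0 <= R0. Proof. by rewrite (le_trans _ R01). Qed.

Let rho_le i : (i <= N)%N -> `|rho| ^+ i <= R0.
Proof.
move=> iN; apply: le_trans (Hrho iN) _.
by rewrite ler_piMr// exprn_ile1 ?lam_ge0 ?lam_le1.
Qed.

Let one_sub_rhoX l : (l <= N)%N -> `|1 - rho ^+ l| <= l%:R * (R0 * R0 * alpha).
Proof.
move=> lN; rewrite -[X in X - _](expr1n _ l) subrXX normrM.
rewrite mulrC -mulrA mulrA; apply: ler_pM => //.
apply: le_trans (ler_norm_sum _ _ _) _.
rewrite -[l in l%:R]card_ord -sum1_card natr_sum mulr_suml; apply: ler_sum => i _.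
by rewrite expr1n mul1r mul1r normrX rho_le// (leq_trans _ lN)// ltnW.
Qed.

(** If [i] is at least [j / 2] the kernel itself is small; otherwise the factor
    [1 - rho ^+ i.-1] is of order [alpha * i]. *)
Let term_bound i j : (2 <= i <= j)%N -> (j <= N)%N ->
  `|(rho ^+ j.-1 - rho ^+ (j - i)) * g i| <=
  T1 * b * (j%:R `^ (- theta) * lam alpha (j - i) ^+ M) +
  T2 * b * (alpha * lam alpha j ^+ M * i%:R `^ (- (theta - 1))).
Proof.
move=> /andP[i2 ij] jN.
have p1 : 0 <= T1 * b * (j%:R `^ (- theta) * lam alpha (j - i) ^+ M).
  by rewrite !mulr_ge0 ?powR_ge0 ?exprn_ge0 ?lam_ge0.
have p2 : 0 <= T2 * b * (alpha * lam alpha j ^+ M * i%:R `^ (- (theta - 1))).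
  by rewrite !mulr_ge0 ?powR_ge0 ?exprn_ge0 ?lam_ge0// ltW.
have -> : rho ^+ j.-1 - rho ^+ (j - i) = - (rho ^+ (j - i) * (1 - rho ^+ i.-1)).
  by rewrite mulrBr mulr1 opprB -exprD; congr (_ ^+ _ - _); nlia.
have Hgi : `|g i| <= b * i%:R `^ (- theta) by rewrite Hg// i2 (leq_trans ij).
have Hr : `|rho ^+ (j - i)| <= R0 * lam alpha (j - i) ^+ M.
  by rewrite normrX Hrho// (leq_trans (leq_subr _ _)).
rewrite normrM normrN normrM.
have [ji|ji] := leqP j i.*2.
  apply: ler_wpDr => //.
  have H2 : `|1 - rho ^+ i.-1| <= 2 * R0.
    apply: le_trans (ler_normB _ _) _; rewrite normr1 normrX.
    have iN : (i.-1 <= N)%N by nlia.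
    by have := rho_le iN; move: R01; lra.
  have := ler_pM (mulr_ge0 (normr_ge0 _) (normr_ge0 _)) (normr_ge0 _)
    (ler_pM (normr_ge0 _) (normr_ge0 _) Hr H2) Hgi.
  move=> /le_trans; apply.
  rewrite (_ : T1 * _ * _ = R0 * lam alpha (j - i) ^+ M * (2 * R0) * (b * (2 `^ theta * j%:R `^ (- theta)))); last by rewrite /T1; ring.
  apply: ler_wpM2l; first by rewrite !mulr_ge0 ?exprn_ge0 ?lam_ge0.
  by apply: ler_wpM2l => //; apply: powR_double; [move: theta2; lra|rewrite ij].
apply: ler_wpDl => //.
have H2 : `|1 - rho ^+ i.-1| <= i%:R * (R0 * R0 * alpha).
  apply: le_trans (one_sub_rhoX (_ : i.-1 <= N)%N) _; first by nlia.
  by rewrite ler_wpM2r ?ler_nat ?leq_pred// !mulr_ge0// ltW.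
have H3 : R0 * lam alpha (j - i) ^+ M <= R0 * (2 ^+ M * lam alpha j ^+ M).
  by rewrite ler_wpM2l// lamX_double//; nlia.
have := ler_pM (mulr_ge0 (normr_ge0 _) (normr_ge0 _)) (normr_ge0 _)
    (ler_pM (normr_ge0 _) (normr_ge0 _) (le_trans Hr H3) H2) Hgi.
move=> /le_trans; apply.
rewrite -natr_powR; last by nlia.
by rewrite le_eqVlt; apply/orP; left; apply/eqP; rewrite /T2; ring.
Qed.

(** With [rho] the total mass, the coefficient of index [j] loses its leading
    part: the terms with [i] small against [j] carry a factor [1 - rho ^ i],
    and the missing terms [i > j] are a tail. *)
Lemma quotient_bound j : (1 <= j <= N)%N ->
  `|rho ^+ j - \sum_(1 <= i < j.+1) rho ^+ (j - i) * g i| <= C1 * b * rweight alpha j.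
Proof.
move=> /andP[j1 jN].
have E : rho ^+ j - \sum_(1 <= i < j.+1) rho ^+ (j - i) * g i =
    \sum_(2 <= i < j.+1) (rho ^+ j.-1 - rho ^+ (j - i)) * g i +
    rho ^+ j.-1 * \sum_(j.+1 <= i < N.+1) g i.
  have -> : rho ^+ j = rho ^+ j.-1 * rho by rewrite -exprSr prednK.
  rewrite {2}Drho (@big_cat_nat _ _ _ j.+1)//= mulrDr addrAC; congr (_ + _).
  rewrite mulr_sumr -sumrB [LHS]big_ltn// -subn1 subrr add0r.
  by apply: eq_bigr => i _; rewrite mulrBl.
rewrite E; apply: le_trans (ler_normD _ _) _.
have B2 : `|rho ^+ j.-1 * \sum_(j.+1 <= i < N.+1) g i| <= 4 * R0 * b * (j%:R `^ (- (theta - 1)) * lam alpha j).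
  rewrite normrM normrX.
  have h1 : `|rho| ^+ j.-1 <= R0 * (4 * lam alpha j).
    apply: le_trans (Hrho _) _; first by nlia.
    rewrite ler_wpM2l//; apply: le_trans (lamX_le1 _ (ltnW M2)) _.
    rewrite /lam ler_pdivlMr// ler_pdivrMl//.
    have -> : j%:R = j.-1%:R + 1 :> R by rewrite natr1 prednK.
    have := ler0n R j.-1; move: (j.-1%:R) alpha0 alpha3 => x h h' hx; nra.
  have h2 : `|\sum_(j.+1 <= i < N.+1) g i| <= b * j%:R `^ (- (theta - 1)).
    apply: le_trans (ler_norm_sum _ _ _) _.
    apply: (@le_trans _ _ (b * \sum_(j.+1 <= i < N.+1) i%:R `^ (- theta))).
      rewrite mulr_sumr; apply: ler_sum_nat => i /andP[ji iN]; apply: Hg; nlia.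
    rewrite ler_wpM2l//; apply: le_trans (sum_powR_tail _ _ j1) _; first by move: theta2; lra.
    by rewrite ler_piMl ?powR_ge0// invf_le1; move: theta2; lra.
  apply: le_trans (ler_pM (exprn_ge0 _ (normr_ge0 _)) (normr_ge0 _) h1 h2) _.
  by rewrite le_eqVlt; apply/orP; left; apply/eqP; ring.
have B1 : `|\sum_(2 <= i < j.+1) (rho ^+ j.-1 - rho ^+ (j - i)) * g i| <=
    5 * T1 * b * (j%:R `^ (- (theta - 1)) * lam alpha j) + T2 * S * b * (alpha * lam alpha j ^+ M).
  apply: le_trans (ler_norm_sum _ _ _) _.
  apply: (@le_trans _ _ (\sum_(1 <= i < j.+1)
    (T1 * b * (j%:R `^ (- theta) * lam alpha (j - i) ^+ M) +
     T2 * b * (alpha * lam alpha j ^+ M * i%:R `^ (- (theta - 1)))))).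
    rewrite [leRHS]big_ltn// ler_wpDl//.
      by rewrite addr_ge0// !mulr_ge0 ?powR_ge0 ?exprn_ge0 ?lam_ge0// ltW.
    by apply: ler_sum_nat => i /andP[i2 ij]; apply: term_bound => //; rewrite i2.
  rewrite big_split/= -!mulr_sumr; apply: lerD.
    rewrite (_ : 5 * T1 * b * _ = T1 * b * (j%:R `^ (- theta) * (5 * (j%:R * lam alpha j)))); last first.
      by rewrite -natr_powR//; ring.
    by rewrite !ler_wpM2l ?powR_ge0 ?sum_lam_rev// !mulr_ge0// ?powR_ge0.
  rewrite (_ : T2 * S * b * _ = T2 * b * (alpha * lam alpha j ^+ M * S)); last by ring.
  rewrite ler_wpM2l ?mulr_ge0 ?exprn_ge0// ler_wpM2l ?mulr_ge0 ?exprn_ge0 ?lam_ge0 ?(ltW alpha0)//.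
  apply: le_trans (sum_powR_le j.+1 (_ : 1 < theta - 1)) _; first by move: theta2; lra.
  by rewrite /S (_ : theta - 1 - 1 = theta - 2); [lra|ring].
have a1 : 0 <= alpha * lam alpha j ^+ M by rewrite mulr_ge0 ?exprn_ge0 ?lam_ge0// ltW.
have a2 : 0 <= j%:R `^ (- (theta - 1)) * lam alpha j by rewrite mulr_ge0 ?powR_ge0 ?lam_ge0.
apply: le_trans (lerD B1 B2) _; rewrite /C1 /rweight.
set A := alpha * _ in a1 *; set B := _ * lam alpha j in a2 *.
rewrite [leRHS](_ : _ = 5 * T1 * b * B + T2 * S * b * A + 4 * R0 * b * B +
   ((5 * T1 + 4 * R0) * b * A + T2 * S * b * B)); last by ring.
have S0 : 0 <= S by rewrite addr_ge0// invr_ge0; move: theta2; lra.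
have T10 : 0 <= T1 by rewrite !mulr_ge0 ?powR_ge0.
have T20 : 0 <= T2 by rewrite !mulr_ge0 ?exprn_ge0.
clearbody A B; rewrite lerDl addr_ge0//; first by do 2!apply: mulr_ge0 => //; rewrite addr_ge0 ?mulr_ge0.
by rewrite !mulr_ge0.
Qed.

Variables (E f : nat -> R).
Hypotheses (g00 : g 0%N = 0) (E0 : E 0%N = 1) (Hf : f = conv g f + E)
  (HE : forall i, (1 <= i <= N)%N -> `|E i| <= b * i%:R `^ (- theta)).

Let C2 : R := C1 + 4.
Let Cf : R := R0 + 3 * C2 * b * R0 * cD * (5 + S).

(** [f] is the sequence of powers of [rho] convolved with [p], where [p] has the
    generating function [(1 - rho w) F(w)]. As [F = E / (1 - G)], [p] solves the
    equation with the coefficients of [(1 - G) / (1 - rho w)], which is a small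
    perturbation of 1. *)
Lemma renewal_bound_aux j : 6 * (C2 * b) * cD * S <= 1 -> (1 <= j <= N)%N ->
  `|f j| <= Cf * (lam alpha j ^+ M + j%:R `^ (- (theta - 2)) * lam alpha j ^+ 2).
Proof.
move=> small /andP[j1 jN].
pose r n := rho ^+ n : R.
pose y := conv r (unit_seq - g).
pose s1 := (unit_seq - (fun n => if n == 1%N then rho else 0)) : nat -> R.
pose p := conv s1 f.
have rs1 : conv s1 r = unit_seq by exact: geometric_conv.
have gf : conv (unit_seq - g) f = E by rewrite convBl conv_unit {1}Hf addrAC subrr add0r.
have yp : conv y p = E.
  by rewrite /y /p -convA (convA _ s1) (convC _ s1) -convA gf convA (convC r) rs1 conv_unit.
have fr : f = conv r p by rewrite /p convA (convC r) rs1 conv_unit.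
have yE n : y n = rho ^+ n - \sum_(1 <= i < n.+1) rho ^+ (n - i) * g i.
  rewrite /y convBr convC conv_unit -[LHS]/(rho ^+ n - conv r g n) convC conv_recl g00 mul0r add0r.
  by congr (_ - _); apply: eq_bigr => i _; rewrite mulrC.
have y0 : y 0%N = 1 by rewrite yE big_geq// subr0.
have p0 : p 0%N = 1.
  rewrite /p conv0 /s1 -[LHS]/((1 - 0) * f 0%N) subr0 mul1r Hf -[LHS]/(conv g f 0 + E 0%N).
  by rewrite conv0 g00 mul0r add0r.
have S0 : 0 <= S by rewrite /S addr_ge0// invr_ge0; move: theta2; lra.
have T10 : 0 <= T1 by rewrite !mulr_ge0 ?powR_ge0.
have T20 : 0 <= T2 by rewrite !mulr_ge0 ?exprn_ge0.
have C10 : 0 <= C1 by rewrite !addr_ge0// ?mulr_ge0.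
have C20 : 0 <= C2 * b by rewrite mulr_ge0// addr_ge0.
have cD0 : 0 <= cD by rewrite addr_ge0 ?mulr_ge0 ?powR_ge0 ?exprn_ge0.
have pb i : (1 <= i <= N)%N -> `|p i| <= 3 * (C2 * b) * rweight alpha i.
  apply: (@perturbed_unit_bound R y E p (rweight alpha) (C2 * b) cD S N) => //.
  - exact: rweight_ge0.
  - exact: rweight_double.
  - by move=> k _; exact: sum_rweight.
  - move=> k /andP[k1 kN]; have := congr1 (fun h => h k) yp.
    by rewrite /= conv_recl y0 mul1r => <-; rewrite addrK.
  - move=> k kN; rewrite yE; apply: le_trans (quotient_bound kN) _.
    by rewrite ler_wpM2r ?rweight_ge0// ler_wpM2r// lerDl.
  - move=> k /andP[k1 kN]; apply: le_trans (HE _) _; first by rewrite k1.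
    apply: (@le_trans _ _ (b * (4 * rweight alpha k))); last first.
      by rewrite mulrA ler_wpM2r ?rweight_ge0// mulrC ler_wpM2r// lerDr.
    rewrite ler_wpM2l// /rweight mulrDr ler_wpDl//.
      by rewrite !mulr_ge0 ?exprn_ge0 ?lam_ge0// ltW.
    rewrite -natr_powR// mulrAC mulrA ler_peMl ?powR_ge0//.
    by have := lam_lower k1; rewrite mulrA.
have Lj := lam_ge0 j.
rewrite fr convC conv_recl p0 mul1r; apply: le_trans (ler_normD _ _) _.
have B1 : `|r j| <= R0 * lam alpha j ^+ M by rewrite normrX Hrho.
have B2 : `|\sum_(1 <= i < j.+1) p i * r (j - i)%N| <= 3 * C2 * b * R0 * cD * (5 + S) *
    (lam alpha j ^+ M + j%:R `^ (- (theta - 2)) * lam alpha j ^+ 2).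
  apply: (@le_trans _ _ (3 * (C2 * b) * R0 *
      \sum_(1 <= i < j.+1) rweight alpha i * lam alpha (j - i) ^+ M)).
    rewrite mulr_sumr; apply: le_trans (ler_norm_sum _ _ _) _; apply: ler_sum_nat => i /andP[i1 ij].
    rewrite normrM [leRHS](_ : _ = (3 * (C2 * b) * rweight alpha i) * (R0 * lam alpha (j - i) ^+ M)); last by ring.
    apply: ler_pM => //; first by apply: pb; nlia.
    by rewrite normrX Hrho//; nlia.
  rewrite [leRHS](_ : _ = 3 * (C2 * b) * R0 * (cD * ((5 + S) *
    (lam alpha j ^+ M + j%:R `^ (- (theta - 2)) * lam alpha j ^+ 2)))); last by ring.
  apply: ler_wpM2l; first by rewrite !mulr_ge0// addr_ge0.
  have lam_cD i : (i <= j <= i.*2)%N -> lam alpha i ^+ M <= cD * lam alpha j ^+ M.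
    move=> /andP[_ ji]; apply: le_trans (lamX_double M ji) _.
    by rewrite ler_wpM2r ?exprn_ge0 ?lam_ge0// lerDl mulr_ge0// powR_ge0.
  have H := @conv_doubling R (rweight alpha) (fun i => lam alpha i ^+ M) cD j cD0 rweight_ge0
    (fun i => exprn_ge0 M (lam_ge0 i)) (fun i => @rweight_double i j) lam_cD 1 j.+1 (leqnn _).
  apply: le_trans H _; apply: ler_wpM2l => //.
  have h1 : rweight alpha j * \sum_(1 <= i < j.+1) lam alpha (j - i) ^+ M <=
     rweight alpha j * (5 * (j%:R * lam alpha j)).
    by rewrite ler_wpM2l ?rweight_ge0// sum_lam_rev.
  have h2 : lam alpha j ^+ M * \sum_(1 <= i < j.+1) rweight alpha i <= lam alpha j ^+ M * S.
    by rewrite ler_wpM2l ?exprn_ge0// sum_rweight.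
  apply: le_trans (lerD h1 h2) _.
  have h3 : rweight alpha j * (j%:R * lam alpha j) <=
      lam alpha j ^+ M + j%:R `^ (- (theta - 2)) * lam alpha j ^+ 2.
    rewrite /rweight mulrDl; apply: lerD.
      rewrite mulrAC mulrA mulrC ler_piMr ?exprn_ge0//.
      by rewrite /lam ler_pdivrMr// mul1r lerDr.
    rewrite (_ : _ * _ * _ = j%:R * j%:R `^ (- (theta - 1)) * lam alpha j ^+ 2); last by ring.
    have -> : j%:R * j%:R `^ (- (theta - 1)) = j%:R `^ (- (theta - 2)) :> R; last by [].
    rewrite (powR_sub1 (theta - 2)) ?ltr0n//; congr (_ * _ `^ _); ring.
  have h4 : 0 <= j%:R `^ (- (theta - 2)) * lam alpha j ^+ 2 by rewrite mulr_ge0 ?powR_ge0 ?exprn_ge0.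
  have h5 : 0 <= lam alpha j ^+ M by rewrite exprn_ge0.
  rewrite mulrA (mulrC _ 5) -mulrA; nra.
apply: le_trans (lerD B1 B2) _.
rewrite /Cf [leRHS]mulrDl lerD2r ler_wpM2l// lerDl.
by rewrite mulr_ge0 ?powR_ge0 ?exprn_ge0.
Qed.

End RenewalBound.

(** A renewal sequence whose kernel has total mass [rho] and only a small part
    off index 1 stays close to [rho ^+ j]. The correction decays like the kernel
    times [alpha ^- 2]: a single long jump, preceded and followed by periods of
    length [1 / alpha] at most. *)
Lemma renewal_bound (R : realType) (theta R0 : R) (M : nat) :
  2 < theta -> (2 <= M)%N -> 1 <= R0 ->
  exists b1 C : R, [/\ 0 < b1, 0 < C &
    forall (alpha b rho : R) (N : nat) (g E f : nat -> R),
    0 < alpha <= 3 -> 0 <= b <= b1 ->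
    (forall i, (i <= N)%N -> `|rho| ^+ i <= R0 * lam alpha i ^+ M) ->
    `|1 - rho| <= R0 * alpha ->
    rho = \sum_(1 <= i < N.+1) g i ->
    (forall i, (2 <= i <= N)%N -> `|g i| <= b * i%:R `^ (- theta)) ->
    g 0%N = 0 -> E 0%N = 1 -> f = conv g f + E ->
    (forall i, (1 <= i <= N)%N -> `|E i| <= b * i%:R `^ (- theta)) ->
    forall j, (1 <= j <= N)%N ->
    `|f j| <= C * (lam alpha j ^+ M + j%:R `^ (- (theta - 2)) * lam alpha j ^+ 2)].
Proof.
move=> th2 M2 R01.
pose S := 2 + (theta - 2)^-1.
pose T1 : R := 2 * R0 * R0 * 2 `^ theta.
pose T2 : R := 2 ^+ M * R0 ^+ 3.
pose C2 : R := 5 * T1 + T2 * S + 4 * R0 + 4.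
pose cD : R := 2 ^+ M + 2 * 2 `^ (theta - 1).
have R00 : 0 <= R0 by lra.
have S0 : 0 < S by rewrite addr_gt0// invr_gt0; lra.
have T10 : 0 <= T1 by rewrite !mulr_ge0 ?powR_ge0.
have T20 : 0 <= T2 by rewrite !mulr_ge0 ?exprn_ge0.
have C20 : 0 < C2 by rewrite ltr_wpDl// !addr_ge0 ?mulr_ge0// ltW.
have cD0 : 0 < cD by rewrite addr_gt0 ?mulr_gt0 ?powR_gt0 ?exprn_gt0.
exists (Num.min 1 (6 * C2 * cD * S)^-1), (R0 + 3 * C2 * R0 * cD * (5 + S)); split.
- by rewrite lt_min ltr01 invr_gt0 !mulr_gt0.
- have C2' := ltW C20; have cD' := ltW cD0; have S' := ltW S0.
  apply: (lt_le_trans ltr01); apply: le_trans R01 _; rewrite lerDl.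
  by apply: mulr_ge0; [apply: mulr_ge0 => //; apply: mulr_ge0 => //; apply: mulr_ge0|apply: addr_ge0].
move=> alpha b rho N g E f /andP[a0 a3] /andP[b0]; rewrite le_min => /andP[b1 b2].
move=> Hrho H1rho Drho Hg g0 E0 Hf HE j jN.
have small : 6 * (C2 * b) * cD * S <= 1.
  rewrite (_ : _ * S = b * (6 * C2 * cD * S)); last by ring.
  by rewrite -ler_pdivlMr ?mul1r// !mulr_gt0.
apply: le_trans (renewal_bound_aux th2 M2 R01 a0 a3 b0 Hrho H1rho Drho Hg g0 E0 Hf HE small jN) _.
apply: ler_wpM2r; first by rewrite addr_ge0 ?mulr_ge0 ?exprn_ge0 ?powR_ge0// (lam_ge0 a0).
rewrite lerD2l -/S -/T1 -/T2 -/C2 -/cD.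
have C2' := ltW C20; have cD' := ltW cD0; have S' := ltW S0.
clearbody C2 cD S.
have S5 : 0 <= 5 + S by apply: addr_ge0.
apply: ler_wpM2r => //; apply: ler_wpM2r => //.
by apply: ler_wpM2r => //; rewrite ler_piMr// mulr_ge0.
Qed.

(** * The critical renewal equation *)

Section TailSums.
Variable R : realType.
Implicit Types (u : nat -> R) (s B : R).

Lemma psum1_series u : psum1 u = series (fun m => if m is 0 then 0 else u m).
Proof.
apply/funext => -[|n]; first by rewrite /psum1 /series/= big_geq// big_geq.
rewrite /psum1 /series/= [RHS]big_ltn// add0r.
by apply: eq_big_nat => -[].
Qed.

Lemma sum1_tail u s B : 1 < s -> 0 <= B ->
  (forall m, (2 <= m)%N -> `|u m| <= B * m%:R `^ (- s)) ->
  summable1 u /\ forall n, (1 <= n)%N ->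
  `|sum1 u - \sum_(1 <= m < n.+1) u m| <= B * (s - 1)^-1 * n%:R `^ (- (s - 1)).
Proof.
move=> s1 B0 Hu.
have cu : cvgn (psum1 u).
  rewrite psum1_series; apply: normed_cvg.
  apply: nondecreasing_is_cvgn.
    by apply: nondecreasing_series => i _ _; exact: normr_ge0.
  exists (`|u 1%N| + B * (1 + (s - 1)^-1)) => _ [n _ <-].
  have s10 : 0 <= (s - 1)^-1 by rewrite invr_ge0; lra.
  rewrite -[leLHS]/(\sum_(0 <= k < n) `|if k is 0 then 0 else u k|); case: n => [|[|n]].
  - by rewrite big_geq// addr_ge0// mulr_ge0// addr_ge0.
  - by rewrite big_nat1 normr0 addr_ge0// mulr_ge0// addr_ge0.
  rewrite big_ltn// normr0 add0r big_ltn// lerD2l.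
  apply: (@le_trans _ _ (B * \sum_(2 <= m < n.+2) m%:R `^ (- s))).
    rewrite mulr_sumr; apply: ler_sum_nat => -[//|m] /andP[m2 _]; exact: Hu.
  rewrite ler_wpM2l//; apply: le_trans (sum_powR_le n.+2 s1).
  by rewrite [leRHS]big_ltn// lerDr powR_ge0.
split => // n n1.
have cn : (fun N => `|psum1 u N - \sum_(1 <= m < n.+1) u m|) @ \oo -->
    `|sum1 u - \sum_(1 <= m < n.+1) u m|.
  by apply: cvg_norm; apply: cvgB => //; exact: cvg_cst.
rewrite -(cvg_lim _ cn)//; apply: limr_le; first by apply/cvg_ex; eexists; exact: cn.
exists n.+1 => // N /= nN.
rewrite /psum1 (@big_cat_nat _ _ _ n.+1)//= addrAC subrr add0r.
apply: le_trans (ler_norm_sum _ _ _) _.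
apply: (@le_trans _ _ (B * \sum_(n.+1 <= m < N) m%:R `^ (- s))).
  rewrite mulr_sumr; apply: ler_sum_nat => m /andP[nm _]; apply: Hu; nlia.
by rewrite -mulrA ler_wpM2l// sum_powR_tail.
Qed.

(** One constant above all the power sums that occur, so that a single
    smallness condition on [b] suffices. *)
Definition ctail (theta : R) : R := 2 + 2 `^ (theta - 1) * (2 + (theta - 2)^-1).

Lemma ctail_bounds theta : 2 < theta ->
  [/\ 2 `^ (theta - 1) * (1 + (theta - 2)^-1) <= ctail theta,
      2 + (theta - 2)^-1 <= ctail theta & 4 <= ctail theta].
Proof.
move=> th2; have i0 : 0 < (theta - 2)^-1 by rewrite invr_gt0; lra.
have p2 : 1 <= 2 `^ (theta - 1) :> R.
  by rewrite -[leLHS](powRr0 2) ler_powR ?ler1n//; lra.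
by rewrite /ctail; split; nra.
Qed.

(** The first exponent is summable, so the convolution decays like the second
    factor. *)
Lemma conv_tail theta u v U V n : 2 < theta -> 0 <= U -> 0 <= V ->
  `|u 0%N| <= U -> `|v 0%N| <= V ->
  (forall i, (1 <= i)%N -> `|u i| <= U * i%:R `^ (- (theta - 1))) ->
  (forall i, (1 <= i)%N -> `|v i| <= V * i%:R `^ (- (theta - 2))) ->
  (1 <= n)%N -> `|conv u v n| <= ctail theta * (U * V) * n%:R `^ (- (theta - 2)).
Proof.
move=> th2 U0 V0 u0 v0 Hu Hv n1.
have i0 : 0 < (theta - 2)^-1 by rewrite invr_gt0; lra.
pose P := n%:R `^ (- (theta - 2)) : R.
have P0 : 0 <= P by exact: powR_ge0.
have PP : n%:R `^ (- (theta - 1)) <= P by rewrite ler_powR ?ler1n//; lra.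
rewrite conv_recl big_nat_recr//= subnn -/P.
pose mid := \sum_(1 <= i < n) u i * v (n - i)%N.
have Hmid : `|mid| <= U * V * (2 `^ (theta - 1) * (2 + (theta - 2)^-1)) * P.
  apply: (@le_trans _ _ (U * V * \sum_(1 <= i < n)
     (i%:R `^ (- (theta - 1)) * (n - i)%:R `^ (- (theta - 2))))).
    apply: le_trans (ler_norm_sum _ _ _) _; rewrite mulr_sumr; apply: ler_sum_nat => i /andP[i1 ilt].
    rewrite normrM mulrACA; apply: ler_pM => //; first exact: Hu.
    by apply: Hv; rewrite subn_gt0.
  rewrite -!mulrA ler_wpM2l// ler_wpM2l//.
  have c2 : 2 `^ (theta - 2) <= 2 `^ (theta - 1) :> R by rewrite ler_powR ?ler1n//; lra.
  apply: le_trans (@conv_doubling R (fun i => i%:R `^ (- (theta - 1)))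
    (fun i => i%:R `^ (- (theta - 2))) (2 `^ (theta - 1)) n _ _ _ _ _ 1 n _) _ => //.
  - by move=> i ij; apply: powR_double => //; lra.
  - move=> i ij; apply: le_trans (powR_double _ ij) _; first by lra.
    by rewrite ler_wpM2r ?powR_ge0.
  rewrite ler_wpM2l ?powR_ge0// mulrDl.
  have A1 : n%:R `^ (- (theta - 1)) * \sum_(1 <= i < n) (n - i)%:R `^ (- (theta - 2)) <= P.
    apply: (@le_trans _ _ (n%:R `^ (- (theta - 1)) * \sum_(1 <= i < n) 1)).
      rewrite ler_wpM2l ?powR_ge0//; apply: ler_sum_nat => i /andP[i1 ilt].
      by rewrite powR_nat_le1//; [lra|rewrite subn_gt0].
    rewrite big_const_nat iter_addr_0 /P (powR_sub1 (theta - 2)) ?ltr0n//.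
    rewrite mulrC (_ : - (theta - 1) = - (theta - 2) - 1); last by ring.
    by rewrite ler_wpM2r ?powR_ge0// ler_nat leq_subr.
  have A2 : \sum_(1 <= i < n) i%:R `^ (- (theta - 1)) <= 1 + (theta - 2)^-1 :> R.
    rewrite (_ : theta - 2 = theta - 1 - 1); last by ring.
    by apply: sum_powR_le; lra.
  have := ler_wpM2l P0 A2; rewrite -/P => A3; lra.
have H0 : `|u 0%N * v n| <= U * V * P.
  by rewrite normrM -mulrA; apply: ler_pM => //; exact: Hv.
have Hn : `|u n * v 0%N| <= U * V * P.
  rewrite normrM mulrAC; apply: ler_pM => //.
  by apply: le_trans (Hu n n1) _; rewrite ler_wpM2l.
apply: le_trans (ler_normD _ _) _; apply: le_trans (lerD (lexx _) (ler_normD _ _)) _.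
rewrite -/mid /ctail; move: Hmid H0 Hn.
set X := `|mid|; set Y := `|_ * v n|; set Z := `|_ * v 0%N|.
set c := 2 `^ _ * _ => Hmid H0 Hn.
rewrite (_ : _ * P = U * V * P + U * V * P + U * V * c * P); last by ring.
lra.
Qed.

(** Discrete derivative, i.e. multiplication of the generating function by
    [1 - w]. *)
Definition dif u n := if n is m.+1 then u m.+1 - u m else u 0%N.

Lemma sum_dif u n : \sum_(i < n.+1) dif u i = u n.
Proof.
elim: n => [|n IH]; first by rewrite big_ord1.
by rewrite big_ord_recr/= IH addrC subrK.
Qed.

Lemma dif_conv u v : dif (conv u v) = conv (dif u) v.
Proof.
pose D : nat -> R := unit_seq - (fun n => if n == 1%N then 1 else 0).
have DE w : dif w = conv D w.
  rewrite convBl conv_unit; apply/funext => -[|n]; rewrite [RHS]/=.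
    by rewrite -[RHS]/(w 0%N - conv _ _ 0%N) conv0 mul0r subr0.
  rewrite -[RHS]/(w n.+1 - conv _ _ n.+1) conv_recl mul0r add0r big_ltn//= subn1 mul1r.
  rewrite big_nat_cond big1 ?addr0// => i /andP[/andP[i2 _] _].
  by rewrite gtn_eqF// mul0r.
by rewrite !DE convA.
Qed.

Lemma dif_convr u v : dif (conv u v) = conv u (dif v).
Proof. by rewrite convC dif_conv convC. Qed.

End TailSums.

Section Critical.
Variables (R : realType) (theta b z : R) (g l e eh f h phi : nat -> R).
Let K := ctail theta.
(* The factor 100 leaves room for crude estimates of absolute constants. *)
Hypotheses (th2 : 2 < theta) (b0 : 0 <= b) (small : 100 * b * K ^+ 4 <= 1).
Hypotheses (g1 : g 1%N = z) (l1 : l 1%N = - z)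
  (Hg : forall m, (2 <= m)%N -> `|g m| <= b * m%:R `^ (- theta))
  (Hl : forall m, (2 <= m)%N -> `|l m| <= b * m%:R `^ (- (theta - 1)))
  (He : forall m, (1 <= m)%N -> `|e m| <= b * m%:R `^ (- theta))
  (Heh : forall m, (1 <= m)%N -> `|eh m| <= b * m%:R `^ (- (theta - 1))).

Let g' m := if m is 0 then 0 else g m.
Let l' m := if m is 0 then 0 else l m.
Let e' m := if m is 0 then 1 else e m.
Let eh' m := if m is 0 then 0 else eh m.

(** Tails of the kernel; at criticality these are the coefficients of
    [(1 - G(w)) / (1 - w)]. *)
Definition ktail (n : nat) : R := 1 - \sum_(1 <= m < n.+1) g m.
Let t := ktail.

Hypotheses (Ht : forall n, (1 <= n)%N -> `|t n| <= b * n%:R `^ (- (theta - 1)))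
  (Hphi : conv (unit_seq - g') phi = unit_seq)
  (Hf : f = conv g' f + e')
  (Hh : h = conv g' h + (conv l' f + eh')).

Let mu := sum1 (fun m => m%:R * g m).
Let lsum := sum1 l.
Let A := (1 + sum1 e) / mu.
Let v := - (lsum / mu).

Let K4 : 4 <= K. Proof. by have [] := ctail_bounds th2. Qed.
Let bK : 100 * b * K <= 1.
Proof.
have := small; have := K4; move: b0 => h0 k4; rewrite (_ : _ * K ^+ 4 = 100 * b * K * K ^+ 3); last by ring.
have k0 : 0 <= K by lra.
by apply: le_trans; rewrite ler_peMr ?mulr_ge0//; apply: exprn_ege1; lra.
Qed.
Let bK3 : 100 * b * K ^+ 3 <= 1.
Proof.
have := small; have := K4; move: b0 => h0 k4; rewrite (_ : _ * K ^+ 4 = 100 * b * K ^+ 3 * K); last by ring.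
have k0 : 0 <= K by lra.
by apply: le_trans; rewrite ler_peMr ?mulr_ge0 ?exprn_ge0//; lra.
Qed.

Let t0 : t 0%N = 1. Proof. by rewrite /t /ktail big_geq// subr0. Qed.

Let dift : dif t = unit_seq - g'.
Proof.
apply/funext => -[|n]; first by rewrite [LHS]t0 -[RHS]/(1 - 0) subr0.
rewrite -[RHS]/(0 - g n.+1) /= /t /ktail [X in 1 - X - _](big_nat_recr n.+1)//=; ring.
Qed.

Let td : conv t (dif phi) = unit_seq.
Proof. by rewrite -dif_convr dif_conv dift. Qed.

Let phi0 : phi 0%N = 1.
Proof.
have := congr1 (fun u => u 0%N) Hphi; rewrite conv0.
by rewrite -[(_ - _) 0%N]/(1 - 0 : R) subr0 mul1r.
Qed.

Let d0 : dif phi 0%N = 1. Proof. exact: phi0. Qed.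

(** The tails have the generating function [(1 - G(w)) / (1 - w)], and its
    inverse has the increments of [phi] as coefficients. The tails are small
    beyond index 0, so their decay is inherited by the inverse. *)
Lemma critical_increment n : (1 <= n)%N -> `|dif phi n| <= 3 * b * n%:R `^ (- (theta - 1)).
Proof.
move=> n1; have i0 : 0 < (theta - 2)^-1 by rewrite invr_gt0; move: th2; lra.
apply: (@perturbed_unit_bound R t (fun _ => 0) (dif phi) (fun n => n%:R `^ (- (theta - 1))) b
  (2 `^ (theta - 1)) (1 + (theta - 2)^-1) n) => //; rewrite ?n1 ?leqnn//.
- by move=> i j ij; apply: powR_double => //; move: th2; lra.
- move=> j _; rewrite (_ : theta - 2 = theta - 1 - 1); last by ring.
  by apply: sum_powR_le; move: th2; lra.
- have [c1 _ _] := ctail_bounds th2; rewrite -mulrA.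
  have := ler_wpM2l (mulr_ge0 (ler0n R 6) b0) c1; rewrite -/K => /le_trans; apply.
  by move: bK (mulr_ge0 b0 (le_trans (ler0n R 4) K4)); lra.
- move=> j /andP[j1 _]; have := congr1 (fun u => u j) td.
  rewrite conv_recl t0 mul1r /unit_seq gtn_eqF// => /eqP; rewrite addr_eq0 => /eqP ->.
  by rewrite sub0r.
- by move=> j /andP[j1 _]; exact: Ht.
- by move=> j _; rewrite normr0 mulr_ge0 ?powR_ge0.
Qed.

Let b3 : 3 * b <= 1. Proof. by move: bK K4 b0; nra. Qed.

Lemma critical_increment_sum n : \sum_(i < n.+1) `|dif phi i| <= K.
Proof.
have i0 : 0 < (theta - 2)^-1 by rewrite invr_gt0; move: th2; lra.
rewrite -(big_mkord xpredT (fun i => `|dif phi i|)) big_ltn// d0 normr1.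
have [_ + _] := ctail_bounds th2; rewrite -/K; apply: le_trans.
rewrite (_ : 2 + (theta - 2)^-1 = 1 + (1 + (theta - 1 - 1)^-1)); last first.
  by rewrite addrA (_ : theta - 1 - 1 = theta - 2)//; ring.
rewrite lerD2l; apply: le_trans (sum_powR_le n.+1 (_ : 1 < theta - 1)); last by move: th2; lra.
apply: ler_sum_nat => i /andP[i1 _]; apply: le_trans (critical_increment i1) _.
by rewrite ler_piMl ?powR_ge0.
Qed.

Lemma critical_bounded n : `|phi n| <= K.
Proof. by rewrite -sum_dif; apply: le_trans (ler_norm_sum _ _ _) (critical_increment_sum n). Qed.

Let Hgm m : (2 <= m)%N -> `|m%:R * g m| <= b * m%:R `^ (- (theta - 1)).
Proof.
move=> m2; rewrite normrM ger0_norm//; have := ler_wpM2l (ler0n R m) (Hg m2).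
by rewrite mulrCA natr_powR//; nlia.
Qed.

Let i0 : 0 < (theta - 2)^-1. Proof. by rewrite invr_gt0; move: th2; lra. Qed.
Let iK : 2 + (theta - 2)^-1 <= K. Proof. by have [] := ctail_bounds th2. Qed.

Let tail2 u : (forall m, (2 <= m)%N -> `|u m| <= b * m%:R `^ (- (theta - 1))) ->
  forall n, (1 <= n)%N ->
  `|sum1 u - \sum_(1 <= m < n.+1) u m| <= b * (theta - 2)^-1 * n%:R `^ (- (theta - 2)).
Proof.
move=> Hu; have [] := @sum1_tail R u (theta - 1) b _ b0 Hu; first by move: th2; lra.
by rewrite (_ : theta - 1 - 1 = theta - 2)//; ring.
Qed.

(** Summation by parts: the sum of the tails is the mean. *)
Lemma mean_tail n : (1 <= n)%N ->
  `|mu - \sum_(i < n.+1) t i| <= b * K * n%:R `^ (- (theta - 2)).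
Proof.
move=> n1.
have E N : \sum_(i < N.+1) t i = \sum_(1 <= m < N.+1) m%:R * g m + N.+1%:R * t N.
  elim: N => [|N IH]; first by rewrite big_ord1 big_geq// add0r mul1r.
  rewrite big_ord_recr/= IH (big_nat_recr N.+1)//= /t /ktail (big_nat_recr N.+1)//=.
  by rewrite -[N.+2%:R]natr1; ring.
rewrite E opprD addrA; apply: le_trans (ler_normB _ _) _.
have h1 := tail2 Hgm n1; rewrite -/mu in h1.
have h2 : `|n.+1%:R * t n| <= 2 * b * n%:R `^ (- (theta - 2)).
  rewrite normrM ger0_norm//; apply: le_trans (ler_wpM2l _ (Ht n1)) _ => //.
  rewrite (powR_sub1 (theta - 2)) ?ltr0n// (_ : - (theta - 1) = - (theta - 2) - 1); last by ring.
  rewrite [leLHS](_ : _ = b * (n.+1%:R * n%:R `^ (- (theta - 2) - 1))); last by ring.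
  rewrite [leRHS](_ : _ = b * (2 * n%:R * n%:R `^ (- (theta - 2) - 1))); last by ring.
  rewrite ler_wpM2l// ler_wpM2r ?powR_ge0// -natrM ler_nat; nlia.
apply: le_trans (lerD h1 h2) _; rewrite -mulrDl ler_wpM2r ?powR_ge0//.
by move: iK b0; nra.
Qed.

Lemma mean_near1 : `|mu - 1| <= 2 * b * K.
Proof.
have := mean_tail (ltn0Sn 0); rewrite powR1 mulr1 big_ord_recr/= big_ord1 t0.
have := Ht (ltn0Sn 0); rewrite powR1 mulr1 => h1 h2.
rewrite (_ : mu - 1 = (mu - (1 + t 1%N)) + t 1%N); last by ring.
apply: le_trans (ler_normD _ _) _; move: K4 b0 h1 h2; nra.
Qed.

Lemma mean_bounds : 2 / 3 <= mu <= 4 / 3.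
Proof. by move: mean_near1; rewrite ler_norml => /andP[]; move: bK; lra. Qed.

Let mu0 : 0 < mu. Proof. by have /andP[] := mean_bounds; lra. Qed.
Let muV : mu^-1 <= 3 / 2.
Proof. by rewrite -[leRHS]invrK lef_pV2 ?posrE// ?invr_gt0//; have /andP[] := mean_bounds; lra. Qed.

Let r n := phi n - mu^-1.

Let r_conv : r = conv (dif phi) (fun n => 1 - mu^-1 * \sum_(i < n.+1) t i).
Proof.
have H : conv t r = (fun n => 1 - mu^-1 * \sum_(i < n.+1) t i).
  have -> : r = phi - (fun=> mu^-1) by [].
  rewrite convBr; apply/funext => n; rewrite -[LHS]/(conv t phi n - conv t _ n).
  congr (_ - _); last by rewrite /conv mulr_sumr; apply: eq_bigr => i _; rewrite mulrC.
  by rewrite -sum_dif dif_conv dift Hphi big_ord_recl /= big1 ?addr0.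
by rewrite -H convA (convC (dif phi)) td conv_unit.
Qed.

Let Kp n : 0 <= K ^+ n. Proof. by rewrite exprn_ge0//; move: K4; lra. Qed.
Let K0 : 0 <= K. Proof. by move: K4; lra. Qed.

(** With [T] the generating function of the tails, that of [phi] is
    [1 / ((1 - w) T(w))], and [T(1)] is the mean; the error is governed by the
    tails of the series [T(1)]. *)
Lemma critical_rate n : (1 <= n)%N -> `|phi n - mu^-1| <= 3 * K ^+ 2 * b * n%:R `^ (- (theta - 2)).
Proof.
move=> n1; rewrite -/(r n) r_conv.
rewrite (_ : 3 * K ^+ 2 * b = ctail theta * (1 * (3 * b * K))); last by rewrite -/K; ring.
have E x : 1 - mu^-1 * x = mu^-1 * (mu - x) by rewrite mulrBr mulVf// gt_eqF.
have mi : 0 <= mu^-1 by rewrite invr_ge0 ltW.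
apply: conv_tail => //; rewrite ?mulr_ge0//.
- by rewrite d0 normr1.
- rewrite big_ord1 t0 E normrM (ger0_norm mi).
  apply: le_trans (ler_pM mi (normr_ge0 _) muV mean_near1) _; lra.
- move=> i i1; apply: le_trans (critical_increment i1) _.
  by rewrite ler_wpM2r ?powR_ge0.
move=> i i1; rewrite E normrM (ger0_norm mi).
apply: le_trans (ler_pM mi (normr_ge0 _) muV (mean_tail i1)) _.
rewrite mulrA ler_wpM2r ?powR_ge0//.
by move: (mulr_ge0 b0 K0); lra.
Qed.

Let r0 : `|r 0%N| <= 3 * K ^+ 2 * b.
Proof.
rewrite /r phi0 (_ : 1 - mu^-1 = mu^-1 * (mu - 1)); last by rewrite mulrBr mulVf ?mulr1// gt_eqF.
have mi : 0 <= mu^-1 by rewrite invr_ge0 ltW.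
rewrite normrM (ger0_norm mi).
apply: le_trans (ler_pM mi (normr_ge0 _) muV mean_near1) _.
have := mulr_ge0 b0 K0; move: K4; nra.
Qed.

Let e_sum : `|sum1 e| <= 2 * b.
Proof.
have [] := @sum1_tail R e theta b _ b0 (fun m (m2 : (2 <= m)%N) => He (ltnW m2)).
  by move: th2; lra.
move=> _ /(_ 1%N isT); rewrite big_nat1 powR1 mulr1 => hx.
have h1 := He (ltn0Sn 0); rewrite powR1 mulr1 in h1.
rewrite -(subrK (e 1%N) (sum1 e)); apply: le_trans (ler_normD _ _) _.
have : b * (theta - 1)^-1 <= b by rewrite ler_piMr// invf_le1; move: th2; lra.
lra.
Qed.

Lemma critical_amplitude_near1 : `|A - 1| <= 6 * b * K.
Proof.
rewrite /A (_ : _ / mu - 1 = mu^-1 * (sum1 e - (mu - 1))); last first.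
  by field; rewrite gt_eqF.
have mi : 0 <= mu^-1 by rewrite invr_ge0 ltW.
rewrite normrM (ger0_norm mi).
apply: (@le_trans _ _ (3 / 2 * (2 * b + 2 * b * K))).
  by apply: ler_pM => //; apply: le_trans (ler_normB _ _) (lerD e_sum mean_near1).
move: K4 b0; nra.
Qed.

Lemma critical_amplitude_bounds : 1 / 2 <= A <= 2.
Proof. by move: critical_amplitude_near1; rewrite ler_norml => /andP[]; move: bK; lra. Qed.

Lemma critical_f_rate n : (1 <= n)%N -> `|f n - A| <= 5 * K ^+ 3 * b * n%:R `^ (- (theta - 2)).
Proof.
move=> n1; have fE : f = conv phi e' by exact: renewal_unique Hphi Hf.
have -> : f n - A = conv e' r n - mu^-1 * (sum1 e - \sum_(1 <= i < n.+1) e i).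
  have -> : r = phi - (fun=> mu^-1) by [].
  rewrite convBr -[(_ - _) n]/(conv e' phi n - conv e' _ n) convC -fE.
  have -> : conv e' (fun=> mu^-1) n = mu^-1 * (1 + \sum_(1 <= i < n.+1) e i).
    rewrite conv_recl mul1r mulrDr mulr1 mulr_sumr; congr (_ + _).
    by apply: eq_big_nat => -[//|i] _; rewrite mulrC.
  by rewrite /A; ring.
have h1 : `|conv e' r n| <= K * (1 * (3 * K ^+ 2 * b)) * n%:R `^ (- (theta - 2)).
  apply: conv_tail => //; rewrite ?mulr_ge0 ?exprn_ge0//.
  - by rewrite normr1.
  - move=> -[//|i] i1; apply: le_trans (He i1) _.
    apply: ler_pM; rewrite ?powR_ge0//; first by move: b3 b0; lra.
    by rewrite ler_powR ?ler1n//; lra.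
  - by move=> i i1; exact: critical_rate.
have h2 : `|mu^-1 * (sum1 e - \sum_(1 <= i < n.+1) e i)| <= 3 / 2 * (b * n%:R `^ (- (theta - 2))).
  have mi : 0 <= mu^-1 by rewrite invr_ge0 ltW.
  rewrite normrM (ger0_norm mi); apply: ler_pM => //.
  have [] := @sum1_tail R e theta b _ b0 (fun m (m2 : (2 <= m)%N) => He (ltnW m2)).
    by move: th2; lra.
  move=> _ /(_ _ n1) /le_trans; apply; rewrite -mulrA ler_wpM2l//.
  apply: (@le_trans _ _ (1 * n%:R `^ (- (theta - 1)))).
    by rewrite ler_wpM2r ?powR_ge0// invf_le1; move: th2; lra.
  by rewrite mul1r ler_powR ?ler1n//; lra.
apply: le_trans (ler_normB _ _) _; apply: le_trans (lerD h1 h2) _.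
rewrite [leLHS](_ : _ = (3 * K ^+ 3 + 3 / 2) * b * n%:R `^ (- (theta - 2))); last by field.
rewrite ler_wpM2r ?powR_ge0// ler_wpM2r//.
have : 1 <= K ^+ 3 by rewrite exprn_ege1//; move: K4; lra.
by lra.
Qed.

Let f0 : f 0%N = 1.
Proof. by rewrite Hf -[LHS]/(conv g' f 0 + 1) conv0 mul0r add0r. Qed.

Let f_rate0 : `|f 0%N - A| <= 5 * K ^+ 3 * b.
Proof.
rewrite f0 distrC; apply: le_trans critical_amplitude_near1 _; rewrite mulrAC ler_wpM2r//.
have : K * 16 <= K ^+ 3.
  have -> : K ^+ 3 = K * (K * K) by ring.
  by apply: ler_wpM2l => //; move: K4; nra.
by move: K0; lra.
Qed.

Lemma critical_f_bounds n : 1 / 4 <= f n <= 3.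
Proof.
have : `|f n - A| <= 5 * K ^+ 3 * b.
  case: n => [|n]; first exact: f_rate0.
  apply: le_trans (critical_f_rate (ltn0Sn n)) _.
  by rewrite ler_piMr ?mulr_ge0 ?Kp// powR_nat_le1//; move: th2; lra.
by rewrite ler_norml; have /andP[] := critical_amplitude_bounds; move: bK3; lra.
Qed.

Let z_near1 : `|z - 1| <= b.
Proof.
have := Ht (ltn0Sn 0); rewrite powR1 mulr1 /t /ktail big_nat1 g1.
by rewrite distrC.
Qed.

Lemma lsum_near : `|lsum + 1| <= 2 * b * K.
Proof.
have := tail2 Hl (ltn0Sn 0); rewrite big_nat1 powR1 mulr1 l1 opprK => hx.
rewrite (_ : lsum + 1 = lsum + z - (z - 1)); last by ring.
apply: le_trans (ler_normB _ _) _; rewrite -/lsum in hx.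
by move: hx z_near1 iK b0 i0; nra.
Qed.

Lemma critical_diffusivity_near1 : `|v - 1| <= 6 * b * K.
Proof.
rewrite /v (_ : - (lsum / mu) - 1 = - mu^-1 * ((lsum + 1) + (mu - 1))); last first.
  by field; rewrite gt_eqF.
have mi : 0 <= mu^-1 by rewrite invr_ge0 ltW.
rewrite normrM normrN (ger0_norm mi).
apply: (@le_trans _ _ (3 / 2 * (2 * b * K + 2 * b * K))).
  by apply: ler_pM => //; apply: le_trans (ler_normD _ _) (lerD lsum_near mean_near1).
lra.
Qed.

Lemma critical_diffusivity_bounds : 1 / 2 <= v <= 2.
Proof. by move: critical_diffusivity_near1; rewrite ler_norml => /andP[]; move: bK; lra. Qed.

Let s := conv l' f + eh'.

Let s_rate n : (1 <= n)%N -> `|s n - A * lsum| <= 14 * K ^+ 4 * b * n%:R `^ (- (theta - 2)).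
Proof.
move=> n1.
have -> : s n - A * lsum = conv l' (f - (fun=> A)) n - A * (lsum - \sum_(1 <= i < n.+1) l i) + eh' n.
  rewrite convBr -[(_ - _) n]/(conv l' f n - conv l' _ n) -[s n]/(conv l' f n + eh' n).
  have -> : conv l' (fun=> A) n = A * \sum_(1 <= i < n.+1) l i.
    rewrite conv_recl mul0r add0r mulr_sumr.
    by apply: eq_big_nat => -[//|i] _; rewrite mulrC.
  by ring.
have P0 : 0 <= n%:R `^ (- (theta - 2)) :> R by exact: powR_ge0.
have h1 : `|conv l' (f - (fun=> A)) n| <= K * (2 * (5 * K ^+ 3 * b)) * n%:R `^ (- (theta - 2)).
  apply: conv_tail => //; rewrite ?mulr_ge0 ?exprn_ge0//.
  - by rewrite normr0.
  - move=> -[//|[|i]] _ /=.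
      rewrite powR1 mulr1 l1 normrN; move: z_near1 b3; rewrite ler_norml => /andP[? ?] ?.
      by rewrite ler_norml; lra.
    apply: le_trans (Hl _) _ => //; rewrite ler_wpM2r ?powR_ge0//; move: b3 b0; lra.
  - by move=> i i1; exact: critical_f_rate.
have h2 : `|A * (lsum - \sum_(1 <= i < n.+1) l i)| <= 2 * (b * (theta - 2)^-1 * n%:R `^ (- (theta - 2))).
  have /andP[A1 A2] := critical_amplitude_bounds; rewrite normrM (@ger0_norm _ A); last by lra.
  by apply: ler_pM => //; [lra|exact: tail2].
have h3 : `|eh' n| <= b * n%:R `^ (- (theta - 2)).
  case: n n1 P0 h1 h2 => // n n1 *; apply: le_trans (Heh n1) _.
  by rewrite ler_wpM2l// ler_powR ?ler1n//; lra.
apply: le_trans (ler_normD _ _) _; apply: le_trans (lerD (ler_normB _ _) (lexx _)) _.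
apply: le_trans (lerD (lerD h1 h2) h3) _.
rewrite [leLHS](_ : _ = (10 * K ^+ 4 + 2 * (theta - 2)^-1 + 1) * b * n%:R `^ (- (theta - 2))); last by ring.
rewrite ler_wpM2r// ler_wpM2r//.
have : K <= K ^+ 4 by rewrite -[leLHS]expr1 ler_weXn2l//; move: K4; lra.
by move: iK K4; lra.
Qed.

Let s_bounded n : (1 <= n)%N -> `|s n| <= 5.
Proof.
move=> n1; rewrite -(subrK (A * lsum) (s n)); apply: le_trans (ler_normD _ _) _.
have h1 : `|A * lsum| <= 2 * (1 + 2 * b * K).
  have /andP[A1 A2] := critical_amplitude_bounds; rewrite normrM (@ger0_norm _ A); last by lra.
  apply: ler_pM => //; first by lra.
  rewrite -(addrK 1 lsum); apply: le_trans (ler_normB _ _) _.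
  by rewrite normr1; move: lsum_near; lra.
have h2 : `|s n - A * lsum| <= 14 * K ^+ 4 * b.
  apply: le_trans (s_rate n1) _.
  by rewrite ler_piMr ?mulr_ge0 ?Kp// powR_nat_le1//; move: th2; lra.
by move: h1 h2 small bK; lra.
Qed.

(** [h] is [phi] convolved with the source [s]. The source tends to [A * lsum]
    and [phi] to [1 / mu], both at the rate [n ^ (2 - theta)]; the sum of these
    errors up to [n] leaves [n ^ (1 - delta)]. *)
Lemma critical_moment_rate delta n : 0 < delta < 1 -> delta < theta - 2 -> (1 <= n)%N ->
  `|h n + v * n%:R * A| <= 36 * K ^+ 4 * (2 + 2 / (1 - delta)) * b * n%:R `^ (1 - delta).
Proof.
move=> /andP[de0 de1] dth n1.
have hE : h = conv phi s by exact: renewal_unique Hphi Hh.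
have s0 : s 0%N = 0 by rewrite -[LHS]/(conv l' f 0 + 0) conv0 mul0r addr0.
have -> : h n + v * n%:R * A =
   \sum_(1 <= i < n.+1) (r (n - i) * s i + mu^-1 * (s i - A * lsum)).
  rewrite hE convC conv_recl s0 mul0r add0r.
  have -> : v * n%:R * A = - \sum_(1 <= i < n.+1) mu^-1 * (A * lsum).
    by rewrite sumr_const_nat subn1/= -mulr_natl /v; ring.
  by rewrite -sumrB; apply: eq_bigr => i _; rewrite /r; ring.
have mi : 0 <= mu^-1 by rewrite invr_ge0 ltW.
have Q1 : \sum_(1 <= i < n.+1) i%:R `^ (- (theta - 2)) <= (1 + 2 / (1 - delta)) * n%:R `^ (1 - delta) :> R.
  apply: le_trans (sum_powR_slow n (_ : 0 < delta < 1)); last by rewrite de0.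
  apply: ler_sum_nat => i /andP[i1 _]; rewrite ler_powR ?ler1n//; lra.
have np : 1 <= n%:R `^ (1 - delta) :> R.
  by rewrite -[leLHS](powRr0 n%:R) ler_powR ?ler1n//; lra.
rewrite big_split/=; apply: le_trans (ler_normD _ _) _.
have B1 : `|\sum_(1 <= i < n.+1) r (n - i) * s i| <=
    15 * K ^+ 2 * b * (1 + (1 + 2 / (1 - delta)) * n%:R `^ (1 - delta)).
  apply: (@le_trans _ _ (\sum_(1 <= i < n.+1) `|r (n - i)| * 5)).
    apply: le_trans (ler_norm_sum _ _ _) _; apply: ler_sum_nat => i /andP[i1 _].
    by rewrite normrM ler_wpM2l// s_bounded.
  rewrite -mulr_suml (_ : 15 * _ * b = 3 * K ^+ 2 * b * 5); last by ring.
  rewrite [leRHS]mulrAC ler_wpM2r// big_nat_rev/=.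
  rewrite (eq_big_nat _ _ (F2 := fun i => `|r i.-1|)); last first.
    by move=> i /andP[i1 ilt]; congr `|r _|; nlia.
  rewrite big_add1/= -(subnKC n1) big_ltn ?addn1// mulrDr mulr1; apply: lerD => //.
  apply: (@le_trans _ _ (3 * K ^+ 2 * b * \sum_(1 <= i < n) i%:R `^ (- (theta - 2)))).
    rewrite subnKC// mulr_sumr; apply: ler_sum_nat => i /andP[i1 _]; exact: critical_rate.
  rewrite ler_wpM2l ?mulr_ge0// subnKC//; apply: le_trans Q1.
  by rewrite (big_nat_recr n)//= lerDl powR_ge0.
have B2 : `|\sum_(1 <= i < n.+1) mu^-1 * (s i - A * lsum)| <=
    21 * K ^+ 4 * b * ((1 + 2 / (1 - delta)) * n%:R `^ (1 - delta)).
  apply: (@le_trans _ _ (21 * K ^+ 4 * b * \sum_(1 <= i < n.+1) i%:R `^ (- (theta - 2)))); last first.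
    by rewrite ler_wpM2l ?mulr_ge0.
  apply: le_trans (ler_norm_sum _ _ _) _; rewrite mulr_sumr; apply: ler_sum_nat => i /andP[i1 _].
  rewrite normrM (ger0_norm mi); apply: le_trans (ler_pM mi (normr_ge0 _) muV (s_rate i1)) _.
  by rewrite le_eqVlt; apply/orP; left; apply/eqP; field.
apply: le_trans (lerD B1 B2) _.
have q0 : 0 <= 2 / (1 - delta) by rewrite divr_ge0//; lra.
set q := 2 / (1 - delta) in q0 *; set X := n%:R `^ _ in np *.
have K24 : K ^+ 2 <= K ^+ 4 by rewrite ler_weXn2l//; move: K4; lra.
apply: (@le_trans _ _ (15 * K ^+ 4 * b * ((2 + q) * X) + 21 * K ^+ 4 * b * ((2 + q) * X))); last first.
  by rewrite le_eqVlt; apply/orP; left; apply/eqP; ring.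
apply: lerD.
  apply: (@le_trans _ _ (15 * K ^+ 2 * b * ((2 + q) * X))).
    apply: ler_wpM2l; first by rewrite !mulr_ge0 ?Kp.
    by rewrite mulrDl [leRHS]mulrDl; lra.
  apply: ler_wpM2r; first by apply: mulr_ge0; lra.
  by apply: ler_wpM2r => //; apply: ler_wpM2l.
apply: ler_wpM2l; first by rewrite !mulr_ge0 ?Kp.
apply: ler_wpM2r; lra.
Qed.

Lemma critical_ratio delta n : 0 < delta < 1 -> delta < theta - 2 -> (1 <= n)%N ->
  exists2 c : R, `|c| <= (8 * 36 * K ^+ 4 * (2 + 2 / (1 - delta)) + 20 * K ^+ 3) * b * n%:R `^ (- delta) &
  - h n / f n = v * n%:R * (1 + c).
Proof.
move=> de dth n1; have /andP[f1 f2] := critical_f_bounds n.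
have /andP[v1 v2] := critical_diffusivity_bounds; have n0 : 0 < n%:R :> R by rewrite ltr0n.
have vn0 : 0 < v * n%:R by rewrite mulr_gt0//; lra.
have fp : 0 < f n by lra.
exists (- h n / f n / (v * n%:R) - 1); last by field; rewrite !gt_eqF//; lra.
have -> : - h n / f n / (v * n%:R) - 1 =
   - (f n * v)^-1 * n%:R^-1 * (h n + v * n%:R * A) - (f n)^-1 * (f n - A).
  by field; rewrite !gt_eqF//; lra.
have fv : (f n * v)^-1 <= 8.
  rewrite -[leRHS]invrK lef_pV2 ?posrE ?invr_gt0 ?mulr_gt0//; [nra|lra].
have fi : (f n)^-1 <= 4 by rewrite -[leRHS]invrK lef_pV2 ?posrE ?invr_gt0//; lra.
apply: le_trans (ler_normB _ _) _; rewrite mulrDl mulrDl; apply: lerD.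
  rewrite mulNr mulNr normrN -mulrA normrM ger0_norm ?invr_ge0 ?mulr_ge0//; try by lra.
  rewrite [leRHS](_ : _ = 8 * (36 * K ^+ 4 * (2 + 2 / (1 - delta)) * b * n%:R `^ (- delta))); last by ring.
  apply: ler_pM => //; first by rewrite invr_ge0 mulr_ge0//; lra.
  rewrite normrM ger0_norm ?invr_ge0// ler_pdivrMl//.
  apply: le_trans (critical_moment_rate de dth n1) _.
  rewrite (_ : n%:R `^ (1 - delta) = n%:R * n%:R `^ (- delta)); last first.
    by rewrite powRD ?powRr1 ?ltW// (gt_eqF n0) implybT.
  by rewrite le_eqVlt; apply/orP; left; apply/eqP; ring.
rewrite normrM ger0_norm ?invr_ge0 ?(ltW fp)//.
rewrite (_ : 20 * K ^+ 3 * b * _ = 4 * (5 * K ^+ 3 * b * n%:R `^ (- delta))); last by ring.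
apply: ler_pM => //; first by rewrite invr_ge0 ltW.
apply: le_trans (critical_f_rate n1) _; rewrite ler_wpM2l ?mulr_ge0//.
by rewrite ler_powR ?ler1n//; lra.
Qed.

End Critical.

(** * Exponential tilting near the critical point *)

Section Tilt.
Variable R : realType.
Implicit Types (u v : nat -> R).

Lemma sum_conv_le u v n :
  \sum_(j < n.+1) `|conv u v j| <= (\sum_(i < n.+1) `|u i|) * (\sum_(i < n.+1) `|v i|).
Proof.
apply: (@le_trans _ _ (\sum_(j < n.+1) \sum_(i < n.+1) if (i <= j)%N then `|u i| * `|v (j - i)%N| else 0)).
  apply: ler_sum => j _; rewrite /conv.
  apply: le_trans (ler_norm_sum _ _ _) _.
  rewrite -(big_mkord xpredT (fun i => `|u i * v (j - i)%N|)).
  rewrite -(big_mkord xpredT (fun i => if (i <= j)%N then `|u i| * `|v (j - i)%N| else 0)).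
  rewrite [leRHS](@big_cat_nat _ _ _ j.+1)//=.
  rewrite ler_wpDr//; first by apply: sumr_ge0 => i _; case: ifP => // _; exact: mulr_ge0.
  by apply: ler_sum_nat => i /andP[_ ij]; rewrite -ltnS ij normrM.
rewrite exchange_big/= mulr_suml; apply: ler_sum => i _.
have [iN] : (i <= n)%N by rewrite -ltnS.
rewrite -(big_mkord xpredT (fun j => if (i <= j)%N then `|u i| * `|v (j - i)%N| else 0)).
rewrite (@big_cat_nat _ _ _ i)//=; last by rewrite ltnW.
rewrite big_nat_cond big1 ?add0r; last by move=> j /andP[/andP[_ ji] _]; rewrite leqNgt ji.
rewrite mulr_sumr -(big_mkord xpredT (fun j => `|u i| * `|v j|)).
rewrite -{1}(add0n i) big_addn.
rewrite [leRHS](@big_cat_nat _ _ _ (n.+1 - i))//=; last exact: leq_subr.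
rewrite ler_wpDr//; first by apply: sumr_ge0 => j _; exact: mulr_ge0.
by apply: ler_sum_nat => j _; rewrite leq_addl addnK.
Qed.

Lemma tilt_conv (c : R) u v :
  (fun n => conv u v n * c ^+ n) = conv (fun n => u n * c ^+ n) (fun n => v n * c ^+ n).
Proof.
apply/funext => n; rewrite /conv mulr_suml; apply: eq_bigr => i _.
by rewrite mulrACA -exprD subnKC// -ltnS.
Qed.

(** Summation by parts turns the difference of the kernels into its partial
    sums, which are small, and the tilted sequence into its increments; these
    are summable because the increments of [phi] are, up to a term that the
    smallness of [a * n ^ (1 - delta)] absorbs. *)
Lemma tilt_close (c : R) (g phi f e G F E : nat -> R) (K Kf B a s delta : R) n :
  0 <= K -> 0 <= Kf -> 0 <= B -> 0 <= a -> 0 < delta < 1 -> 1 < s -> (1 <= n)%N ->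
  conv (unit_seq - g) phi = unit_seq -> f = conv g f + e -> F = conv G F + E ->
  e 0%N = E 0%N -> g 0%N = 0 -> G 0%N = 0 ->
  \sum_(i < n.+1) `|dif phi i| <= K ->
  (forall j, (j <= n)%N -> `|phi j| <= K) ->
  \sum_(i < n.+1) `|dif f i| <= Kf ->
  (forall j, (1 <= j <= n)%N ->
     `|\sum_(1 <= m < j.+1) (G m * c ^+ m - g m)| <= B * a * j%:R `^ (- delta)) ->
  (forall j, (1 <= j <= n)%N -> `|E j * c ^+ j - e j| <= B * a * j%:R `^ (- s)) ->
  2 * K * B * (1 + 2 / (1 - delta)) * (a * n%:R `^ (1 - delta)) <= 1 ->
  `|F n * c ^+ n - f n| <=
    K * B * ((1 + 2 / (1 - delta)) * (2 * Kf + (1 + (s - 1)^-1)) + (1 + (s - 1)^-1)) *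
    (a * n%:R `^ (1 - delta)).
Proof.
move=> K0 Kf0 B0 a0 de s1 n1 Hphi Hf HF eE g0 G0 Kphi Kphi1 KF HH HE small.
have /andP[de0 de1] := de.
pose psi j := F j * c ^+ j; pose Gt j := G j * c ^+ j; pose Et j := E j * c ^+ j.
have psiE : psi = conv Gt psi + Et.
  rewrite -tilt_conv; apply/funext => j.
  by rewrite /psi {1}HF -[(_ + _) j]/(conv G F j + E j) mulrDl.
pose Hs j := \sum_(i < j.+1) (Gt i - g i).
have difHs : dif Hs = Gt - g.
  by apply/funext => -[|j]; rewrite /= /Hs ?big_ord1// [X in X - _]big_ord_recr/= addrAC subrr add0r.
pose sg := conv Hs (dif psi) + (Et - e).
pose chi := psi - f.
have chiE : chi = conv phi sg.
  apply: renewal_unique Hphi _.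
  rewrite /sg -dif_convr dif_conv difHs convBl /chi {1}psiE {1}Hf convBr.
  by apply/funext => j; rewrite /= !fctE; ring.
have dchi : dif chi = conv (dif phi) sg by rewrite chiE dif_conv.
pose Cd := 1 + 2 / (1 - delta); pose S := 1 + (s - 1)^-1.
have q0 : 0 <= 2 / (1 - delta) by rewrite divr_ge0//; lra.
have i0 : 0 <= (s - 1)^-1 by rewrite invr_ge0; lra.
pose X := a * n%:R `^ (1 - delta).
have np : 1 <= n%:R `^ (1 - delta) :> R.
  by rewrite -[leLHS](powRr0 n%:R) ler_powR ?ler1n//; lra.
have X0 : 0 <= X by rewrite mulr_ge0 ?powR_ge0.
have aX : a <= X by rewrite ler_peMr.
pose V := \sum_(i < n.+1) `|dif psi i|.
have V0 : 0 <= V by exact: sumr_ge0.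
have sumH : \sum_(i < n.+1) `|Hs i| <= B * Cd * X.
  rewrite -(big_mkord xpredT (fun i => `|Hs i|)) big_ltn// [Hs 0%N]big_ord1 /Gt g0 G0 mul0r subrr normr0 add0r.
  apply: (@le_trans _ _ (B * a * \sum_(1 <= i < n.+1) i%:R `^ (- delta))).
    rewrite mulr_sumr; apply: ler_sum_nat => i /andP[i1 iN].
    apply: le_trans (HH i _); last by rewrite i1.
    rewrite /Hs -(big_mkord xpredT (fun i => Gt i - g i)) big_ltn//.
    by rewrite /Gt g0 G0 mul0r subrr add0r.
  rewrite (_ : B * Cd * X = B * a * (Cd * n%:R `^ (1 - delta))); last by rewrite /X; ring.
  by rewrite ler_wpM2l ?mulr_ge0// sum_powR_slow.
have sumE : \sum_(i < n.+1) `|(Et - e) i| <= B * S * X.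
  rewrite -(big_mkord xpredT (fun i => `|(Et - e) i|)) big_ltn//.
  rewrite -[(Et - e) 0%N]/(E 0%N * 1 - e 0%N) eE mulr1 subrr normr0 add0r.
  apply: (@le_trans _ _ (B * a * \sum_(1 <= i < n.+1) i%:R `^ (- s))).
    rewrite mulr_sumr; apply: ler_sum_nat => i /andP[i1 iN].
    by apply: le_trans (HE i _); rewrite ?i1.
  apply: (@le_trans _ _ (B * a * S)); first by rewrite ler_wpM2l ?mulr_ge0// sum_powR_le.
  by rewrite mulrAC ler_wpM2l// mulr_ge0// /S; move: i0; only_lra.
have sumS : \sum_(i < n.+1) `|sg i| <= B * Cd * X * V + B * S * X.
  apply: (@le_trans _ _ (\sum_(i < n.+1) (`|conv Hs (dif psi) i| + `|(Et - e) i|))).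
    by apply: ler_sum => i _; exact: ler_normD.
  rewrite big_split/=; apply: lerD => //.
  by apply: le_trans (sum_conv_le _ _ _) _; rewrite ler_wpM2r.
have KX : K * B * Cd * X <= 1 / 2 by move: small; rewrite -/Cd -/X; only_lra.
have Cd1 : 1 <= Cd by rewrite /Cd; move: q0; only_lra.
have KX2 : K * B * X <= 1 / 2.
  apply: le_trans KX; rewrite [leRHS]mulrAC ler_peMr// !mulr_ge0//.
have S0 : 0 <= S by rewrite /S; move: i0; only_lra.
have VV : V <= 2 * Kf + S.
  have h1 : V <= Kf + K * (B * Cd * X * V + B * S * X).
    apply: (@le_trans _ _ (\sum_(i < n.+1) (`|dif f i| + `|dif chi i|))).
      apply: ler_sum => -[[|i] ilt] _.
        rewrite [dif psi _]/= [dif f _]/= [dif chi _]/=.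
        by rewrite -[chi 0%N]/(psi 0%N - f 0%N) -{1}(subrK (f 0%N) (psi 0%N)) addrC ler_normD.
      rewrite [dif psi _]/= [dif f _]/= [dif chi _]/=.
      rewrite -[chi i.+1]/(psi i.+1 - f i.+1) -[chi i]/(psi i - f i).
      rewrite (_ : psi i.+1 - psi i = (f i.+1 - f i) + (psi i.+1 - f i.+1 - (psi i - f i))); last by ring.
      exact: ler_normD.
    rewrite big_split/=; apply: lerD => //.
    rewrite dchi; apply: le_trans (sum_conv_le _ _ _) _.
    by apply: ler_pM => //; apply: sumr_ge0.
  have h2 : K * B * Cd * X * V <= 1 / 2 * V by rewrite ler_wpM2r.
  have h3 : K * B * X * S <= 1 / 2 * S by rewrite ler_wpM2r.
  rewrite (_ : K * (_ + _) = K * B * Cd * X * V + K * B * X * S) in h1; last by ring.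
  move: h1 h2 h3; only_lra.
have -> : F n * c ^+ n - f n = conv phi sg n by rewrite -chiE.
apply: (@le_trans _ _ (K * \sum_(i < n.+1) `|sg i|)).
  rewrite convC mulr_sumr; apply: le_trans (ler_norm_sum _ _ _) _; apply: ler_sum => i _.
  by rewrite normrM mulrC ler_wpM2r// Kphi1// leq_subr.
apply: le_trans (ler_wpM2l K0 sumS) _; rewrite -/Cd -/S -/X.
have h : B * Cd * X * V <= B * Cd * X * (2 * Kf + S).
  by rewrite ler_wpM2l// !mulr_ge0//; move: Cd1; only_lra.
have := ler_wpM2l K0 h; only_lra.
Qed.

(** [x <= x `^ t] if [x <= 1], and [1 <= x `^ t] otherwise. *)
Lemma expR_sub1_le (x t : R) : 0 <= x -> 0 < t <= 1 -> expR x - 1 <= x `^ t * expR x.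
Proof.
move=> x0 /andP[t0 t1]; have e0 := expR_gt0 x.
have [x1|x1] := leP x 1.
  have h1 : expR x - 1 <= x * expR x.
    have h : expR x * (1 - x) <= 1.
      by rewrite -[leRHS](expRxMexpNx_1 x) ler_wpM2l ?expR_ge0// expR_ge1Dx.
    by move: h; rewrite mulrBr mulr1 [_ * x]mulrC; lra.
  apply: le_trans h1 _; rewrite ler_wpM2r ?expR_ge0//.
  have [->|xn] := eqVneq x 0; first by rewrite powR_ge0.
  have xp : 0 < x by rewrite lt_def xn.
  by apply: ger1_powR; rewrite ?xp.
apply: (@le_trans _ _ (expR x)); first by lra.
by rewrite ler_peMl ?expR_ge0// -[leLHS](powRr0 x) ler_powR// ltW.
Qed.

Lemma expR_sub1Dx_le (x t : R) : 0 <= x -> 0 < t <= 1 ->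
  expR x - 1 - x <= x `^ (1 + t) * expR x.
Proof.
move=> x0 t01; have /andP[t0 t1] := t01.
have h : expR x - 1 - x <= x * (expR x - 1).
  have h : expR x * (1 - x) <= 1.
    by rewrite -[leRHS](expRxMexpNx_1 x) ler_wpM2l ?expR_ge0// expR_ge1Dx.
  by move: h; rewrite mulrBr mulr1 [_ * x]mulrC; lra.
apply: le_trans h _.
have -> : x `^ (1 + t) = x * x `^ t.
  have [->|xn] := eqVneq x 0; first by rewrite mul0r powR0//; lra.
  by rewrite powRD ?powRr1// xn implybT.
by rewrite -mulrA ler_wpM2l// expR_sub1_le.
Qed.

(** Up to errors of order [a ^ (1 + t)] the tilted kernel has the same total
    mass as the critical one, since [v] is chosen to cancel the first order in
    [a]; the growth of the tilt costs a power [w] in the decay. *)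
Lemma tilt_kernel (theta t w v a B E0 : R) (g l G e E : nat -> R) (n : nat) :
  0 < t <= 1 -> 0 <= w -> 0 < v <= 2 -> 0 <= a -> 0 <= B -> 1 <= E0 ->
  1 < theta - 1 - t - w ->
  (forall m, (1 <= m <= n)%N -> expR (v * a) ^+ m <= E0 * m%:R `^ w) ->
  (forall m, (1 <= m)%N -> `|g m| <= B * m%:R `^ (- theta)) ->
  (forall m, (1 <= m)%N -> `|l m| <= B * m%:R `^ (- (theta - 1))) ->
  (forall m, (1 <= m)%N ->
     `|G m - g m - a * l m| <= B * a `^ (1 + t) * m%:R `^ (- theta + (1 + t))) ->
  (forall j, (1 <= j)%N ->
     `|\sum_(1 <= m < j.+1) (l m + v * (m%:R * g m))| <= B * j%:R `^ (- (theta - 2))) ->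
  (forall m, (1 <= m)%N -> `|e m| <= B * m%:R `^ (- theta)) ->
  (forall m, (1 <= m)%N -> `|E m - e m| <= B * a * m%:R `^ (- (theta - 1))) ->
  forall j, (1 <= j <= n)%N ->
  `|\sum_(1 <= m < j.+1) (G m * expR (v * a) ^+ m - g m)| <=
    7 * B * E0 * (1 + (theta - 1 - t - w - 1)^-1) * a `^ (1 + t) + B * a * j%:R `^ (- (theta - 2)) /\
  `|E j * expR (v * a) ^+ j - e j| <= 3 * B * E0 * a * j%:R `^ (- (theta - 1 - w)).
Proof.
move=> t01 w0 /andP[v0 v2] a0 B0 E01 kap Hx Hg Hl HG Hsum He HE j /andP[j1 jn].
have /andP[t0 t1] := t01; have E00 : 0 <= E0 by lra.
have va0 : 0 <= v * a by rewrite mulr_ge0// ltW.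
have xE m : expR (v * a) ^+ m = expR (v * (a * m%:R)) by rewrite mulrA expRM_natr.
have x0 m : 0 <= v * (a * m%:R) by rewrite mulr_ge0 ?(ltW v0)// mulr_ge0.
have x1 m : 1 <= expR (v * a) ^+ m by rewrite xE; have := expR_ge1Dx (v * (a * m%:R)); have := x0 m; lra.
pose kp := theta - 1 - t - w.
have pw m : (1 <= m)%N -> m%:R `^ (- theta + (1 + t)) * m%:R `^ w = m%:R `^ (- kp) :> R.
  move=> m1; rewrite -powRD; first by congr (_ `^ _); rewrite /kp; ring.
  by rewrite (gt_eqF (_ : 0 < m%:R :> R)) ?ltr0n ?implybT.
have vt m s : 0 < s <= 2 -> (v * (a * m%:R)) `^ s <= 4 * (a `^ s * m%:R `^ s).
  move=> /andP[s0 s2]; rewrite powRM ?mulr_ge0 ?(ltW v0)// powRM//.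
  rewrite ler_wpM2r ?mulr_ge0 ?powR_ge0//.
  apply: (@le_trans _ _ (2 `^ s)); first by rewrite ge0_ler_powR ?nnegrE// ltW.
  apply: (@le_trans _ _ (2 `^ 2)); first by rewrite ler_powR ?ler1n.
  by rewrite powR_mulrn// expr2; lra.
have vt1 m : (v * (a * m%:R)) `^ t <= 2 * (a `^ t * m%:R `^ t).
  rewrite powRM ?mulr_ge0 ?(ltW v0)// powRM//.
  rewrite ler_wpM2r ?mulr_ge0 ?powR_ge0//.
  apply: (@le_trans _ _ (2 `^ t)); first by rewrite ge0_ler_powR ?nnegrE// ltW.
  by rewrite -[leRHS]powRr1// ler_powR ?ler1n.
have aat : a * a `^ t = a `^ (1 + t).
  have [->|an] := eqVneq a 0; first by rewrite mul0r powR0//; lra.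
  by rewrite powRD ?powRr1// an implybT.
split; last first.
  have -> : E j * expR (v * a) ^+ j - e j = (E j - e j) * expR (v * a) ^+ j + e j * (expR (v * a) ^+ j - 1).
    by ring.
  have Hxj : expR (v * a) ^+ j <= E0 * j%:R `^ w by apply: Hx; rewrite j1.
  have h1 : expR (v * a) ^+ j - 1 <= 2 * (a * j%:R) * (E0 * j%:R `^ w).
    rewrite xE; apply: le_trans (expR_sub1_le (x0 j) (_ : 0 < 1 <= 1)) _; first by rewrite ltr01 lexx.
    rewrite powRr1//; apply: ler_pM; [exact: x0|exact: expR_ge0| |by rewrite -xE].
    by rewrite ler_wpM2r// mulr_ge0.
  have P1 : j%:R `^ (- (theta - 1)) * j%:R `^ w = j%:R `^ (- (theta - 1 - w)) :> R.
    rewrite -powRD; first by congr (_ `^ _); ring.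
    by rewrite (gt_eqF (_ : 0 < j%:R :> R)) ?ltr0n ?implybT.
  apply: le_trans (ler_normD _ _) _; rewrite !normrM.
  rewrite (ger0_norm (le_trans ler01 (x1 j))) (@ger0_norm _ (_ - 1)); last by have := x1 j; lra.
  have h2 := ler_pM (normr_ge0 _) (le_trans ler01 (x1 j)) (HE j j1) Hxj.
  have h3 : `|e j| * (expR (v * a) ^+ j - 1) <= B * j%:R `^ (- theta) * (2 * (a * j%:R) * (E0 * j%:R `^ w)).
    by apply: ler_pM => //; [have := x1 j; only_lra|exact: He].
  apply: le_trans (lerD h2 h3) _; rewrite -P1 -natr_powR//.
  by rewrite le_eqVlt; apply/orP; left; apply/eqP; ring.
have E1 : \sum_(1 <= m < j.+1) (G m * expR (v * a) ^+ m - g m) =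
  \sum_(1 <= m < j.+1) ((G m - g m - a * l m) * expR (v * a) ^+ m +
     a * l m * (expR (v * a) ^+ m - 1) + g m * (expR (v * a) ^+ m - 1 - v * (a * m%:R))) +
  a * \sum_(1 <= m < j.+1) (l m + v * (m%:R * g m)).
  by rewrite mulr_sumr -big_split/=; apply: eq_bigr => m _; ring.
rewrite E1; apply: le_trans (ler_normD _ _) _; apply: lerD; last first.
  rewrite normrM ger0_norm// [B * a]mulrC -mulrA ler_wpM2l//; exact: Hsum.
apply: le_trans (ler_norm_sum _ _ _) _.
apply: (@le_trans _ _ (7 * B * E0 * a `^ (1 + t) * \sum_(1 <= m < j.+1) m%:R `^ (- kp))); last first.
  rewrite [leRHS]mulrAC ler_wpM2l ?mulr_ge0 ?powR_ge0//.
  exact: sum_powR_le.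
rewrite mulr_sumr; apply: ler_sum_nat => m /andP[m1 mj].
have mn : (1 <= m <= n)%N by rewrite m1 (leq_trans _ jn).
have Hxm := Hx m mn; have x1m := x1 m; have x0m : 0 <= expR (v * a) ^+ m by move: x1m; only_lra.
have Pw := pw m m1.
have h1 : `|(G m - g m - a * l m) * expR (v * a) ^+ m| <= B * E0 * a `^ (1 + t) * m%:R `^ (- kp).
  rewrite normrM (ger0_norm x0m); apply: le_trans (ler_pM (normr_ge0 _) x0m (HG m m1) Hxm) _.
  by rewrite -Pw le_eqVlt; apply/orP; left; apply/eqP; ring.
have h2 : `|a * l m * (expR (v * a) ^+ m - 1)| <= 2 * (B * E0 * a `^ (1 + t) * m%:R `^ (- kp)).
  rewrite normrM normrM (ger0_norm a0) (@ger0_norm _ (_ - 1)); last by move: x1m; only_lra.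
  have hx : expR (v * a) ^+ m - 1 <= 2 * (a `^ t * m%:R `^ t) * (E0 * m%:R `^ w).
    rewrite xE; apply: le_trans (expR_sub1_le (x0 m) t01) _.
    by apply: ler_pM => //; rewrite ?powR_ge0 ?expR_ge0// -xE.
  apply: le_trans (ler_pM _ _ (ler_wpM2l a0 (Hl m m1)) hx) _; rewrite ?mulr_ge0//; first by move: x1m; only_lra.
  rewrite -Pw -aat.
  have -> : m%:R `^ (- theta + (1 + t)) = m%:R `^ (- (theta - 1)) * m%:R `^ t :> R.
    rewrite -powRD; first by congr (_ `^ _); ring.
    by rewrite (gt_eqF (_ : 0 < m%:R :> R)) ?ltr0n ?implybT.
  by rewrite le_eqVlt; apply/orP; left; apply/eqP; ring.
have h3 : `|g m * (expR (v * a) ^+ m - 1 - v * (a * m%:R))| <= 4 * (B * E0 * a `^ (1 + t) * m%:R `^ (- kp)).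
  have y0 : 0 <= expR (v * a) ^+ m - 1 - v * (a * m%:R).
    by rewrite xE; have := expR_ge1Dx (v * (a * m%:R)); only_lra.
  rewrite normrM (ger0_norm y0).
  have hx : expR (v * a) ^+ m - 1 - v * (a * m%:R) <= 4 * (a `^ (1 + t) * m%:R `^ (1 + t)) * (E0 * m%:R `^ w).
    rewrite xE; apply: le_trans (expR_sub1Dx_le (x0 m) t01) _.
    apply: ler_pM => //; rewrite ?powR_ge0 ?expR_ge0// -?xE//.
    by apply: vt; move: t0 t1; only_lra.
  apply: le_trans (ler_pM (normr_ge0 _) y0 (Hg m m1) hx) _.
  rewrite -Pw.
  have -> : m%:R `^ (- theta + (1 + t)) = m%:R `^ (- theta) * m%:R `^ (1 + t) :> R.
    by rewrite -powRD// (gt_eqF (_ : 0 < m%:R :> R)) ?ltr0n ?implybT.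
  by rewrite le_eqVlt; apply/orP; left; apply/eqP; ring.
apply: le_trans (ler_normD _ _) _; apply: le_trans (lerD (ler_normD _ _) (lexx _)) _.
move: h1 h2 h3; only_lra.
Qed.

(** [m ln n = m ln m + m ln (n / m)], where the last term is at most [n]: the
    tilt costs only a power of [m], up to a constant. *)
Lemma tilt_growth (gam v a : R) n m : 0 <= gam -> 0 <= v -> (1 <= m <= n)%N ->
  a <= gam * n%:R^-1 * ln n%:R ->
  expR (v * a) ^+ m <= expR (v * gam) * m%:R `^ (v * gam).
Proof.
move=> g0 v0 /andP[m1 mn] ha.
have m0 : 0 < m%:R :> R by rewrite ltr0n.
have n0 : 0 < n%:R :> R by rewrite ltr0n; nlia.
rewrite -expRM_natr /powR gt_eqF// -expRD ler_expR -mulrA -[X in X + _]mulr1 -!mulrA -!mulrDr.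
rewrite ler_wpM2l//; apply: le_trans (ler_wpM2r (ltW m0) ha) _.
rewrite -!mulrA ler_wpM2l// mulrC ler_pdivrMr// mulrC.
have nm : 0 < n%:R / m%:R :> R by rewrite divr_gt0.
have -> : ln n%:R = ln m%:R + ln (n%:R / m%:R) :> R by rewrite ln_div ?posrE// addrC subrK.
have l0 : 0 <= ln m%:R :> R by rewrite ln_ge0// ler1n.
have h1 : m%:R * ln m%:R <= n%:R * ln m%:R :> R by rewrite ler_wpM2r// ler_nat.
have h2 : m%:R * ln (n%:R / m%:R) <= n%:R :> R.
  by rewrite mulrC -ler_pdivlMr// ltW// ln_sublinear.
by rewrite mulrDr mulrDl mul1r [ln m%:R * _]mulrC; lra.
Qed.

Lemma ln_le_powR (t : R) n : 0 < t -> (1 <= n)%N -> ln n%:R <= t^-1 * n%:R `^ t.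
Proof.
by move=> t0 n1; rewrite ler_pdivlMl// -ln_powR ltW// ln_sublinear// powR_gt0 ?ltr0n.
Qed.

End Tilt.

(** * Integration over the torus *)

Lemma rV_norm_leP (R : realType) d (k : 'rV[R]_d) (c : R) : 0 <= c ->
  `|k| <= c <-> forall i, `|k 0 i| <= c.
Proof.
move=> c0; rewrite -[`|k|]/(mx_norm k) mx_normrE; split => [H i|H].
  by apply: le_trans H; exact: (le_bigmax _ (fun ij : 'I_1 * 'I_d => `|k ij.1 ij.2|) (ord0, i)).
by apply: bigmax_le => // -[a i] _; rewrite ord1 H.
Qed.

Section TorusIntegral.
Variable R : realType.
Local Open Scope ereal_scope.
Local Notation mR := (measurableTypeR R).
Local Notation U := (uniform_prob (Npi_lt_pi R)).

Lemma torus_integralS n (f : n.+1.-tuple mR -> \bar R) :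
  measurable_fun setT f -> (forall x, 0 <= f x) ->
  \int[torus_measure R n.+1]_t f t =
  \int[U]_x \int[torus_measure R n]_t f (tcons (x, t)).
Proof.
move=> mf f0; rewrite /= ge0_integral_distribution//.
rewrite (@fubini_tonelli1 _ _ _ _ _ _ _ (f \o @tcons R n))//.
  by apply: measurableT_comp => //; exact: measurable_tcons.
by move=> x; exact: f0.
Qed.

Lemma torus_integral0 (f : 0.-tuple mR -> \bar R) :
  measurable_fun setT f -> \int[torus_measure R 0]_t f t = f [tuple].
Proof. by move=> mf; rewrite integral_dirac// diracT mul1e. Qed.

Lemma measurable_tcons_slice n (x : mR) (f : n.+1.-tuple mR -> \bar R) :
  measurable_fun setT f -> measurable_fun setT (fun t => f (tcons (x, t))).
Proof.
move=> mf; apply: (@measurableT_comp _ _ _ _ _ _ f) => //.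
exact: (@measurable_cons _ _ (n.-tuple mR) mR (cst x) n id).
Qed.

Lemma measurable_torus_inner n (f : n.+1.-tuple mR -> \bar R) :
  measurable_fun setT f -> (forall x, 0 <= f x) ->
  measurable_fun setT (fun x : mR => \int[torus_measure R n]_t f (tcons (x, t))).
Proof.
move=> mf f0.
apply: (@measurable_fun_fubini_tonelli_F _ _ _ _ _ _ (f \o @tcons R n)) => //.
  by apply: measurableT_comp => //; exact: measurable_tcons.
by move=> x; exact: f0.
Qed.

(** The functions of interest are only known through pointwise bounds and need
    not be measurable; for nonnegative functions the definition of the integral
    as a supremum over simple functions gives monotonicity all the same. *)
Lemma ge0_le_integral_nonmeasurable d (T : measurableType d)
  (mu : {measure set T -> \bar R}) (f g : T -> \bar R) :
  (forall x, 0 <= f x) -> (forall x, f x <= g x) ->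
  \int[mu]_x f x <= \int[mu]_x g x.
Proof.
move=> f0 fg; have g0 x : 0 <= g x by exact: le_trans (fg x).
rewrite !ge0_integralTE//; apply: ereal_sup_le => _ [h hf <-].
exists h => // x; exact: le_trans (hf x) (fg x).
Qed.

(** Comparison with a derivative replaces the computation of the integral. *)
Lemma uniform_integral_le (f F F' : R -> R) (r : R) :
  (0 < r <= pi)%R -> measurable_fun setT (f : mR -> mR) -> (forall x, 0 <= f x)%R ->
  (forall x, ~ (- r <= x <= r) -> - pi <= x <= pi -> f x = 0)%R ->
  (forall x, - r <= x <= r -> f x <= F' x)%R ->
  (forall x : R, is_derive x 1%R F (F' x)) -> continuous F' ->
  \int[U]_x (f x)%:E <= ((F r - F (- r)) / (2 * pi))%:E.
Proof.
move=> /andP[r0 rpi] mf f0 fout fin dF cF'.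
rewrite integral_uniform; last 2 first.
- exact/measurable_EFinP.
- by move=> x; rewrite lee_fin.
have rr : (- r < r)%R by rewrite gtrN.
have -> : \int[lebesgue_measure]_(x in `[(- pi)%R, pi]) (f x)%:E =
          \int[lebesgue_measure]_(x in `[(- r)%R, r]) (f x)%:E.
  have -> : `[(- r)%R, r]%classic = `[(- pi)%R, pi]%classic `&` `[(- r)%R, r]%classic.
    apply/seteqP; split => [x|x [_]//].
    rewrite /= !in_itv/= => /andP[rx xr]; split; last by rewrite rx xr.
    by rewrite (le_trans xr rpi) (le_trans _ rx)// lerN2.
  rewrite [RHS]integral_mkcondr; apply: eq_integral => x.
  rewrite inE/= in_itv/= => xpi; rewrite patchE; case: ifPn => // xr; rewrite fout//.
  by move: xr; rewrite notin_setE/= in_itv/=.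
have := @continuous_FTC2 R F' F (- r) r rr.
move=> /(_ _ _ _) FTC.
have {}FTC : \int[lebesgue_measure]_(x in `[(- r)%R, r]) (F' x)%:E = (F r)%:E - (F (- r))%:E.
  apply: FTC.
  - by apply: continuous_subspaceT.
  - have cF x : {for x, continuous F}.
      by apply: differentiable_continuous; apply/derivable1_diffP; exact: ex_derive.
    split.
    + by move=> x _; exact: ex_derive.
    + by apply: cvg_at_right_filter; exact: cF.
    + by apply: cvg_at_left_filter; exact: cF.
  - by move=> x _; rewrite derive1E; exact: derive_val.
have -> : (pi - - pi = 2 * pi :> R)%R by ring.
have p0 : (0 < 2 * pi :> R)%R by rewrite mulr_gt0// pi_gt0.
rewrite [((_ - _) / _)%R]mulrC EFinM lee_pmul2l ?lte_fin ?invr_gt0//.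
rewrite EFinB -FTC; apply: ge0_le_integral => //=.
- by move=> x _; rewrite lee_fin.
- by apply/measurable_funTS/measurable_EFinP.
- apply/measurable_funTS/measurable_EFinP.
  exact: continuous_measurable_fun.
Qed.

Lemma measurable_prod_tnth n (f : R -> R) : measurable_fun setT (f : mR -> mR) ->
  measurable_fun setT (fun t : n.-tuple mR => (\prod_(i < n) f (tnth t i))%R).
Proof.
move=> mf; apply: measurable_prod => i _.
by apply: (@measurableT_comp _ _ _ _ _ _ (f : mR -> mR)) => //; exact: measurable_tnth.
Qed.

Lemma torus_integral_prod n (f : R -> R) (c : R) : (0 <= c)%R ->
  measurable_fun setT (f : mR -> mR) -> (forall x, 0 <= f x)%R ->
  \int[U]_x (f x)%:E <= c%:E ->
  \int[torus_measure R n]_t (\prod_(i < n) f (tnth t i))%:E <= (c ^+ n)%:E.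
Proof.
move=> c0 mf f0 fc; elim: n => [|n IH].
  rewrite torus_integral0; last by apply/measurable_EFinP; exact: measurable_prod_tnth.
  by rewrite big_ord0.
rewrite torus_integralS; last 2 first.
- by apply/measurable_EFinP; exact: measurable_prod_tnth.
- by move=> t; rewrite lee_fin; apply: prodr_ge0.
have mP : measurable_fun setT (fun t : n.-tuple mR => (\prod_(i < n) f (tnth t i))%:E).
  by apply/measurable_EFinP; exact: measurable_prod_tnth.
apply: (@le_trans _ _ (\int[U]_x ((f x)%:E * (c ^+ n)%:E))).
  apply: ge0_le_integral_nonmeasurable => x.
    by apply: integral_ge0 => t _; rewrite lee_fin; apply: prodr_ge0.
  under eq_integral => t _.
    rewrite big_ord_recl /= EFinM.
    rewrite (_ : tnth (tcons (x, t)) ord0 = x)//.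
    under eq_bigr do rewrite tnthS.
    over.
  rewrite ge0_integralZl_EFin//; last by move=> t _; rewrite lee_fin; apply: prodr_ge0.
  by apply: lee_wpmul2l; [rewrite lee_fin|exact: IH].
rewrite ge0_integralZr//; last 3 first.
- exact/measurable_EFinP.
- by move=> x _; rewrite lee_fin.
- by rewrite lee_fin exprn_ge0.
by rewrite exprS EFinM lee_pmul// ?lee_fin ?exprn_ge0//; apply: integral_ge0 => t _; rewrite lee_fin.
Qed.

Lemma torus_integral_out n (f : n.-tuple mR -> \bar R) :
  measurable_fun setT f -> (forall t, 0 <= f t) ->
  (forall t, (forall i, `|tnth t i| <= pi)%R -> f t = 0) ->
  \int[torus_measure R n]_t f t = 0.
Proof.
elim: n f => [|n IH] f mf f0 fz.
  by rewrite torus_integral0// fz// => -[].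
rewrite torus_integralS//.
rewrite integral_uniform; last 2 first.
- exact: measurable_torus_inner.
- by move=> x; apply: integral_ge0.
rewrite [X in _ * X](_ : _ = 0) ?mule0//.
apply: integral0_eq => x; rewrite /= in_itv/= => xpi.
apply: IH => //; first exact: measurable_tcons_slice.
move=> t Ht; apply: fz => i.
case: (unliftP ord0 i) => [j ->|->]; last by rewrite /= ler_norml.
by rewrite /tcons tnthS.
Qed.

(** The domination is only assumed on the cube; as its complement is a null set,
    the majorant may be made infinite there. *)
Lemma torus_norm_le d (p c : R) (h : 'rV[R]_d -> R) (G : d.-tuple mR -> R) :
  (1 <= p)%R -> (0 <= c)%R -> measurable_fun setT G -> (forall t, 0 <= G t)%R ->
  (forall k, cube k -> `|h k| `^ p <= G [tuple k ord0 i | i < d])%R ->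
  \int[torus_measure R d]_t (G t)%:E <= (c `^ p)%:E ->
  torus_norm p h <= c%:E.
Proof.
move=> p1 c0 mG G0 hG IG.
have p0 : (0 < p)%R by rewrite (lt_le_trans _ p1).
rewrite /torus_norm unlock.
have -> : c%:E = (c `^ p)%:E `^ p^-1 by rewrite poweR_EFin -powRrM divff ?gt_eqF// powRr1.
apply: gt0_ler_poweR; rewrite ?invr_ge0 ?(ltW p0)// ?in_itv/= ?andbT ?leey ?lee_fin ?powR_ge0//.
  by rewrite integral_ge0// => t _; exact: poweR_ge0.
pose cT : set (d.-tuple mR) := [set t | forall i, (`|tnth t i| <= pi)%R].
have mcT : measurable cT.
  have -> : cT = \bigcap_(i in [set: 'I_d]) ((fun t => tnth t i) @^-1` `[(- pi)%R, pi]%classic).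
    apply/seteqP; split => t /= H i; first by move=> _; rewrite /= in_itv/= -ler_norml; exact: H.
    by have := H i I; rewrite /= in_itv/= -ler_norml.
  apply: fin_bigcap_measurable => // i _.
  rewrite -[X in measurable X]setTI; apply: (@measurable_tnth _ mR) => //.
pose inf t : \bar R := if t \in cT then 0 else +oo.
have inf0 t : 0 <= inf t by rewrite /inf; case: ifP => // _; exact: leey.
have minf : measurable_fun setT inf.
  apply: measurable_fun_ifT => //; apply: (measurable_fun_bool true).
  rewrite setTI (_ : _ @^-1` _ = cT)//.
  by apply/seteqP; split => t /= => [/set_mem|/mem_set].
apply: (@le_trans _ _ (\int[torus_measure R d]_t ((G t)%:E + inf t))); last first.
  rewrite ge0_integralD//; last 2 first.
  - by move=> t _; rewrite lee_fin.
  - exact/measurable_EFinP.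
  rewrite (@torus_integral_out _ inf) ?adde0// => t Ht.
  by rewrite /inf ifT//; apply/mem_set.
apply: ge0_le_integral_nonmeasurable => t; first by rewrite lee_fin powR_ge0.
rewrite /inf; case: ifPn => [|_]; last by rewrite addey// leey.
rewrite inE => tc; rewrite adde0 lee_fin.
have -> : t = [tuple (\row_i tnth t i) ord0 i | i < d].
  by apply: eq_from_tnth => i; rewrite tnth_mktuple mxE.
have -> : (\row_i tnth [tuple (\row_i0 tnth t i0) ord0 i1 | i1 < d] i = \row_i tnth t i :> 'rV[R]_d)%R.
  by apply/rowP => i; rewrite !mxE tnth_mktuple mxE.
by apply: hG; apply/rV_norm_leP => // [|i]; [exact: pi_ge0|rewrite mxE].
Qed.

Local Open Scope ring_scope.

Lemma integral_prob_cst d (T : measurableType d) (P : probability T R) (r : R) :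
  (\int[P]_x r%:E = r%:E)%E.
Proof. by have := @expectation_cst _ _ _ P r; rewrite unlock. Qed.

Lemma sin_natpi n : sin (n%:R * pi) = 0 :> R.
Proof.
elim: n => [|n IH]; first by rewrite mul0r sin0.
by rewrite -natr1 mulrDl mul1r sinDpi IH oppr0.
Qed.

Lemma sin_intpi (m : int) : sin (m%:~R * pi) = 0 :> R.
Proof.
by case: m => n; rewrite ?NegzE ?mulrNz ?mulNr ?sinN ?sin_natpi ?oppr0//; exact: sin_natpi.
Qed.

Lemma uniform_cos (m : int) (c : R) :
  (\int[U]_x (1 + cos (x * m%:~R + c))%:E = (1 + (m == 0)%:R * cos c)%:E)%E.
Proof.
have [->|m0] := eqVneq m 0.
  under eq_integral do rewrite mulr0 add0r.
  by rewrite mul1r; exact: (@integral_prob_cst _ _ (uniform_prob (Npi_lt_pi R))).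
have mR0 : m%:~R != 0 :> R by rewrite intr_eq0.
have ccos : continuous (fun x : R => 1 + cos (x * m%:~R + c)).
  move=> x; apply: cvgD; first exact: cvg_cst.
  apply: continuous_comp; last exact: continuous_cos.
  by apply: cvgD; [apply: cvgM; [exact: cvg_id|exact: cvg_cst]|exact: cvg_cst].
rewrite integral_uniform; last 2 first.
- by apply/measurable_EFinP; exact: continuous_measurable_fun.
- by move=> x; rewrite lee_fin -lerBlDl sub0r cos_geN1.
pose F (x : R) : R := x + (m%:~R)^-1 * sin (x * m%:~R + c).
have dF (x : R) : is_derive x 1 F (1 + cos (x * m%:~R + c)).
  rewrite /F; apply: is_derive_eq; rewrite /GRing.scale/=.
  by rewrite mulr0 mulr1 !add0r addr0; field.
have cF x : {for x, continuous F}.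
  by apply: differentiable_continuous; apply/derivable1_diffP; exact: ex_derive.
have ppi : - pi < pi :> R by exact: Npi_lt_pi.
rewrite (@continuous_FTC2 R (fun x => 1 + cos (x * m%:~R + c)) F)//; last 3 first.
- exact: continuous_subspaceT.
- split; first by move=> x _; exact: ex_derive.
  + by apply: cvg_at_right_filter; exact: cF.
  + by apply: cvg_at_left_filter; exact: cF.
- by move=> x _; rewrite derive1E; exact: derive_val.
rewrite -EFinB -EFinM; congr EFin.
have -> : F pi - F (- pi) = 2 * pi.
  by rewrite /F mulNr !sinD sinN cosN (mulrC pi) sin_intpi; ring.
have -> : pi - - pi = 2 * pi :> R by ring.
by rewrite mul0r addr0 mulVf// gt_eqF// mulr_gt0// pi_gt0.
Qed.

Lemma torus_cos n (y : 'I_n -> int) (c : R) :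
  (\int[torus_measure R n]_t (1 + cos (\sum_i tnth t i * (y i)%:~R + c))%:E =
   (1 + [forall i, y i == 0]%:R * cos c)%:E)%E.
Proof.
elim: n y c => [|n IH] y c.
  rewrite torus_integral0; last first.
    rewrite (_ : (fun _ => _) = cst (1 + cos c)%:E)//.
    by apply/funext => t; rewrite big_ord0 add0r.
  rewrite big_ord0 add0r (_ : [forall i, _] = true) ?mul1r//.
  by apply/forallP => -[].
have mcos : measurable_fun setT (fun t : n.+1.-tuple mR => 1 + cos (\sum_i tnth t i * (y i)%:~R + c)).
  apply: measurable_funD => //.
  apply: (@measurableT_comp _ _ _ _ _ _ (@cos R)).
    by apply: continuous_measurable_fun; exact: continuous_cos.
  apply: measurable_funD => //; apply: measurable_sum => i.
  by apply: measurable_funM => //; exact: measurable_tnth.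
rewrite torus_integralS; last 2 first.
- exact/measurable_EFinP.
- by move=> t; rewrite lee_fin -lerBlDl sub0r cos_geN1.
pose y' i := y (lift ord0 i).
under eq_integral => x _.
  under eq_integral => t _.
    rewrite big_ord_recl (_ : tnth (tcons (x, t)) ord0 = x)//.
    rewrite (eq_bigr (fun i => tnth t i * (y' i)%:~R)); last first.
      by move=> i _; rewrite /tcons tnthS.
    rewrite addrAC addrC.
    over.
  rewrite IH.
  over.
have -> : [forall i, y i == 0] = (y ord0 == 0) && [forall i, y' i == 0].
  apply/forallP/andP => [H|[H0 /forallP H] i]; first by split => //; apply/forallP => i; exact: H.
  by case: (unliftP ord0 i) => [j ->|->]//; exact: H.
case: [forall i, y' i == 0]; last first.
  rewrite andbF.
  under eq_integral do rewrite mul0r addr0.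
  by rewrite mul0r addr0; exact: (@integral_prob_cst _ _ (uniform_prob (Npi_lt_pi R))).
rewrite andbT.
under eq_integral do rewrite mul1r.
exact: uniform_cos.
Qed.

End TorusIntegral.

(** * Cosine sums and one-dimensional integrals *)

Section LpBound.
Variable R : realType.
Local Notation mR := (measurableTypeR R).
Local Notation U := (uniform_prob (Npi_lt_pi R)).

Lemma sum_eq_count (T : eqType) (x : T) (s : seq T) :
  \sum_(y <- s) (x == y)%:R = (count_mem x s)%:R :> R.
Proof.
by elim: s => [|y s IH]; rewrite ?big_nil// big_cons IH/= natrD eq_sym.
Qed.

(** Half of Parseval's identity, for finite cosine sums. The integrands are
    kept nonnegative by adding 1 to each cosine. *)
Lemma torus_bessel d (F : seq 'rV[int]_d) (w : 'rV[int]_d -> R) (W : R) :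
  uniq F -> (forall x, 0 <= w x <= W) ->
  (\int[torus_measure R d]_t
     ((\sum_(x <- F) w x * cos (\sum_i tnth t i * (x 0 i)%:~R)) ^+ 2)%:E <=
   (W * \sum_(x <- F) w x)%:E)%E.
Proof.
move=> uF w0W.
pose ph (x : 'rV[int]_d) (t : d.-tuple mR) : R := \sum_i tnth t i * (x 0 i)%:~R.
pose S t := \sum_(x <- F) w x * cos (ph x t).
have mph x : measurable_fun setT (ph x).
  by apply: measurable_sum => i; apply: measurable_funM => //; exact: measurable_tnth.
have mcos (h : d.-tuple mR -> R) : measurable_fun setT h -> measurable_fun setT (fun t => cos (h t)).
  move=> mh; apply: (@measurableT_comp _ _ _ _ _ _ (@cos R)) => //.
  by apply: continuous_measurable_fun; exact: continuous_cos.
have mS : measurable_fun setT S.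
  by apply: measurable_sum => x; apply: measurable_funM => //; exact: mcos.
pose T := \sum_(x <- F) w x.
have w0 x : 0 <= w x by have /andP[] := w0W x.
pose P := [seq (x, y) | x <- F, y <- F].
pose term (xy : 'rV[int]_d * 'rV[int]_d) (t : d.-tuple mR) : R :=
  w xy.1 * w xy.2 / 2 * ((1 + cos (ph (xy.1 - xy.2) t)) + (1 + cos (ph (xy.1 + xy.2) t))).
have phD x y t : ph (x + y) t = ph x t + ph y t.
  by rewrite -big_split/=; apply: eq_bigr => i _; rewrite mxE intrD mulrDr.
have phB x y t : ph (x - y) t = ph x t - ph y t.
  by rewrite -sumrB; apply: eq_bigr => i _; rewrite !mxE intrB mulrBr.
have ST t : S t ^+ 2 + T ^+ 2 = \sum_(xy <- P) term xy t.
  rewrite big_allpairs/= !expr2 !big_distrlr/= -big_split/=; apply: eq_bigr => x _.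
  rewrite -big_split/=; apply: eq_bigr => y _.
  by rewrite /term/= phB phD cosB cosD; field.
have term0 xy t : 0 <= term xy t.
  apply: mulr_ge0; first by rewrite divr_ge0// mulr_ge0.
  have := cos_geN1 (ph (xy.1 - xy.2) t); have := cos_geN1 (ph (xy.1 + xy.2) t); lra.
pose mcp (h : d.-tuple mR -> R) := fun t => (1 + cos (h t)).
have mcp1 x : measurable_fun setT (fun t => (1 + cos (ph x t))%:E).
  by apply/measurable_EFinP; apply: measurable_funD => //; exact: mcos.
have cosp x t : (0 <= (1 + cos (ph x t))%:E)%E.
  by rewrite lee_fin; have := cos_geN1 (ph x t); lra.
have intc (x : 'rV[int]_d) : (\int[torus_measure R d]_t (1 + cos (ph x t))%:E = (1 + (x == 0)%:R)%:E)%E.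
  have := torus_cos (fun i => x 0 i) (0 : R); rewrite cos0 mulr1.
  under eq_integral do rewrite addr0.
  rewrite /ph => ->; congr (_ + _%:R)%:E.
  congr nat_of_bool; apply/idP/idP => [/forallP H|/eqP ->]; last by apply/forallP => i; rewrite mxE.
  by apply/eqP/rowP => i; rewrite mxE; apply/eqP; exact: H.
have intt xy : (\int[torus_measure R d]_t (term xy t)%:E =
   (w xy.1 * w xy.2 / 2 * (2 + (xy.1 == xy.2)%:R + (xy.1 == - xy.2)%:R))%:E)%E.
  under eq_integral do rewrite /term EFinM EFinD.
  rewrite ge0_integralZl_EFin//; last 3 first.
  - by move=> t _; rewrite adde_ge0.
  - exact: emeasurable_funD.
  - by rewrite divr_ge0// mulr_ge0.
  rewrite ge0_integralD// !intc -EFinD -EFinM; congr (_ * _)%:E.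
  by rewrite subr_eq0 addr_eq0; ring.
have mS2 : measurable_fun setT (fun t => (S t ^+ 2)%:E).
  by apply/measurable_EFinP; exact: measurable_funX.
have key : (\int[torus_measure R d]_t (S t ^+ 2)%:E + (T ^+ 2)%:E =
    (\sum_(xy <- P) w xy.1 * w xy.2 / 2 * (2 + (xy.1 == xy.2)%:R + (xy.1 == - xy.2)%:R))%:E)%E.
  rewrite -(integral_prob_cst (torus_measure R d) (T ^+ 2)) -ge0_integralD//; last 2 first.
  - by move=> t _; rewrite lee_fin sqr_ge0.
  - by move=> t _; rewrite lee_fin sqr_ge0.
  under eq_integral do rewrite -EFinD ST -sumEFin.
  rewrite ge0_integral_sum//; last 2 first.
  - move=> xy; under eq_fun do rewrite /term EFinM EFinD.
    by apply: emeasurable_funM => //; exact: emeasurable_funD.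
  - by move=> xy t _; rewrite lee_fin.
  by rewrite -sumEFin; apply: eq_bigr => xy _; exact: intt.
have uniqle x : \sum_(y <- F) (x == y)%:R <= 1 :> R.
  by rewrite sum_eq_count count_uniq_mem// lern1 leq_b1.
have rle : \sum_(xy <- P) w xy.1 * w xy.2 / 2 * (2 + (xy.1 == xy.2)%:R + (xy.1 == - xy.2)%:R) <=
   T ^+ 2 + W * T.
  rewrite big_allpairs/= expr2 big_distrlr/= mulr_sumr -big_split/=; apply: ler_sum => x _.
  apply: (@le_trans _ _ (\sum_(y <- F) (w x * w y + w x * W / 2 * ((x == y)%:R + (- x == y)%:R)))).
    apply: ler_sum => y _; have /andP[wy0 wyW] := w0W y.
    rewrite (_ : (x == - y) = (- x == y)); last by rewrite eqr_oppLR.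
    have h : w x * w y / 2 * ((x == y)%:R + (- x == y)%:R) <= w x * W / 2 * ((x == y)%:R + (- x == y)%:R).
      by rewrite ler_wpM2r ?addr_ge0// ler_wpM2r ?invr_ge0// ler_wpM2l.
    by rewrite (_ : _ * (2 + _ + _) = w x * w y + w x * w y / 2 * ((x == y)%:R + (- x == y)%:R));
      [rewrite lerD2l|field].
  rewrite big_split/= lerD2l -mulr_sumr big_split/=.
  have W0 : 0 <= w x * W / 2.
    by rewrite divr_ge0// mulr_ge0//; have /andP[] := w0W x; lra.
  apply: (@le_trans _ _ (w x * W / 2 * (1 + 1))); last by rewrite [leRHS]mulrC; lra.
  by rewrite ler_wpM2l// lerD.
move: key; rewrite -/(S _).
have : (0 <= \int[torus_measure R d]_t (S t ^+ 2)%:E)%E.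
  by apply: integral_ge0 => t _; rewrite lee_fin sqr_ge0.
case: (\int[torus_measure R d]_t (S t ^+ 2)%:E)%E => [r|//|//] _.
by rewrite -EFinD => -[] key; rewrite lee_fin -/T; move: rle; rewrite -key; lra.
Qed.

Lemma cont_sqr (A : R) : continuous (fun x : R => (A * x) ^+ 2).
Proof.
move=> x; rewrite (_ : (fun _ => _) = (fun x : R => A * x * (A * x))); last first.
  by apply/funext => y; rewrite expr2.
by apply: cvgM; apply: cvgM; [exact: cvg_cst|exact: cvg_id|exact: cvg_cst|exact: cvg_id].
Qed.

Lemma uniform_lorentz (A : R) : 0 < A ->
  (\int[U]_x ((1 + (A * x) ^+ 2)^-1)%:E <= A^-1%:E)%E.
Proof.
move=> A0; have den x : 0 < 1 + (A * x) ^+ 2 by rewrite ltr_wpDr ?sqr_ge0.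
have cf : continuous (fun x : R => (1 + (A * x) ^+ 2)^-1).
  move=> x; apply: cvgV; first by rewrite gt_eqF.
  by apply: cvgD; [exact: cvg_cst|exact: cont_sqr].
have p0 : 0 < pi :> R by exact: pi_gt0.
apply: le_trans (@uniform_integral_le R (fun x => (1 + (A * x) ^+ 2)^-1)
  (fun x => A^-1 * atan (A * x)) (fun x => (1 + (A * x) ^+ 2)^-1) pi _ _ _ _ _ _ _) _ => //.
- by rewrite p0 lexx.
- exact: continuous_measurable_fun.
- by move=> x; rewrite invr_ge0 ltW.
- move=> x; apply: is_derive_eq; rewrite /GRing.scale/=.
  by rewrite mulr1 mulrCA mulVf ?mulr1// gt_eqF.
rewrite lee_fin mulrN atanN mulrN opprK -mulrDr -mulrA ler_piMr ?invr_ge0 ?(ltW A0)//.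
rewrite ler_pdivrMr ?mulr_gt0// mul1r.
have := atan_ltpi2 (A * pi); lra.
Qed.

(** The primitive [x * (q + c x^2) ^ (- s)], up to the factor [1 - 2 s], has a
    derivative that is at least [(q + c x^2) ^ (- s)]. *)
Lemma uniform_power (q c s r : R) : 0 < q -> 0 < c -> 0 < s < 1 / 2 -> 0 < r <= pi ->
  (\int[U]_x (if `|x| <= r then (q + c * x ^+ 2) `^ (- s) else 0)%:E <=
   ((1 - 2 * s)^-1 * (r * (c * r ^+ 2) `^ (- s)))%:E)%E.
Proof.
move=> q0 c0 /andP[s0 s2] /andP[r0 rpi].
have den x : 0 < q + c * x ^+ 2 by rewrite ltr_wpDr// mulr_ge0 ?sqr_ge0// ltW.
have k0 : 0 < 1 - 2 * s by lra.
pose u (x : R) := q + c * (x * x).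
have uE x : u x = q + c * x ^+ 2 by rewrite /u expr2.
have u0 x : 0 < u x by rewrite uE.
pose F (x : R) := (1 - 2 * s)^-1 * (x * expR (- s * ln (u x))).
pose F' (x : R) := (1 - 2 * s)^-1 * (expR (- s * ln (u x)) * (1 - 2 * s * (c * (x * x) / u x))).
have pE x : (q + c * x ^+ 2) `^ (- s) = expR (- s * ln (u x)) by rewrite -uE /powR gt_eqF.
have cu : continuous u.
  move=> x; apply: cvgD; first exact: cvg_cst.
  by apply: cvgM; [exact: cvg_cst|apply: cvgM; exact: cvg_id].
have ce : continuous (fun x => expR (- s * ln (u x))).
  move=> x; apply: continuous_comp; last exact: continuous_expR.
  apply: cvgM; first exact: cvg_cst.
  by apply: continuous_comp; [exact: cu|exact: continuous_ln].
have rpi0 := pi_gt0 R.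
apply: le_trans (@uniform_integral_le R (fun x => if `|x| <= r then (q + c * x ^+ 2) `^ (- s) else 0)
  F F' r _ _ _ _ _ _ _) _.
- by rewrite r0 rpi.
- have -> : (fun x : R => if `|x| <= r then (q + c * x ^+ 2) `^ (- s) else 0) =
    (fun x : mR => if `|x| <= r then expR (- s * ln (u x)) else 0).
    by apply/funext => x; rewrite pE.
  apply: measurable_fun_ifT => //; last exact: continuous_measurable_fun.
  apply: measurable_fun_ler => //.
- by move=> x; case: ifP => // _; exact: powR_ge0.
- by move=> x xr _; rewrite ifF//; apply/negP; rewrite ler_norml.
- move=> x xr; rewrite ler_norml xr pE /F' ler_pdivlMl// mulrC ler_wpM2l ?expR_ge0//.
  have h : c * (x * x) / u x <= 1.
    by rewrite ler_pdivrMr// mul1r lerDr ltW.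
  by have := ler_wpM2l (ltW s0) h; lra.
- move=> x; have dl := is_derive1_ln (u0 x).
  have du : is_derive x 1 u (2 * c * x).
    by rewrite /u; apply: is_derive_eq; rewrite /GRing.scale/= !(mulr0, mulr1, addr0, add0r); ring.
  have dlu : is_derive x 1 (fun y => ln (u y)) ((u x)^-1 * (2 * c * x)) := is_derive1_comp dl du.
  rewrite /F; apply: is_derive_eq.
  rewrite /F' /GRing.scale/=; field.
  by rewrite !gt_eqF.
- move=> x; apply: cvgM; first exact: cvg_cst.
  apply: cvgM; first exact: ce.
  apply: cvgB; first exact: cvg_cst.
  apply: cvgM; first exact: cvg_cst.
  apply: cvgM; first by apply: cvgM; [exact: cvg_cst|apply: cvgM; exact: cvg_id].
  by apply: cvgV; [rewrite gt_eqF|exact: cu].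
rewrite lee_fin /F.
have -> : u (- r) = u r by rewrite /u mulrNN.
rewrite -pE.
set X := _ `^ _; set Y := _ `^ _.
have XY : X <= Y.
  rewrite /X /Y !powRN lef_pV2 ?posrE ?powR_gt0 ?mulr_gt0 ?exprn_gt0//.
  by rewrite ge0_ler_powR ?nnegrE ?lerDr ?(ltW (den r)) ?(ltW s0) ?(ltW q0)// ltW// mulr_gt0// exprn_gt0.
have Y0 : 0 <= Y by exact: powR_ge0.
have X0 : 0 <= X by exact: powR_ge0.
rewrite (_ : (_ - _) / _ = (1 - 2 * s)^-1 * (r * X) / pi); last first.
  have -> : (1 - 2 * s)^-1 * (r * X) - (1 - 2 * s)^-1 * (- r * X) = 2 * ((1 - 2 * s)^-1 * (r * X)) by ring.
  by rewrite invfM mulrACA divff ?mul1r.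
rewrite ler_pdivrMr//; apply: (@le_trans _ _ ((1 - 2 * s)^-1 * (r * Y))).
  by rewrite ler_wpM2l ?invr_ge0 ?(ltW k0)// ler_wpM2l// ltW.
rewrite ler_peMr//; first by rewrite mulr_ge0 ?invr_ge0 ?(ltW k0)// mulr_ge0// ltW.
by have := pi_ge2 R; lra.
Qed.

Lemma sqnorm_ge d (k : 'rV[R]_d) i : k 0 i ^+ 2 <= sqnorm k.
Proof.
by rewrite /sqnorm (bigD1 i)//= lerDl; apply: sumr_ge0 => j _; exact: sqr_ge0.
Qed.

End LpBound.

(** * From pointwise bounds to bounds in L^p *)

Section LpBound.
Variable R : realType.
Local Notation mR := (measurableTypeR R).
Local Notation U := (uniform_prob (Npi_lt_pi R)).

Lemma powR_le_self (x p : R) : 0 <= x <= 1 -> 1 <= p -> x `^ p <= x.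
Proof.
move=> /andP[x0 x1] p1; have [->|xn] := eqVneq x 0; first by rewrite powR0// gt_eqF//; lra.
by apply: ge1r_powR => //; rewrite lt_def xn x0.
Qed.

(** Interpolation between [x ^ (2 - theta)] (at [q = theta], after removing
    [b ^ -2]) and a constant (at [q = 0]). *)
Lemma decay_interpolate (theta q x b : R) : 2 < theta -> 0 <= q <= theta -> 1 <= x ->
  0 < b -> 1 <= x * b ->
  x `^ (- (theta - 2)) * (x * b)^-1 ^+ 2 <= x `^ (- q) * b `^ (- (2 * q / theta)).
Proof.
move=> th2 /andP[q0 qth] x1 b0 xb1; have x0 : 0 < x by lra.
have th0 : 0 < theta by lra.
pose kp := 2 * q / theta; rewrite -/kp.
have kp2 : kp <= 2 by rewrite ler_pdivrMr//; lra.
have qt1 : q / theta <= 1 by rewrite ler_pdivrMr//; lra.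
have E : (theta - 2) * (q / theta) = q - kp by rewrite /kp; field; rewrite gt_eqF.
have h : q - kp <= theta - 2.
  by rewrite -E ler_piMr//; lra.
apply: (@le_trans _ _ (x `^ (- (theta - 2)) * (x * b) `^ (- kp))).
  rewrite ler_wpM2l ?powR_ge0// exprVn -powR_invn ?ler_powR ?lerN2//; lra.
rewrite powRM ?(ltW x0) ?(ltW b0)// mulrA ler_wpM2r ?powR_ge0//.
by rewrite -powRD ?(gt_eqF x0) ?implybT// ler_powR//; lra.
Qed.

(** The pointwise bound is integrated separately over the ball [`|k| <= 1 / L],
    where both of its terms are dominated by products of functions of one
    coordinate, and outside of it, where the factor [Dh ^ 2] provides the
    volume factor. All constants are uniform in [p]. *)
Lemma lp_bound d (theta C0 c1 eta C2 : R) (M : nat) :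
  (0 < d)%N -> 2 < theta -> 0 <= C0 -> 0 < c1 -> 0 < eta -> 0 <= C2 ->
  (d <= M)%N -> theta <= M%:R ->
  exists2 C : R, 0 < C & forall (L p : R) (n : nat) (a f Dh : 'rV[R]_d -> R) (G2 : d.-tuple mR -> R),
  1 <= L -> 1 <= p -> (1 <= n)%N ->
  (forall k, cube k -> [/\ 0 <= a k <= 2, `|Dh k| <= 1,
     `|k| <= L^-1 -> c1 * L ^+ 2 * sqnorm k <= a k & L^-1 <= `|k| -> eta <= a k]) ->
  (forall k, cube k -> `|f k| <= C0 * ((1 + a k * n%:R)^-1 ^+ M +
     n%:R `^ (- (theta - 2)) * (1 + a k * n%:R)^-1 ^+ 2)) ->
  measurable_fun setT G2 -> (forall t, 0 <= G2 t) ->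
  (forall k, cube k -> Dh k ^+ 2 <= G2 [tuple k ord0 i | i < d]) ->
  (\int[torus_measure R d]_t (G2 t)%:E <= (C2 * L `^ (- d%:R))%:E)%E ->
  (torus_norm p (fun k => (Dh k ^+ 2 * f k)%R) <=
   (C / (L `^ (d%:R / p) * n%:R `^ Num.min (d%:R / (2 * p)) theta))%:E)%E.
Proof.
move=> d0 th2 C00 c10 eta0 C20 dM thM.
pose c := Num.min c1 1.
have c0 : 0 < c by rewrite lt_min c10 ltr01.
have cle1 : c <= 1 by rewrite ge_min lexx orbT.
have clec1 : c <= c1 by rewrite ge_min lexx.
pose Ce := eta^-1 ^+ M + eta^-1 ^+ 2.
have Ce0 : 0 <= Ce by rewrite addr_ge0// exprn_ge0// invr_ge0 ltW.
pose Q := 2 * C0 * (1 + Ce).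
have QE : Q = 2 * C0 * (1 + Ce) by [].
have Q0 : 0 <= Q by rewrite !mulr_ge0// addr_ge0.
have QC : C0 <= Q / 2 by rewrite QE; have := mulr_ge0 C00 Ce0; lra.
have QC2 : C0 * Ce <= Q by rewrite QE; have := mulr_ge0 C00 Ce0; lra.
clearbody Q.
(* The exponent of a single coordinate in [psi]; the power is integrable as
   [s < 1 / 2]. *)
pose s := theta^-1.
have th0 : 0 < theta by lra.
have s0 : 0 < s by rewrite invr_gt0.
have sth : s * theta = 1 by rewrite mulVf// gt_eqF//; lra.
have s12 : s < 1 / 2.
  by rewrite -(ltr_pM2r (_ : 0 < theta)) ?sth; lra.
pose Cs := (1 - 2 * s)^-1 * (c / 2) `^ (- s).
have Cs0 : 0 < Cs by rewrite mulr_gt0 ?powR_gt0 ?invr_gt0; move: s12 c0; only_lra.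
pose A1 := (Num.sqrt c1)^-1.
have A10 : 0 < A1 by rewrite invr_gt0 sqrtr_gt0.
pose C1 := 1 + A1 ^+ d + Cs ^+ d + C2.
have C1E : C1 = 1 + A1 ^+ d + Cs ^+ d + C2 by [].
have C11 : 1 <= C1 by rewrite /C1 -!addrA lerDl !addr_ge0// exprn_ge0// ltW.
have C10 : 0 <= C1 by lra.
clearbody C1.
exists (1 + Q * C1); first by rewrite ltr_pwDl// mulr_ge0.
move=> L p n a f Dh G2 L1 p1 n1 Ha Hf mG2 G20 HG2 IG2.
have L0 : 0 < L := lt_le_trans ltr01 L1.
have p0 : 0 < p := lt_le_trans ltr01 p1.
have n0 : 0 < n%:R :> R by rewrite ltr0n.
have n1' : 1 <= n%:R :> R by rewrite ler1n.
have d0' : 0 < d%:R :> R by rewrite ltr0n.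
pose q := Num.min (d%:R / (2 * p)) theta.
have qd : q * p <= d%:R / 2.
  apply: (@le_trans _ _ (d%:R / (2 * p) * p)); first by rewrite ler_wpM2r ?(ltW p0)// ge_min lexx.
  by rewrite invfM mulrA mulfVK// gt_eqF.
have qth : q <= theta by rewrite ge_min lexx orbT.
have q0 : 0 < q by rewrite lt_min divr_gt0 ?mulr_gt0//; lra.
pose nq := n%:R `^ (- (q * p)).
have nq0 : 0 < nq by rewrite powR_gt0.
have nq0' := ltW nq0.
pose G1 (t : d.-tuple mR) := \prod_(i < d) (1 + ((Num.sqrt (c1 * n%:R) * L) * tnth t i) ^+ 2)^-1.
pose psi (x : R) := if `|x| <= L^-1 then ((2 * n%:R)^-1 + (c / 2 * L ^+ 2) * x ^+ 2) `^ (- s) else 0.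
pose G3 (t : d.-tuple mR) := \prod_(i < d) psi (tnth t i).
pose QQ := Q `^ p.
have QQ0 : 0 <= QQ by exact: powR_ge0.
pose A := Num.sqrt (c1 * n%:R) * L.
have A0 : 0 < A by rewrite mulr_gt0// sqrtr_gt0 mulr_gt0.
have mlor : measurable_fun setT ((fun x : R => (1 + (A * x) ^+ 2)^-1) : mR -> mR).
  apply: continuous_measurable_fun => x; apply: cvgV.
    by rewrite gt_eqF// ltr_wpDr ?sqr_ge0.
  by apply: cvgD; [exact: cvg_cst|exact: cont_sqr].
have cL0 : 0 < c / 2 * L ^+ 2 by apply: mulr_gt0; [exact: divr_gt0|exact: exprn_gt0].
have n20 : 0 < (2 * n%:R)^-1 :> R by rewrite invr_gt0 mulr_gt0.
have b0 x : 0 < (2 * n%:R)^-1 + (c / 2 * L ^+ 2) * x ^+ 2.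
  by apply: ltr_wpDr => //; apply: mulr_ge0; [exact: ltW|exact: sqr_ge0].
have mpsi : measurable_fun setT (psi : mR -> mR).
  apply: measurable_fun_ifT => //; first exact: measurable_fun_ler.
  apply: (@measurableT_comp _ _ _ _ _ _ (fun y : R => y `^ (- s))) => //.
  apply: measurable_funD => //; apply: measurable_funM => //; exact: measurable_funX.
have psi0 x : 0 <= psi x by rewrite /psi; case: ifP => // _; exact: powR_ge0.
have lor0 x : 0 <= (1 + (A * x) ^+ 2)^-1 by rewrite invr_ge0 addr_ge0// sqr_ge0.
have mG1 : measurable_fun setT G1 by exact: (measurable_prod_tnth mlor).
have mG3 : measurable_fun setT G3 by exact: (measurable_prod_tnth mpsi).
have G10 t : 0 <= G1 t by apply: prodr_ge0.
have G30 t : 0 <= G3 t by apply: prodr_ge0.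
have IG1 : (\int[torus_measure R d]_t (G1 t)%:E <= ((A^-1) ^+ d)%:E)%E.
  apply: (@torus_integral_prod R d (fun x => (1 + (A * x) ^+ 2)^-1) A^-1) => //.
    by rewrite invr_ge0 ltW.
  exact: uniform_lorentz.
have Li : 0 < L^-1 <= pi.
  rewrite invr_gt0 L0 /=; apply: (@le_trans _ _ 1); first by rewrite invf_le1.
  by apply: le_trans (pi_ge2 R); rewrite ler1n.
have IG3 : (\int[torus_measure R d]_t (G3 t)%:E <= ((L^-1 * Cs) ^+ d)%:E)%E.
  apply: (@torus_integral_prod R d psi (L^-1 * Cs)) => //.
    by apply: mulr_ge0; [rewrite invr_ge0|]; exact: ltW.
  apply: le_trans (@uniform_power R (2 * n%:R)^-1 (c / 2 * L ^+ 2) s L^-1 _ _ _ _) _ => //.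
    by rewrite s0 s12.
  have -> : c / 2 * L ^+ 2 * L^-1 ^+ 2 = c / 2.
    by rewrite -mulrA -exprMn mulfV ?(lt0r_neq0 L0)// expr1n mulr1.
  by rewrite lee_fin /Cs mulrCA.
pose c' := Q * C1 / (L `^ (d%:R / p) * n%:R `^ q).
have c'0 : 0 <= c'.
  by rewrite divr_ge0 ?mulr_ge0 ?powR_ge0.
have c'p : c' `^ p = QQ * C1 `^ p * L `^ (- d%:R) * nq.
  rewrite /c' powRM ?invr_ge0 ?mulr_ge0 ?powR_ge0//.
  rewrite powRM//.
  rewrite -powR_inv1 ?mulr_ge0 ?powR_ge0// -powRrM mulN1r powRM ?powR_ge0//.
  rewrite -!powRrM /nq mulrN mulrN divfK ?gt_eqF// -/QQ; ring.
apply: (@le_trans _ _ c'%:E); last first.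
  rewrite lee_fin /c' ler_wpM2r ?invr_ge0 ?mulr_ge0 ?powR_ge0//.
  by rewrite lerDr.
pose G t := QQ * (G1 t + nq * G3 t + nq * G2 t).
apply: (@torus_norm_le _ _ _ _ _ G) => //.
- apply: measurable_funM => //; apply: measurable_funD; first apply: measurable_funD => //.
    exact: measurable_funM.
  exact: measurable_funM.
- by move=> t; rewrite mulr_ge0// !addr_ge0// mulr_ge0.
- move=> k kc; have [/andP[a0 a2] Dh1 Hin Hout] := Ha k kc.
  have y0 : 0 < 1 + a k * n%:R by rewrite ltr_wpDr// mulr_ge0// ltW.
  set t := [tuple k ord0 i | i < d].
  have Dh2 : Dh k ^+ 2 <= 1 by rewrite -real_normK ?num_real// exprn_ile1.
  have Dh20 : 0 <= Dh k ^+ 2 by exact: sqr_ge0.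
  rewrite normrM (ger0_norm Dh20).
  have [kL|kL] := leP `|k| L^-1; last first.
    (* Here [a] is bounded below, so [f] decays like [n ^ (- theta)], and the
       volume factor comes from the integral of [G2]. *)
    have ae := Hout (ltW kL).
    have ean : eta * n%:R <= 1 + a k * n%:R.
      by apply: (@le_trans _ _ (a k * n%:R)); [rewrite ler_wpM2r// ltW|rewrite lerDr].
    have iean : (1 + a k * n%:R)^-1 <= eta^-1 * n%:R^-1.
      by rewrite -invfM lef_pV2 ?posrE ?mulr_gt0.
    have X1 : (1 + a k * n%:R)^-1 ^+ M <= eta^-1 ^+ M * n%:R `^ (- theta).
      apply: (@le_trans _ _ ((eta^-1 * n%:R^-1) ^+ M)).
        by rewrite lerXn2r// ?nnegrE ?mulr_ge0 ?invr_ge0// ltW.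
      rewrite exprMn ler_wpM2l ?exprn_ge0 ?invr_ge0 ?(ltW eta0)//.
      by rewrite exprVn powRN lef_pV2 ?posrE ?exprn_gt0 ?powR_gt0// -powR_mulrn// ler_powR.
    have X2 : n%:R `^ (- (theta - 2)) * (1 + a k * n%:R)^-1 ^+ 2 <= eta^-1 ^+ 2 * n%:R `^ (- theta).
      apply: (@le_trans _ _ (n%:R `^ (- (theta - 2)) * (eta^-1 * n%:R^-1) ^+ 2)).
        by rewrite ler_wpM2l ?powR_ge0// lerXn2r// ?nnegrE ?mulr_ge0 ?invr_ge0// ltW.
      rewrite exprMn mulrCA ler_wpM2l ?exprn_ge0 ?invr_ge0 ?(ltW eta0)//.
      rewrite exprVn -powR_invn// -powRD ?(gt_eqF n0) ?implybT//.
      by rewrite (_ : - (theta - 2) - 2%:R = - theta)//; ring.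
    have fb : `|f k| <= Q * n%:R `^ (- theta).
      apply: le_trans (Hf k kc) _.
      apply: (@le_trans _ _ (C0 * (Ce * n%:R `^ (- theta)))).
        by rewrite ler_wpM2l// /Ce mulrDl lerD.
      by rewrite mulrA ler_wpM2r ?powR_ge0// QC2.
    rewrite powRM//.
    have B1 : (Dh k ^+ 2) `^ p <= G2 t.
      apply: le_trans (HG2 k kc).
      by apply: powR_le_self => //; rewrite Dh20.
    have B2 : `|f k| `^ p <= QQ * nq.
      apply: (@le_trans _ _ ((Q * n%:R `^ (- theta)) `^ p)).
        by rewrite ge0_ler_powR ?nnegrE ?(ltW p0)// mulr_ge0// powR_ge0.
      rewrite powRM ?powR_ge0// -powRrM ler_wpM2l// ler_powR// mulNr lerN2.
      by rewrite ler_wpM2r// ltW.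
    apply: le_trans (ler_pM (powR_ge0 _ _) (powR_ge0 _ _) B1 B2) _.
    by rewrite mulrC -mulrA /G ler_wpM2l// lerDr addr_ge0// mulr_ge0.
  (* Here [a] dominates the square of every coordinate: the first term is below
     a product of Lorentzians and the second one below a product of powers of
     single coordinates. *)
  have ak := Hin kL.
  have ki i : c1 * L ^+ 2 * k 0 i ^+ 2 <= a k.
    by apply: le_trans ak; rewrite ler_wpM2l ?sqnorm_ge// mulr_ge0 ?exprn_ge0// ltW.
  have kiL i : `|k 0 i| <= L^-1.
    by have /rV_norm_leP := kL; apply; rewrite invr_ge0 ltW.
  pose X := (1 + a k * n%:R)^-1 ^+ M.
  pose Y := n%:R `^ (- (theta - 2)) * (1 + a k * n%:R)^-1 ^+ 2.
  have iy0 : 0 <= (1 + a k * n%:R)^-1 by rewrite invr_ge0 ltW.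
  have iy1 : (1 + a k * n%:R)^-1 <= 1 by rewrite invf_le1// lerDl mulr_ge0// ltW.
  have X0 : 0 <= X by rewrite exprn_ge0.
  have Y0 : 0 <= Y by rewrite mulr_ge0 ?powR_ge0 ?exprn_ge0.
  have Xp : X `^ p <= G1 t.
    have X1 : X <= 1 by rewrite exprn_ile1.
    apply: (@le_trans _ _ X).
      by apply: powR_le_self => //; rewrite X0.
    apply: (@le_trans _ _ ((1 + a k * n%:R)^-1 ^+ d)); first by rewrite ler_wiXn2l.
    rewrite /G1 -[d in leLHS]card_ord -prodr_const; apply: ler_prod => i _.
    have dA : 0 < 1 + (Num.sqrt (c1 * n%:R) * L * tnth t i) ^+ 2 by rewrite ltr_wpDr ?sqr_ge0.
    rewrite iy0 /= lef_pV2 ?posrE//.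
    rewrite tnth_mktuple lerD2l 2!exprMn sqr_sqrtr ?mulr_ge0 ?(ltW c10)//.
    rewrite (_ : c1 * n%:R * L ^+ 2 * k 0 i ^+ 2 = c1 * L ^+ 2 * k 0 i ^+ 2 * n%:R); last by ring.
    by rewrite ler_wpM2r.
  have Yp : Y `^ p <= nq * G3 t.
    pose kp := 2 * q / theta.
    have kp0 : 0 <= kp by apply: divr_ge0; [apply: mulr_ge0 => //; exact: ltW|exact: ltW].
    pose b := n%:R^-1 + a k.
    have bp : 0 < b by rewrite ltr_pwDl ?invr_gt0.
    have by_ : 1 + a k * n%:R = n%:R * b by rewrite mulrDr mulfV ?gt_eqF// mulrC.
    have Yle : Y <= n%:R `^ (- q) * b `^ (- kp).
      rewrite /Y by_; apply: decay_interpolate => //; first by rewrite (ltW q0).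
      by rewrite -by_ lerDl mulr_ge0.
    apply: (@le_trans _ _ ((n%:R `^ (- q) * b `^ (- kp)) `^ p)).
      by rewrite ge0_ler_powR ?nnegrE ?(ltW p0)// mulr_ge0// powR_ge0.
    rewrite powRM ?powR_ge0// -!powRrM (_ : - q * p = - (q * p)); last by ring.
    rewrite -/nq ler_wpM2l ?(ltW nq0)//.
    have -> : b `^ (- kp * p) = \prod_(i < d) b `^ (- (kp * p / d%:R)).
      rewrite prodr_const card_ord -powR_mulrn ?powR_ge0// -powRrM; congr (_ `^ _).
      by field; rewrite gt_eqF.
    apply: ler_prod => i _; rewrite powR_ge0 /= tnth_mktuple /psi kiL.
    set bi := _ + _; have bi0 : 0 < bi by exact: b0.
    have bib : bi <= b.
      rewrite /bi /b; apply: lerD.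
        by rewrite lef_pV2 ?posrE ?mulr_gt0// ler_peMl ?ler1n.
      apply: le_trans (ki i); rewrite ler_wpM2r ?sqr_ge0// ler_wpM2r ?exprn_ge0 ?(ltW L0)//.
      by apply: le_trans clec1; rewrite ler_pdivrMr// ler_peMr// ?ler1n// ltW.
    have bi1 : bi <= 1.
      have h1 : (2 * n%:R)^-1 <= 1 / 2 :> R.
        by rewrite div1r lef_pV2 ?posrE ?mulr_gt0// ler_peMr.
      have h2 : L ^+ 2 * k 0 i ^+ 2 <= 1.
        rewrite -exprMn -real_normK ?num_real// exprn_ile1// normrM (ger0_norm (ltW L0)).
        by rewrite -(mulfV (lt0r_neq0 L0)) ler_wpM2l ?(ltW L0).
      have h3 : 0 <= L ^+ 2 * k 0 i ^+ 2 by apply: mulr_ge0; [apply: exprn_ge0; exact: ltW|exact: sqr_ge0].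
      have h4 := ler_pM (ltW c0) h3 cle1 h2; rewrite mul1r in h4.
      have h5 : c / 2 * L ^+ 2 * k 0 i ^+ 2 <= 1 / 2.
        by rewrite (_ : _ * _ = c * (L ^+ 2 * k 0 i ^+ 2) / 2) ?ler_wpM2r//; ring.
      by move: (lerD h1 h5); rewrite -splitr.
    apply: (@le_trans _ _ (bi `^ (- (kp * p / d%:R)))).
      rewrite !powRN lef_pV2 ?posrE ?powR_gt0// ge0_ler_powR ?nnegrE ?(ltW bi0) ?(ltW bp)//.
      by apply: divr_ge0 => //; apply: mulr_ge0 => //; exact: ltW.
    rewrite !powRN lef_pV2 ?posrE ?powR_gt0// ger_powR ?bi0//.
    rewrite ler_pdivrMr// /kp (_ : 2 * q / theta * p = 2 * (q * p) * s); last by rewrite /s; ring.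
    by rewrite mulrC ler_wpM2l ?(ltW s0)// mulrC -ler_pdivlMr.
  apply: (@le_trans _ _ ((Q / 2 * (X + Y)) `^ p)).
    have XY0 : 0 <= X + Y by apply: addr_ge0.
    have Q20 : 0 <= Q / 2 by apply: divr_ge0.
    apply: ge0_ler_powR; rewrite ?nnegrE; [exact: ltW|exact: mulr_ge0|exact: mulr_ge0|].
    rewrite -[leRHS]mul1r; apply: ler_pM => //.
    apply: le_trans (Hf k kc) _; by rewrite -/X -/Y ler_wpM2r.
  apply: (@le_trans _ _ (QQ * (X `^ p + Y `^ p))); last first.
    by rewrite /G ler_wpM2l// -addrA; apply: lerD => //; apply: ler_wpDr => //; rewrite mulr_ge0.
  apply: (@le_trans _ _ ((Q * Num.max X Y) `^ p)).
    have XY0 : 0 <= X + Y by apply: addr_ge0.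
    have mX0 : 0 <= Num.max X Y by rewrite le_max X0.
    have Q20 : 0 <= Q / 2 by apply: divr_ge0.
    apply: ge0_ler_powR; rewrite ?nnegrE; [exact: ltW|exact: mulr_ge0|exact: mulr_ge0|].
    rewrite -mulrA ler_wpM2l// ler_pdivrMl//.
    have : X <= Num.max X Y by rewrite le_max lexx.
    have : Y <= Num.max X Y by rewrite le_max lexx orbT.
    by only_lra.
  rewrite powRM ?le_max ?X0// ler_wpM2l//.
  by case: (leP X Y) => _; rewrite ?lerDl ?lerDr powR_ge0.
have mE (g : d.-tuple mR -> R) : measurable_fun setT g -> measurable_fun setT (fun t => (g t)%:E).
  by move=> mg; apply/measurable_EFinP.
under eq_integral do rewrite /G EFinM.
rewrite ge0_integralZl_EFin//; last 2 first.
- by move=> t _; rewrite lee_fin !addr_ge0// mulr_ge0.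
- apply: mE; apply: measurable_funD; first apply: measurable_funD => //.
    exact: measurable_funM.
  exact: measurable_funM.
under eq_integral do rewrite EFinD EFinD !EFinM.
have nqE (g : d.-tuple mR -> R) : (forall t, 0 <= g t) -> measurable_fun setT g ->
    (\int[torus_measure R d]_t (nq%:E * (g t)%:E) = nq%:E * \int[torus_measure R d]_t (g t)%:E)%E.
  move=> g0 mg; rewrite ge0_integralZl_EFin//; first by move=> t _; rewrite lee_fin.
  - exact: mE.
have mul0 (g : d.-tuple mR -> R) : (forall t, 0 <= g t) -> forall t, (0 <= nq%:E * (g t)%:E)%E.
  by move=> g0 t; rewrite mule_ge0 ?lee_fin.
have mulm (g : d.-tuple mR -> R) : measurable_fun setT g -> measurable_fun setT (fun t => nq%:E * (g t)%:E)%E.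
  by move=> mg; apply: emeasurable_funM => //; exact: mE.
rewrite ge0_integralD//; last 4 first.
- by move=> t _; rewrite adde_ge0 ?mul0// lee_fin.
- by apply: emeasurable_funD; [exact: mE|exact: mulm].
- by move=> t _; exact: mul0.
- exact: mulm.
rewrite ge0_integralD//; last 4 first.
- by move=> t _; rewrite lee_fin.
- exact: mE.
- by move=> t _; exact: mul0.
- exact: mulm.
rewrite !nqE//.
have nq0E : (0 <= nq%:E)%E by rewrite lee_fin.
apply: (@le_trans _ _ (QQ%:E * ((A^-1 ^+ d)%:E + nq%:E * ((L^-1 * Cs) ^+ d)%:E + nq%:E * (C2 * L `^ (- d%:R))%:E))%E).
  apply: lee_wpmul2l; first by rewrite lee_fin.
  by apply: leeD; [apply: leeD => //|]; apply: lee_wpmul2l.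
rewrite lee_fin c'p -!mulrA ler_wpM2l//.
have LE : L `^ (- d%:R) = L^-1 ^+ d by rewrite powR_invn ?(ltW L0)// exprVn.
have Ld0 : 0 <= L^-1 ^+ d by rewrite exprn_ge0// invr_ge0 ltW.
have A1E : A^-1 ^+ d <= A1 ^+ d * (L^-1 ^+ d * nq).
  rewrite /A sqrtrM ?(ltW c10)// !invfM !exprMn -/A1.
  rewrite -mulrA ler_wpM2l ?exprn_ge0 ?(ltW A10)// mulrC ler_wpM2l//.
  rewrite exprVn /nq powRN lef_pV2 ?posrE ?powR_gt0 ?exprn_gt0 ?sqrtr_gt0//.
  rewrite -powR12_sqrt ?(ltW n0)// -powR_mulrn ?powR_ge0// -powRrM ler_powR//.
  by rewrite (mulrC _ d%:R).
have C1p : C1 <= C1 `^ p by rewrite le1r_powR.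
rewrite LE exprMn.
apply: (@le_trans _ _ (C1 * (L^-1 ^+ d * nq))); last first.
  by rewrite ler_wpM2r// mulr_ge0.
rewrite C1E; set l := L^-1 ^+ d in Ld0 A1E *.
have ln0 : 0 <= l * nq by rewrite mulr_ge0.
rewrite (_ : (_ + _ + _ + _) * _ = l * nq + A1 ^+ d * (l * nq) + nq * (l * Cs ^+ d) + nq * (C2 * l)); last by ring.
move: A1E ln0; only_lra.
Qed.

End LpBound.

(** * Sums over the lattice and the transform of the step distribution *)

Section LatticeSum.
Variables (R : realType) (d : nat).
Implicit Types (u v w : 'rV[int]_d -> R) (F : seq 'rV[int]_d).

Definition lsummable u : Prop :=
  (\esum_(x in [set: 'rV[int]_d]) (`|u x|)%:E < +oo)%E.

Lemma lsummable_le u v : lsummable v -> (forall x, `|u x| <= `|v x|) -> lsummable u.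
Proof. by move=> sv uv; apply: le_lt_trans sv; apply: le_esum => x _; rewrite lee_fin. Qed.

Lemma ler_sum_subset F G u : uniq F -> uniq G -> {subset F <= G} ->
  (forall x, 0 <= u x) -> \sum_(x <- F) u x <= \sum_(x <- G) u x.
Proof.
move=> uF uG FG u0; rewrite [leRHS](bigID (mem F)) /= -[leLHS]addr0.
apply: lerD; last by apply: sumr_ge0.
rewrite -[X in _ <= X]big_filter le_eqVlt; apply/orP; left; apply/eqP.
apply: perm_big; apply: uniq_perm => //; first exact: filter_uniq.
move=> x; rewrite mem_filter /=; case: (boolP (x \in F)) => // xF.
by rewrite (FG x xF).
Qed.

(** The sums over all sufficiently large finite sets approximate the sum;
    every fact about [lattice_sum] below follows from its finite analogue
    through this property. *)
Lemma lattice_sum_approx u (tau : R) : lsummable u -> 0 < tau ->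
  exists F0, forall F, uniq F -> {subset F0 <= F} ->
    `|lattice_sum u - \sum_(x <- F) u x| <= tau.
Proof.
have pos (p : 'rV[int]_d -> R) t : (forall x, 0 <= p x) -> lsummable p -> 0 < t ->
    exists F0, forall F, uniq F -> {subset F0 <= F} ->
    `|fine (\esum_(x in [set: 'rV[int]_d]) (p x)%:E) - \sum_(x <- F) p x| <= t.
  move=> p0 sp t0.
  have sp' : (\esum_(x in [set: 'rV[int]_d]) (p x)%:E)%E \is a fin_num.
    rewrite ge0_fin_numE; last by apply: esum_ge0 => x _; rewrite lee_fin.
    by apply: le_lt_trans sp; apply: le_esum => x _; rewrite lee_fin ler_norm.
  have [y [A [fA _] <-]] := ub_ereal_sup_adherent t0 sp'.
  rewrite -/(esum _ _) -[X in (X - _)%E]fineK// fsbig_finite//= sumEFin lte_fin => HA.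
  set A1 := finmap.enum_fset _ in HA; have uA : uniq A1 by exact: finmap.fset_uniq.
  exists A1 => F uF sF; rewrite ler_distl; apply/andP; split.
    rewrite lerBlDr.
    have : ((\sum_(x <- F) p x)%:E <= \esum_(x in [set: 'rV[int]_d]) (p x)%:E)%E.
      apply: esum_ge; exists [set` F]; first by split => //; exact: finite_seq.
      by rewrite -fsbig_seq//= sumEFin.
    by rewrite -[(\esum_(_ in _) _)%E]fineK// lee_fin => h; apply: le_trans h _; rewrite ?lerDl ltW.
  have := ler_sum_subset uA uF sF p0.
  by move: HA; lra.
move=> su t0; have t20 : 0 < tau / 2 by rewrite divr_gt0.
pose up x := Num.max (u x) 0; pose un x := Num.max (- u x) 0.
have Eu x : u x = up x - un x.
  by rewrite /up /un; case: (leP (u x) 0); case: (leP (- u x) 0); lra.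
have [||F1 H1] := pos up _ _ _ t20; first by move=> x; rewrite le_max lexx orbT.
  apply: lsummable_le su _ => x; rewrite /up; case: (leP (u x) 0) => // _; by rewrite normr0.
have [||F2 H2] := pos un _ _ _ t20; first by move=> x; rewrite le_max lexx orbT.
  apply: lsummable_le su _ => x; rewrite /un; case: (leP (- u x) 0) => // _; by rewrite ?normr0 ?normrN.
exists (F1 ++ F2) => F uF sF.
rewrite /lattice_sum.
rewrite (_ : (fun x => ((fun x => (u x)%:E)^\+)%E x) = fun x => (up x)%:E); last first.
  by apply/funext => x; rewrite funeposE /up EFin_max.
rewrite (_ : (fun x => ((fun x => (u x)%:E)^\-)%E x) = fun x => (un x)%:E); last first.
  by apply/funext => x; rewrite funenegE /un EFin_max.
rewrite (eq_bigr (fun x => up x - un x)); last by move=> x _; rewrite Eu.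
rewrite sumrB opprB addrACA.
have h1 := H1 F uF (fun x xF => sF x ltac:(by rewrite mem_cat xF)).
have h2 := H2 F uF (fun x xF => sF x ltac:(by rewrite mem_cat xF orbT)).
apply: le_trans (_ : tau / 2 + tau / 2 <= _); last by rewrite -splitr.
rewrite [X in `|X|](_ : _ = (fine (\esum_(x in [set: 'rV_d]) (up x)%:E) - \sum_(x <- F) up x) -
  (fine (\esum_(x in [set: 'rV_d]) (un x)%:E) - \sum_(x <- F) un x)); last by lra.
by apply: le_trans (ler_normB _ _) _; exact: lerD.
Qed.

(** The finite set can be chosen uniformly for all families that are
    dominated by one summable family. *)
Lemma lattice_sum_approx_dom v (tau : R) : lsummable v -> (forall x, 0 <= v x) -> 0 < tau ->
  exists F0, forall F u, uniq F -> {subset F0 <= F} -> (forall x, `|u x| <= v x) ->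
    `|lattice_sum u - \sum_(x <- F) u x| <= tau.
Proof.
move=> sv v0 t0; have t40 : 0 < tau / 4 by rewrite divr_gt0.
have [F0 H0] := lattice_sum_approx sv t40.
exists F0 => F u uF sF uv.
have t20 : 0 < tau / 2 by rewrite divr_gt0.
have su : lsummable u by apply: lsummable_le sv _ => x; rewrite (ger0_norm (v0 x)).
have [F1 H1] := lattice_sum_approx su t20.
pose G := undup (F ++ F1).
have uG : uniq G by exact: undup_uniq.
have FG : {subset F <= G} by move=> x xF; rewrite mem_undup mem_cat xF.
have h1 := H1 G uG ltac:(by move=> x xF; rewrite mem_undup mem_cat xF orbT).
have h2 := H0 F uF sF.
have h3 := H0 G uG (fun x xF => FG x (sF x xF)).
have h4 : \sum_(x <- F) (v x + u x) <= \sum_(x <- G) (v x + u x).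
  by apply: ler_sum_subset => // x; have := uv x; rewrite ler_norml => /andP[]; lra.
have h5 : \sum_(x <- F) (v x - u x) <= \sum_(x <- G) (v x - u x).
  by apply: ler_sum_subset => // x; have := uv x; rewrite ler_norml => /andP[]; lra.
move: h1 h2 h3 h4 h5; rewrite !big_split /= !sumrN.
move: (lattice_sum _) (lattice_sum _) (\sum_(i <- F) u i) (\sum_(i <- G) u i) (\sum_(i <- F) v i) (\sum_(i <- G) v i).
move=> a b c c' e e'; rewrite !ler_norml => /andP[? ?] /andP[? ?] /andP[? ?] ? ?; lra.
Qed.

Lemma norm_le_eps (x c : R) : (forall t, 0 < t -> `|x| <= c * t) -> x = 0.
Proof.
move=> H; apply/eqP; rewrite -normr_eq0 eq_le normr_ge0 andbT leNgt; apply/negP => x0.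
have c0 : 0 < c by have := H 1 ltr01; rewrite mulr1; exact: lt_le_trans.
have c20 : 0 < 2 * c by lra.
have := H (`|x| / (2 * c)) (divr_gt0 x0 c20).
by rewrite (_ : c * _ = `|x| / 2); [lra|field; rewrite gt_eqF].
Qed.

Lemma lattice_sumDZ c u v : lsummable u -> lsummable v ->
  lsummable (fun x => c * u x + v x) ->
  lattice_sum (fun x => c * u x + v x) = c * lattice_sum u + lattice_sum v.
Proof.
move=> su sv sw; apply/eqP; rewrite -subr_eq0; apply/eqP; apply: (@norm_le_eps _ (2 + `|c|)) => t t0.
have [F1 H1] := lattice_sum_approx su t0.
have [F2 H2] := lattice_sum_approx sv t0.
have [F3 H3] := lattice_sum_approx sw t0.
pose F := undup (F1 ++ F2 ++ F3).
have uF : uniq F by exact: undup_uniq.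
have := H1 F uF ltac:(by move=> x xF; rewrite mem_undup !mem_cat xF).
have := H2 F uF ltac:(by move=> x xF; rewrite mem_undup !mem_cat xF orbT).
have := H3 F uF ltac:(by move=> x xF; rewrite mem_undup !mem_cat xF !orbT).
rewrite big_split -big_distrr /=.
move: (lattice_sum _) (lattice_sum u) (lattice_sum v) (\sum_(i <- F) u i) (\sum_(i <- F) v i).
move=> a b b' s s' h3 h2 h1.
rewrite (_ : a - (c * b + b') = (a - (c * s + s')) - c * (b - s) - (b' - s')); last by ring.
apply: le_trans (ler_normB _ _) _; rewrite (_ : (2 + `|c|) * t = t + `|c| * t + t); last by ring.
apply: lerD => //; apply: le_trans (ler_normB _ _) _; apply: lerD => //.
by rewrite normrM ler_wpM2l.
Qed.

Lemma ler_lattice_sum u v : lsummable u -> lsummable v -> (forall x, u x <= v x) ->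
  lattice_sum u <= lattice_sum v.
Proof.
move=> su sv uv; apply/ler_addgt0Pr => t t0; have t20 : 0 < t / 2 by rewrite divr_gt0.
have [F1 H1] := lattice_sum_approx su t20.
have [F2 H2] := lattice_sum_approx sv t20.
pose F := undup (F1 ++ F2).
have uF : uniq F by exact: undup_uniq.
have := H1 F uF ltac:(by move=> x xF; rewrite mem_undup mem_cat xF).
have := H2 F uF ltac:(by move=> x xF; rewrite mem_undup mem_cat xF orbT).
have : \sum_(x <- F) u x <= \sum_(x <- F) v x by apply: ler_sum.
by rewrite !ler_norml => h /andP[h1 h2] /andP[h3 h4]; lra.
Qed.

Lemma lattice_sum0 : lattice_sum (fun _ : 'rV[int]_d => 0 : R) = 0.
Proof.
have s0 : lsummable (fun _ => 0) by rewrite /lsummable esum1// => x _; rewrite normr0.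
have := @lattice_sumDZ 1 (fun=> 0) (fun=> 0) s0 s0.
by rewrite mul1r addr0 => /(_ s0); lra.
Qed.

Lemma lsummableD u v : lsummable u -> lsummable v -> lsummable (fun x => u x + v x).
Proof.
move=> su sv; have := lte_add_pinfty su sv.
rewrite -esumD; try by move=> x _; rewrite lee_fin.
by apply: le_lt_trans; apply: le_esum => x _; rewrite -EFinD lee_fin ler_normD.
Qed.

Lemma lsummableZ c u : lsummable u -> lsummable (fun x => c * u x).
Proof.
move=> su; have [n cn] : exists n, `|c| <= n%:R :> R.
  by exists (Num.bound `|c|); apply: ltW; rewrite (le_lt_trans _ (archi_boundP _)).
apply: (@lsummable_le _ (fun x => n%:R * u x)); last first.
  by move=> x; rewrite !normrM ler_wpM2r// normr_nat.
elim: n {cn} => [|n IH].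
  by apply: lsummable_le su _ => x; rewrite mul0r normr0.
by have := lsummableD su IH; congr lsummable; apply/funext => x; rewrite -natr1; ring.
Qed.

Lemma lattice_sumZ c u : lsummable u -> lattice_sum (fun x => c * u x) = c * lattice_sum u.
Proof.
move=> su; have s0 : lsummable (fun _ => 0).
  by rewrite /lsummable esum1// => x _; rewrite normr0.
have := @lattice_sumDZ c u (fun=> 0) su s0.
rewrite lattice_sum0 addr0 (_ : (fun x => c * u x + 0) = fun x => c * u x).
  by apply; exact: lsummableZ.
by apply/funext => x; rewrite addr0.
Qed.

Lemma lattice_sumD u v : lsummable u -> lsummable v ->
  lattice_sum (fun x => u x + v x) = lattice_sum u + lattice_sum v.
Proof.
move=> su sv; have := @lattice_sumDZ 1 u v su sv; rewrite mul1r.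
rewrite (_ : (fun x => 1 * u x + v x) = fun x => u x + v x); last first.
  by apply/funext => x; rewrite mul1r.
by apply; exact: lsummableD.
Qed.

End LatticeSum.

Section Fourier.
Variables (R : realType) (d : nat) (D : 'rV[int]_d -> R).
Hypothesis D0 : forall x, 0 <= D x.
Hypothesis DF : Dhat D 0 = 1.

Definition phase (k : 'rV[R]_d) (x : 'rV[int]_d) : R := \sum_i k 0 i * (x 0 i)%:~R.

Lemma DhatE k : Dhat D k = lattice_sum (fun x => cos (phase k x) * D x).
Proof.
rewrite /Dhat /fourier /lattice_sumC /=; congr lattice_sum; apply/funext => x.
by rewrite mulr0 subr0.
Qed.

Lemma phase0 x : phase 0 x = 0.
Proof. by rewrite /phase big1// => i _; rewrite mxE mul0r. Qed.

Lemma phaseD k l x : phase (k + l) x = phase k x + phase l x.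
Proof. by rewrite /phase -big_split; apply: eq_bigr => i _; rewrite mxE mulrDl. Qed.

Lemma phaseZ c k x : phase (c *: k) x = c * phase k x.
Proof. by rewrite /phase mulr_sumr; apply: eq_bigr => i _; rewrite mxE mulrA. Qed.

Lemma mass1 : lattice_sum D = 1.
Proof.
rewrite -[RHS]DF DhatE; congr lattice_sum; apply/funext => x.
by rewrite phase0 cos0 mul1r.
Qed.

(** The sum of [D] cannot diverge: [fine] would then send it to 0. *)
Lemma lsummable_kernel : lsummable D.
Proof.
rewrite /lsummable; set s := (X in (X < _)%E); rewrite ltNge leye_eq; apply/negP => /eqP sE.
have : lattice_sum D = 0.
  rewrite /lattice_sum.
  have -> : (\esum_(x in [set: 'rV_d]) ((fun x => (D x)%:E)^\+)%E x = +oo)%E.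
    rewrite -sE /s; apply: eq_esum => x _; rewrite funeposE ger0_norm//.
    by apply/max_idPl; rewrite lee_fin.
  rewrite esum1 ?subr0// => x _; rewrite funenegE; apply/max_idPr.
  by rewrite -EFinN lee_fin oppr_le0.
by rewrite mass1; lra.
Qed.

Lemma lsummable_cos k : lsummable (fun x => cos (phase k x) * D x).
Proof.
apply: lsummable_le lsummable_kernel _ => x.
by rewrite normrM ler_piMl//; exact: cos_max.
Qed.

(** A measurable function above [Dhat ^ 2] whose integral is of the order of
    the sup norm of [D]: [Dhat] is uniformly close to a finite cosine sum, and
    the integral of the square of the latter is at most the l2 norm of [D]. *)
Lemma Dhat_sqr_majorant (W : R) : 0 < W -> (forall x, D x <= W) ->
  exists G2 : d.-tuple (measurableTypeR R) -> R,
  [/\ measurable_fun setT G2, forall t, 0 <= G2 t,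
      forall k, Dhat D k ^+ 2 <= G2 [tuple k ord0 i | i < d] &
      (\int[torus_measure R d]_t (G2 t)%:E <= (4 * W)%:E)%E].
Proof.
move=> W0 DW; pose t := Num.sqrt W.
have t0 : 0 < t by rewrite sqrtr_gt0.
have tW : t ^+ 2 = W by rewrite sqr_sqrtr// ltW.
have [F0 H0] := lattice_sum_approx_dom lsummable_kernel D0 t0.
pose F := undup F0.
have uF : uniq F by exact: undup_uniq.
have F0F : {subset F0 <= F} by move=> x xF; rewrite mem_undup.
have sF : \sum_(x <- F) D x <= 1.
  apply/ler_addgt0Pr => s s0; have [F3 H3] := lattice_sum_approx lsummable_kernel s0.
  pose G := undup (F ++ F3).
  have uG : uniq G by exact: undup_uniq.
  have := H3 G uG ltac:(by move=> x xF; rewrite mem_undup mem_cat xF orbT).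
  rewrite mass1 ler_distl => /andP[h _].
  have : \sum_(x <- F) D x <= \sum_(x <- G) D x.
    by apply: ler_sum_subset => // x xF; rewrite mem_undup mem_cat xF.
  by move: h; lra.
pose S (k : 'rV[R]_d) := \sum_(x <- F) D x * cos (phase k x).
pose S' (t : d.-tuple (measurableTypeR R)) :=
  \sum_(x <- F) D x * cos (\sum_i tnth t i * (x 0 i)%:~R).
exists (fun t => 2 * S' t ^+ 2 + 2 * W).
have mS : measurable_fun setT S'.
  apply: measurable_sum => x; apply: measurable_funM => //.
  apply: (@measurableT_comp _ _ _ _ _ _ (@cos R)) => //.
    by apply: continuous_measurable_fun; exact: continuous_cos.
  by apply: measurable_sum => i; apply: measurable_funM => //; exact: measurable_tnth.
have mS2 : measurable_fun setT (fun t => 2 * S' t ^+ 2).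
  by apply: measurable_funM => //; apply: measurable_funX.
split.
- exact: measurable_funD.
- by move=> u; rewrite addr_ge0// mulr_ge0// ?sqr_ge0// ltW.
- move=> k; have -> : S' [tuple k ord0 i | i < d] = S k.
    by apply: eq_bigr => x _; congr (_ * cos _); apply: eq_bigr => i _; rewrite tnth_mktuple.
  have : `|Dhat D k - S k| <= t.
    rewrite DhatE (_ : S k = \sum_(x <- F) cos (phase k x) * D x); last first.
      by apply: eq_bigr => x _; rewrite mulrC.
    apply: H0 => // x; rewrite normrM (ger0_norm (D0 x)) ler_piMl//; exact: cos_max.
  move=> h; have : (Dhat D k - S k) ^+ 2 <= W.
    by rewrite -tW -real_normK ?num_real// lerXn2r// nnegrE// ltW.
  have := sqr_ge0 (Dhat D k - S k - S k).
  move: (Dhat D k) (S k) => a b; nra.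
- under eq_integral do rewrite EFinD.
  rewrite ge0_integralD//; first last.
  + by move=> u _; rewrite lee_fin ltW// mulr_gt0.
  + exact/measurable_EFinP.
  + by move=> u _; rewrite lee_fin mulr_ge0// sqr_ge0.
  rewrite integral_prob_cst; under eq_integral do rewrite EFinM.
  rewrite ge0_integralZl_EFin//; first last.
  + by apply/measurable_EFinP; exact: measurable_funX.
  + by move=> u _; rewrite lee_fin sqr_ge0.
  apply: (@le_trans _ _ (2%:E * W%:E + (2 * W)%:E)%E); last first.
    by rewrite -EFinM -EFinD lee_fin; lra.
  apply: leeD => //; apply: lee_wpmul2l; first by rewrite lee_fin.
  have w0W x : 0 <= D x <= W by rewrite D0 DW.
  apply: le_trans (torus_bessel uF w0W) _.
  by rewrite lee_fin ler_piMr// ltW.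
Qed.

End Fourier.

Section CosineBounds.
Variable R : realType.

Lemma norm_sin_le (x : R) : `|sin x| <= `|x|.
Proof.
wlog x0 : x / 0 < x.
  move=> H; have [x0|x0|->] := ltgtP x 0; last by rewrite sin0.
    by rewrite -normrN -sinN -[leRHS]normrN; apply: H; rewrite oppr_gt0.
  exact: H.
have [|c _] := @MVT R sin cos 0 x x0 (fun y _ => is_derive_sin y).
  by apply: continuous_subspaceT => y; exact: continuous_sin.
rewrite sin0 !subr0 => ->; rewrite normrM ler_piMl//; exact: cos_max.
Qed.

Lemma one_sub_cos (y : R) : 1 - cos y = 2 * sin (y / 2) ^+ 2.
Proof.
have {1}-> : y = y / 2 *+ 2 by rewrite -mulr_natr divfK.
by rewrite cos_mulr2n; have := cos2Dsin2 (y / 2); lra.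
Qed.

Lemma one_sub_cos_bounds (y : R) : 0 <= 1 - cos y <= y ^+ 2 / 2.
Proof.
rewrite one_sub_cos mulr_ge0 ?sqr_ge0//=.
have : sin (y / 2) ^+ 2 <= (y / 2) ^+ 2.
  rewrite -real_normK ?num_real// -[leRHS]real_normK ?num_real//.
  by rewrite lerXn2r// norm_sin_le.
by rewrite expr_div_n; lra.
Qed.

Lemma cos_sub_quad (y : R) : `|1 - cos y - y ^+ 2 / 2| <= `|y| ^+ 4.
Proof.
wlog y0 : y / 0 < y.
  move=> H; have [x0|x0|->] := ltgtP y 0; last by rewrite cos0 !expr0n/= subrr mul0r subrr normr0.
    by rewrite -[y]opprK cosN sqrrN normrN; apply: H; rewrite oppr_gt0.
  exact: H.
pose x := y / 2; have x0 : 0 < x by rewrite divr_gt0.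
have [|c] := @MVT R (fun z => z - sin z) (fun z => 1 - cos z) 0 x x0 (fun z _ => is_deriveB _ _).
  apply: continuous_subspaceT => z; apply: cvgB; [exact: cvg_id|exact: continuous_sin].
rewrite in_itv /= => /andP[c0 cx]; rewrite sin0 !subr0 => E.
have /andP[h1 h2] := one_sub_cos_bounds c.
have h3 : 0 <= x - sin x by rewrite E mulr_ge0// ltW.
have h4 : x - sin x <= x ^+ 2 / 2 * x.
  rewrite E ler_wpM2r ?(ltW x0)//; apply: le_trans h2 _.
  by rewrite ler_pM2r// lerXn2r// ?nnegrE ltW.
have h5 : x + sin x <= 2 * x by lra.
have h6 : 0 <= x + sin x by have := norm_sin_le x; rewrite (gtr0_norm x0) ler_norml => /andP[]; lra.
rewrite one_sub_cos -/x -normrN (gtr0_norm y0) (_ : y = 2 * x); last by rewrite mulrC divfK.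
rewrite [X in `|X|](_ : _ = 2 * ((x - sin x) * (x + sin x))); last by field.
rewrite ger0_norm; last by rewrite !mulr_ge0.
have := ler_pM h3 h6 h4 h5; have := exprn_ge0 4 (ltW x0); clearbody x.
rewrite (_ : x ^+ 2 / 2 * x * (2 * x) = x ^+ 4); last by field.
by rewrite (_ : (2 * x) ^+ 4 = 16 * x ^+ 4); [lra|ring].
Qed.

End CosineBounds.

Section Dispersion.
Variables (R : realType) (d : nat) (D : 'rV[int]_d -> R).
Hypothesis D0 : forall x, 0 <= D x.
Hypothesis DF : Dhat D 0 = 1.
Variable eps : R.
Hypothesis eps0 : 0 < eps.
Hypothesis Dmom : (\esum_(x in [set: 'rV[int]_d])
            (znorm R x `^ (2 + 2 * eps) * D x)%:E < +oo)%E.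

(** The limit of [akD D (t *: k) / t ^ 2] as [t] tends to 0. *)
Definition quad (k : 'rV[R]_d) : R := lattice_sum (fun x => phase k x ^+ 2 * D x) / 2.

Lemma norm_phase_le k (x : 'rV[int]_d) :
  `|phase k x| <= d%:R * Num.sqrt (sqnorm k) * znorm R x.
Proof.
rewrite /phase; apply: le_trans (ler_norm_sum _ _ _) _.
rewrite -mulrA (_ : d%:R * _ = \sum_(i < d) (Num.sqrt (sqnorm k) * znorm R x)); last first.
  by rewrite sumr_const card_ord mulr_natl.
apply: ler_sum => i _.
rewrite normrM; apply: ler_pM => //; rewrite -sqrtr_sqr ler_sqrt.
- exact: sqnorm_ge.
- by apply: sumr_ge0 => j _; exact: sqr_ge0.
- by rewrite (bigD1 i)//= lerDl; apply: sumr_ge0 => j _; exact: sqr_ge0.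
- by apply: sumr_ge0 => j _; exact: sqr_ge0.
Qed.

Lemma znorm_eq0_or_ge1 (x : 'rV[int]_d) : znorm R x = 0 \/ 1 <= znorm R x.
Proof.
have [z|/existsP[i xi]] := altP (@forallP _ (fun i => x 0 i == 0)); first left.
  by rewrite /znorm big1 ?sqrtr0// => i _; rewrite (eqP (z i)) expr0n.
right; rewrite -[1]sqrtr1 ler_sqrt; last by apply: sumr_ge0 => j _; exact: sqr_ge0.
apply: le_trans (_ : (x 0 i)%:~R ^+ 2 <= _); last first.
  by rewrite (bigD1 i)//= lerDl; apply: sumr_ge0 => j _; exact: sqr_ge0.
by rewrite -real_normK ?num_real// exprn_ege1// -intr_norm ler1z -gtz0_ge1 normr_gt0.
Qed.

Lemma znorm_powR_le (x : 'rV[int]_d) (r s : R) : 0 < r <= s -> znorm R x `^ r <= znorm R x `^ s.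
Proof.
move=> /andP[r0 rs]; have [->|x1] := znorm_eq0_or_ge1 x; last exact: ler_powR.
by rewrite !powR0// gt_eqF//; exact: lt_le_trans rs.
Qed.

Lemma lsummable_moment (r : R) : 0 < r <= 2 + 2 * eps -> lsummable (fun x => znorm R x `^ r * D x).
Proof.
move=> rs; apply: le_lt_trans Dmom; apply: le_esum => x _; rewrite lee_fin ger0_norm.
  by rewrite ler_wpM2r// znorm_powR_le.
by rewrite mulr_ge0// powR_ge0.
Qed.

Lemma lsummable_quad k : lsummable (fun x => phase k x ^+ 2 * D x).
Proof.
have h : 0 < (2%:R : R) <= 2 + 2 * eps by rewrite ltr0n/=; move: eps0; lra.
apply: lsummable_le (lsummableZ (d%:R ^+ 2 * sqnorm k) (lsummable_moment h)) _ => x.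
rewrite [leRHS]ger0_norm ?mulr_ge0 ?powR_ge0 ?sqr_ge0//; last first.
  by apply: sumr_ge0 => j _; exact: sqr_ge0.
have h4 := mulr_ge0 (sqr_ge0 (phase k x)) (D0 x).
rewrite (ger0_norm h4) mulrA ler_wpM2r//.
have := norm_phase_le k x => /(lerXn2r 2) -/(_ (normr_ge0 _)); rewrite nnegrE.
rewrite !mulr_ge0 ?sqrtr_ge0// => /(_ isT); rewrite real_normK ?num_real// !exprMn sqr_sqrtr.
  by rewrite powR_mulrn ?sqrtr_ge0.
by apply: sumr_ge0 => j _; exact: sqr_ge0.
Qed.

Lemma lsummable_one_sub_cos k : lsummable (fun x => (1 - cos (phase k x)) * D x).
Proof.
apply: lsummable_le (lsummable_quad k) _ => x.
have /andP[h1 h2] := one_sub_cos_bounds (phase k x).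
have h3 := mulr_ge0 h1 (D0 x); have h4 := mulr_ge0 (sqr_ge0 (phase k x)) (D0 x).
rewrite (ger0_norm h3) (ger0_norm h4) ler_wpM2r//; apply: le_trans h2 _.
by rewrite ler_pdivrMr// ler_peMr ?sqr_ge0// ler1n.
Qed.

Lemma akDE k : akD D k = lattice_sum (fun x => (1 - cos (phase k x)) * D x).
Proof.
rewrite /akD -{1}DF !DhatE -[RHS]mul1r.
have h := lattice_sumD (lsummable_one_sub_cos k) (lsummable_cos D0 DF k).
rewrite (_ : (fun x => cos (phase 0 x) * D x) = fun x => (1 - cos (phase k x)) * D x + cos (phase k x) * D x).
  by rewrite h; ring.
by apply/funext => x; rewrite phase0 cos0; ring.
Qed.

(** Only moments of order [2 + 2 e1] are at hand, so the quartic remainder of the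
    cosine is traded for that power where its argument is at most 1, and the
    quadratic terms where it is larger. *)
Lemma akD_quad (e1 : R) : 0 < e1 <= 1 -> e1 <= eps ->
  exists2 C : R, 0 <= C & forall k, `|akD D k - quad k| <= C * sqnorm k `^ (1 + e1).
Proof.
move=> /andP[e10 e11] e1e.
have h : 0 < 2 + 2 * e1 <= 2 + 2 * eps by lra.
pose m := lattice_sum (fun x => znorm R x `^ (2 + 2 * e1) * D x).
have m0 : 0 <= m.
  rewrite -(@lattice_sum0 R d); apply: ler_lattice_sum.
  - by rewrite /lsummable esum1// => x _; rewrite normr0.
  - exact: lsummable_moment.
  - by move=> x; rewrite mulr_ge0// powR_ge0.
have pw (y : R) : 0 <= y -> (y ^+ 2) `^ (1 + e1) = y `^ (2 + 2 * e1).
  by move=> y0; rewrite -powR_mulrn// -powRrM mulrDr mulr1.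
have key (y : R) : `|1 - cos y - y ^+ 2 / 2| <= `|y| `^ (2 + 2 * e1).
  have [y1|y1] := leP `|y| 1.
    apply: le_trans (cos_sub_quad y) _; rewrite -powR_mulrn//.
    have [->|y0] := eqVneq y 0; first by rewrite normr0 !powR0// gt_eqF//; lra.
    by rewrite ger_powR ?normr_gt0 ?y0//; lra.
  have /andP[h1 h2] := one_sub_cos_bounds y.
  have h3 : `|y| ^+ 2 <= `|y| `^ (2 + 2 * e1).
    by rewrite -powR_mulrn// ler_powR ?(ltW y1)//; lra.
  have h4 := sqr_ge0 y; rewrite real_normK ?num_real// in h3.
  by rewrite ler_norml; apply/andP; split; lra.
exists (d%:R `^ (2 + 2 * e1) * m); first by rewrite mulr_ge0// powR_ge0.
move=> k; pose c := (d%:R * Num.sqrt (sqnorm k)) `^ (2 + 2 * e1).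
have cE : c = d%:R `^ (2 + 2 * e1) * sqnorm k `^ (1 + e1).
  by rewrite /c powRM ?sqrtr_ge0// -[in RHS](@sqr_sqrtr _ (sqnorm k)) ?pw ?sqrtr_ge0//; apply: sumr_ge0 => j _; exact: sqr_ge0.
rewrite mulrAC -cE akDE /quad.
pose u x := (1 - cos (phase k x)) * D x + (- 2^-1) * (phase k x ^+ 2 * D x).
have su : lsummable u.
  by apply: lsummableD; [exact: lsummable_one_sub_cos|apply: lsummableZ; exact: lsummable_quad].
have <- : lattice_sum u = lattice_sum (fun x => (1 - cos (phase k x)) * D x) - lattice_sum (fun x => phase k x ^+ 2 * D x) / 2.
  rewrite lattice_sumD ?lattice_sumZ; [by rewrite mulNr mulrC|exact: lsummable_quad|exact: lsummable_one_sub_cos|].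
  by apply: lsummableZ; exact: lsummable_quad.
have sv : lsummable (fun x => c * (znorm R x `^ (2 + 2 * e1) * D x)).
  by apply: lsummableZ; exact: lsummable_moment.
have uv x : `|u x| <= c * (znorm R x `^ (2 + 2 * e1) * D x).
  rewrite (_ : u x = (1 - cos (phase k x) - phase k x ^+ 2 / 2) * D x); last by rewrite /u; ring.
  rewrite normrM (ger0_norm (D0 x)) mulrA ler_wpM2r//; apply: le_trans (key _) _.
  rewrite -powRM ?mulr_ge0 ?sqrtr_ge0//; apply: ge0_ler_powR; rewrite ?nnegrE ?mulr_ge0 ?sqrtr_ge0//; first by lra.
  exact: norm_phase_le.
rewrite -lattice_sumZ -?/m; last exact: lsummable_moment.
rewrite ler_norml; apply/andP; split.
  rewrite -mulN1r -lattice_sumZ//; apply: ler_lattice_sum => //; first exact: lsummableZ.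
  by move=> x; have := uv x; rewrite ler_norml mulN1r => /andP[].
by apply: ler_lattice_sum => // x; have := uv x; rewrite ler_norml => /andP[].
Qed.

Lemma quadZ c k : quad (c *: k) = c ^+ 2 * quad k.
Proof.
rewrite /quad mulrA -lattice_sumZ; last exact: lsummable_quad.
by congr (lattice_sum _ / 2); apply/funext => x; rewrite phaseZ exprMn mulrA.
Qed.

Lemma quad_parallelogram k l : quad (k + l) + quad (k - l) = 2 * quad k + 2 * quad l.
Proof.
have s k' : lsummable (fun x => phase k' x ^+ 2 * D x) by exact: lsummable_quad.
rewrite /quad -mulrDl -(lattice_sumD (s _) (s _)) !mulrA -(lattice_sumZ 2 (s k)) -(lattice_sumZ 2 (s l)).
rewrite -mulrDl -(lattice_sumD (lsummableZ 2 (s k)) (lsummableZ 2 (s l))).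
congr (lattice_sum _ / 2); apply/funext => x.
by rewrite -scaleN1r !phaseD phaseZ; ring.
Qed.

Lemma quad_cvg k : akD D (t *: k) / t ^+ 2 @[t --> 0^'+] --> quad k.
Proof.
pose e1 := Num.min 1 eps.
have e10 : 0 < e1 <= 1 by rewrite lt_min ltr01 eps0 ge_min lexx.
have e1e : e1 <= eps by rewrite ge_min lexx orbT.
have e1p : 0 < e1 by case/andP: e10.
have [C C0 HC] := akD_quad e10 e1e.
have h0 : C * sqnorm k `^ (1 + e1) * t `^ (2 * e1) @[t --> 0^'+] --> (0 : R).
  rewrite -[X in _ --> X](mulr0 (C * sqnorm k `^ (1 + e1))).
  apply: cvgM; first exact: cvg_cst.
  by apply: powR_cvg0; rewrite mulr_gt0.
apply/subr_cvg0; apply: (@squeeze_cvgr _ _ _ _ (fun t => - (C * sqnorm k `^ (1 + e1) * t `^ (2 * e1)))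
   (fun t => C * sqnorm k `^ (1 + e1) * t `^ (2 * e1))); last 2 first.
- by rewrite -[X in _ --> X]oppr0; exact: (cvgN h0).
- exact: h0.
near=> t.
have t0 : 0 < t by near: t; exact: nbhs_right_gt.
rewrite -ler_norml.
have -> : akD D (t *: k) / t ^+ 2 - quad k = (akD D (t *: k) - quad (t *: k)) / t ^+ 2.
  by rewrite quadZ; field; rewrite gt_eqF.
rewrite normrM normfV (ger0_norm (sqr_ge0 t)) ler_pdivrMr ?exprn_gt0//.
apply: le_trans (HC _) _; rewrite -!mulrA ler_wpM2l//.
rewrite (_ : sqnorm (t *: k) = t ^+ 2 * sqnorm k); last first.
  by rewrite /sqnorm mulr_sumr; apply: eq_bigr => i _; rewrite mxE exprMn.
rewrite powRM ?sqr_ge0//; last by apply: sumr_ge0 => j _; exact: sqr_ge0.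
rewrite mulrC ler_wpM2l ?powR_ge0// -powR_mulrn ?(ltW t0)// -powRrM -powRD ?(gt_eqF t0) ?implybT//.
by rewrite (_ : 2%:R * (1 + e1) = 2 * e1 + 2%:R)//; ring.
Unshelve. all: by end_near.
Qed.

Hypothesis Dsym : cube_symmetric (akD D).

Lemma near0_cube (k : 'rV[R]_d) : \forall t \near (0 : R)^'+, cube (t *: k).
Proof.
near=> t; have t0 : 0 < t by near: t; exact: nbhs_right_gt.
rewrite /cube /= normrZ gtr0_norm//.
apply: (@le_trans _ _ (pi / (1 + `|k|) * (1 + `|k|))); last by rewrite divfK// gt_eqF// ltr_pwDl.
have t0' := ltW t0; apply: ler_pM => //; last by rewrite lerDr.
near: t; apply: nbhs_right_le; by rewrite divr_gt0 ?pi_gt0// ltr_pwDl.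
Unshelve. all: by end_near.
Qed.

Lemma quad_symmetric k l :
  (forall t, cube (t *: k) -> akD D (t *: l) = akD D (t *: k)) -> quad l = quad k.
Proof.
move=> H; have := @quad_cvg l.
move=> hl; apply: (cvg_unique _ hl) => //; apply: cvg_trans (@quad_cvg k).
apply: near_eq_cvg; near=> t; rewrite H//; near: t; exact: near0_cube.
Unshelve. all: by end_near.
Qed.

(** Reflections make the quadratic form diagonal and permutations make its
    diagonal coefficients equal. *)
Lemma quad_isotropic (i0 : 'I_d) k : quad k = quad 'e_i0 * sqnorm k.
Proof.
have qf i l : quad (flip i l) = quad l.
  apply: quad_symmetric => t tc; have [H _] := Dsym tc.
  rewrite -(H i); congr akD; apply/rowP => j; rewrite !mxE; case: ifP => // _; by rewrite mulrN.
have qe i : quad 'e_i = quad 'e_i0.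
  apply: quad_symmetric => t tc; have [_ H] := Dsym tc.
  rewrite -(H (tperm i i0)); congr akD; apply/rowP => j; rewrite !mxE /=; congr (_ * _).
  by rewrite -(inj_eq (@perm_inj _ (tperm i i0))) tpermL.
have step i (l : 'rV[R]_d) : l 0 i = 0 -> forall c, quad (l + c *: 'e_i) = quad l + c ^+ 2 * quad 'e_i.
  move=> li c; have := quad_parallelogram l (c *: 'e_i).
  have -> : l - c *: 'e_i = flip i (l + c *: 'e_i).
    by apply/rowP => j; rewrite !mxE eqxx /=; case: eqP => [->|_]; rewrite ?li ?mulr0 ?mulr1; ring.
  by rewrite qf quadZ; lra.
have E (s : seq 'I_d) : uniq s ->
    quad (\sum_(i <- s) k 0 i *: 'e_i) = \sum_(i <- s) k 0 i ^+ 2 * quad 'e_i.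
  elim: s => [|i s IH] /=.
    by rewrite !big_nil -(scale0r (0 : 'rV[R]_d)) quadZ expr0n mul0r.
  move=> /andP[is_ us]; rewrite !big_cons -(IH us).
  set v := \sum_(j <- s) k 0 j *: _.
  have vi : v 0 i = 0.
    rewrite /v summxE big1_seq// => j /andP[_ js]; rewrite !mxE eqxx /=.
    by case: eqP => [ji|_]; [by rewrite ji js in is_|rewrite mulr0].
  by rewrite (addrC _ v) (step _ _ vi) addrC.
have -> : quad k = quad (\sum_(i <- enum 'I_d) k 0 i *: 'e_i).
  by rewrite big_enum /= -row_sum_delta.
rewrite E ?enum_uniq// big_enum /= mulrC mulr_suml.
by apply: eq_bigr => i _; rewrite qe.
Qed.

End Dispersion.

(** * The Laplacian at the origin of an even function *)

Section Laplacian.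
Variables (R : realType) (d : nat).
Implicit Types (u v g : 'rV[R]_d -> R).

Lemma near0_line (P : set 'rV[R]_d) (v : 'rV[R]_d) :
  (\forall k \near (0 : 'rV[R]_d), P k) -> \forall t \near (0 : R), P (t *: v).
Proof.
move=> HP; have : (fun t : R => t *: v) t @[t --> (0 : R)] --> (0 : 'rV[R]_d).
  by rewrite -[X in _ --> X](scale0r v); apply: cvgZr_tmp; exact: cvg_id.
by move/(_ _ HP).
Qed.

Lemma is_derive_line u (v : 'rV[R]_d) (t : R) : derivable u (t *: v) v ->
  is_derive t 1 (fun s => u (s *: v)) ('D_v u (t *: v)).
Proof.
move=> du.
have E : (fun h : R => h^-1 *: (((fun s => u (s *: v)) \o shift t) (h *: (1 : R)) - u (t *: v))) =
         (fun h : R => h^-1 *: ((u \o shift (t *: v)) (h *: v) - u (t *: v))).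
  by apply/funext => h /=; rewrite scalerDl [h *: 1]mulr1.
by apply: DeriveDef; rewrite /derivable /derive E.
Qed.

(** An even function of one variable has the Taylor expansion of order 2 at 0
    without a linear term. *)
Lemma even_second_difference (phi : R -> R) (dphi : R -> R) (c : R) :
  (\forall t \near (0 : R), is_derive (t : R) 1 phi (dphi t)) ->
  (\forall t \near (0 : R), phi (- t : R) = phi t) ->
  is_derive (0 : R) 1 dphi c ->
  2 * (phi t - phi 0) / t ^+ 2 @[t --> 0^'+] --> c.
Proof.
move=> Hd Hev Hc.
have d0 : dphi 0 = 0.
  have h0 : is_derive (0 : R) 1 phi (dphi 0) by exact: (nbhs_singleton Hd).
  have h1 : is_derive (0 : R) 1 (phi \o -%R) (dphi 0 * (- 1)).
    by apply: is_derive1_comp; rewrite oppr0.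
  have h2 : is_derive (0 : R) 1 phi (dphi 0 * (- 1)).
    by apply: near_eq_is_derive h1; near=> t; rewrite /=; near: t.
  case: h0 => _ e0; case: h2 => _ e2; move: e2; rewrite e0; lra.
have lim0 : h^-1 * dphi h @[h --> 0^'] --> c.
  case: Hc => dc c_.
  have E : (fun h : R => h^-1 *: ((dphi \o shift 0) (h *: (1 : R)) - dphi 0)) = fun h => h^-1 * dphi h.
    by apply/funext => h /=; rewrite [h *: 1]mulr1 addr0 d0 subr0.
  by move: dc c_; rewrite /derivable /derive E => dc <-.
have [r Hr] := nbhs_ex Hd.
have dp t : t \in `](0 : R), r%:num[ -> is_derive t 1 (fun s => 2 * (phi s - phi 0)) (2 * dphi t).
  rewrite in_itv /= => /andP[t0 tr].
  have : is_derive t 1 phi (dphi t) by apply: Hr; rewrite /ball /= sub0r normrN gtr0_norm.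
  by move=> h; apply: is_derive_eq; rewrite /GRing.scale /= subr0.
have dt t : t \in `](0 : R), r%:num[ -> is_derive t 1 (fun s : R => s ^+ 2) (2 * t).
  by move=> _; apply: is_derive_eq; rewrite /GRing.scale /=; ring.
apply: (lhopital_at_right _ dp dt) => //.
- have h0 : is_derive (0 : R) 1 phi (dphi 0) by exact: (nbhs_singleton Hd).
  have : {for 0, continuous phi}.
    by apply: differentiable_continuous; apply/derivable1_diffP; exact: ex_derive.
  move=> ch; have h : 2 * (phi t - phi 0) @[t --> (0 : R)] --> 2 * (phi 0 - phi 0).
    by apply: cvgM; [exact: cvg_cst|apply: cvgB; [exact: ch|exact: cvg_cst]].
  by rewrite subrr mulr0 in h; exact: cvg_at_right_filter.
- have h : x ^+ 2 @[x --> (0 : R)] --> (0 : R) ^+ 2 by exact: exprn_continuous.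
  by rewrite expr0n in h; exact: cvg_at_right_filter.
- by move=> t; rewrite in_itv /= => /andP[t0 _]; rewrite mulf_neq0// gt_eqF.
- apply: cvg_trans (cvg_dnbhs_at_right lim0); apply: near_eq_cvg; near=> t.
  have t0 : 0 < t by near: t; exact: nbhs_right_gt.
  by field; rewrite gt_eqF.
Unshelve. all: by end_near.
Qed.

(** For a function that is even in each coordinate these are the second
    difference quotients along the axes, and they converge to the Laplacian.
    Working with limits of quotients replaces the differentiation of functions
    that are regular only near 0. *)
Definition lap_quot u (t : R) : R := \sum_i 2 * (u (t *: 'e_i) - u 0) / t ^+ 2.

Lemma cube0 : cube (0 : 'rV[R]_d).
Proof. by rewrite /cube /= normr0 pi_ge0. Qed.

Lemma near0_in_cube : \forall k \near (0 : 'rV[R]_d), cube k.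
Proof.
have := @nbhsx_ballx _ _ (0 : 'rV[R]_d) pi (pi_gt0 R).
by apply: filterS => k; rewrite -ball_normE /ball_ /= sub0r normrN /cube /= => /ltW.
Qed.

Lemma near0_axes (P : set 'rV[R]_d) : (\forall k \near (0 : 'rV[R]_d), P k) ->
  \forall t \near 0^'+, forall i : 'I_d, P (t *: 'e_i).
Proof.
move=> HP; apply: cvg_within.
have : forall i : 'I_d, \forall t \near (0 : R), P (t *: 'e_i) by move=> i; exact: near0_line.
exact: (@filter_forall R 'I_d (fun i t => P (t *: 'e_i)) (nbhs 0)).
Qed.

Lemma cvg_fin_sum (I : finType) (F : I -> R -> R) (l : I -> R) :
  (forall i, F i t @[t --> 0^'+] --> l i) ->
  \sum_i F i t @[t --> 0^'+] --> \sum_i l i.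
Proof.
by move=> H; apply: cvg_big => [|i _]; [exact: add_continuous|exact: H].
Qed.

Lemma axis_quot_cvg u i : C2_near0 u -> cube_symmetric u ->
  2 * (u (t *: 'e_i) - u 0) / t ^+ 2 @[t --> 0^'+] --> partial i (partial i u) 0.
Proof.
move=> C2 su.
have C2' : \forall t \near (0 : R), derivable u (t *: 'e_i) 'e_i.
  by apply: (@near0_line (fun k => derivable u k 'e_i)); near=> k; case: (near C2 k _ i i).
have C20 := nbhs_singleton C2.
have := @even_second_difference (fun t => u (t *: 'e_i)) (fun t => partial i u (t *: 'e_i)) (partial i (partial i u) 0).
rewrite scale0r; apply.
- near=> t; apply: is_derive_line; near: t; exact: C2'.
- near=> t.
  have tc : cube (t *: 'e_i : 'rV[R]_d) by near: t; exact: near0_line near0_in_cube.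
  have [H _] := su _ tc; rewrite -(H i); congr u; apply/rowP => j.
  by rewrite !mxE eqxx /=; case: eqP => _ /=; rewrite ?mulr1 ?mulr0.
- have := @is_derive_line (partial i u) 'e_i 0; rewrite scale0r; apply.
  by case: (C20 i i).
Unshelve. all: by end_near.
Qed.

Lemma lap_quot_cvg u : C2_near0 u -> cube_symmetric u ->
  lap_quot u t @[t --> 0^'+] --> laplacian u 0.
Proof. by move=> C2 su; apply: cvg_fin_sum => i; exact: axis_quot_cvg. Qed.

Lemma lap_quot_near u v : (forall k, cube k -> u k = v k) ->
  \forall t \near 0^'+, lap_quot u t = lap_quot v t.
Proof.
move=> uv; near=> t; apply: eq_bigr => i _.
rewrite (uv 0 cube0) uv//.
have : forall i : 'I_d, cube (t *: 'e_i) by near: t; apply: near0_axes; exact: near0_in_cube.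
exact.
Unshelve. all: by end_near.
Qed.

Lemma lap_quot_cvg_eq u v (l : R) : (forall k, cube k -> u k = v k) ->
  lap_quot u t @[t --> 0^'+] --> l -> lap_quot v t @[t --> 0^'+] --> l.
Proof.
move=> uv; apply: cvg_trans; apply: near_eq_cvg; apply: lap_quot_near => k kc.
by rewrite uv.
Qed.

Lemma laplacian_near u v : (\forall k \near (0 : 'rV[R]_d), u k = v k) ->
  laplacian u 0 = laplacian v 0.
Proof.
move=> uv; apply: eq_bigr => i _; apply: near_eq_derive.
have uv' := near_join uv; near=> k; apply: near_eq_derive; near: k; exact: uv'.
Unshelve. all: by end_near.
Qed.

Let rmul (a b : R -> R) (l m : R) : a t @[t --> 0^'+] --> l -> b t @[t --> 0^'+] --> m ->
  a t * b t @[t --> 0^'+] --> l * m.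
Proof. exact: cvgM. Qed.

Let radd (a b : R -> R) (l m : R) : a t @[t --> 0^'+] --> l -> b t @[t --> 0^'+] --> m ->
  a t + b t @[t --> 0^'+] --> l + m.
Proof. exact: cvgD. Qed.

Let rcst (l : R) : (fun=> l) t @[t --> (0 : R)^'+] --> l.
Proof. exact: cvg_cst. Qed.

Let leib (a b c : R -> R) (la lb x y : R) :
  a t @[t --> 0^'+] --> la -> b t @[t --> 0^'+] --> lb -> c t @[t --> 0^'+] --> (0 : R) ->
  a t * y + x * b t + c t @[t --> 0^'+] --> la * y + x * lb + 0.
Proof.
move=> ha hb hc; apply: (@radd (fun t => a t * y + x * b t) c) => //.
apply: (@radd (fun t => a t * y) (fun t => x * b t)).
  exact: (@rmul a (fun=> y)).
exact: (@rmul (fun=> x) b).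
Qed.

Let cross0 (a b : R -> R) (la lb : R) :
  a t @[t --> 0^'+] --> la -> b t @[t --> 0^'+] --> lb ->
  a t * b t * t ^+ 2 / 2 @[t --> 0^'+] --> (0 : R).
Proof.
move=> ha hb; have h : x ^+ 2 @[x --> (0 : R)] --> (0 : R) ^+ 2 by exact: exprn_continuous.
rewrite expr0n /= in h; have h' := cvg_at_right_filter h.
rewrite [X in _ --> X](_ : 0 = la * lb * 0 / 2); last by rewrite mulr0 mul0r.
apply: (@rmul (fun t => a t * b t * t ^+ 2) (fun=> 2^-1)) => //.
apply: (@rmul (fun t => a t * b t) (fun t => t ^+ 2)) => //.
exact: rmul.
Qed.

(** Leibniz rule; the cross term of the product vanishes in the limit. *)
Lemma lap_quotM u v : C2_near0 u -> cube_symmetric u -> C2_near0 v -> cube_symmetric v ->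
  lap_quot (fun k => u k * v k) t @[t --> 0^'+] --> laplacian u 0 * v 0 + u 0 * laplacian v 0.
Proof.
move=> C2u su C2v sv; have cu := lap_quot_cvg C2u su; have cv := lap_quot_cvg C2v sv.
have cross : \sum_i (2 * (u (t *: 'e_i) - u 0) / t ^+ 2) * (2 * (v (t *: 'e_i) - v 0) / t ^+ 2) * t ^+ 2 / 2
   @[t --> 0^'+] --> \sum_(i < d) (0 : R).
  apply: cvg_fin_sum => i; have hl := @axis_quot_cvg u i C2u su; have hl' := @axis_quot_cvg v i C2v sv.
  exact: cross0 hl hl'.
rewrite big1 ?addr0// in cross.
rewrite -[X in _ --> X]addr0.
have Q : lap_quot u t * v 0 + u 0 * lap_quot v t +
    \sum_i (2 * (u (t *: 'e_i) - u 0) / t ^+ 2) * (2 * (v (t *: 'e_i) - v 0) / t ^+ 2) * t ^+ 2 / 2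
    @[t --> 0^'+] --> laplacian u 0 * v 0 + u 0 * laplacian v 0 + 0.
  exact: leib.
apply: cvg_trans Q; apply: near_eq_cvg; near=> t.
have t0 : 0 < t by near: t; exact: nbhs_right_gt.
rewrite /lap_quot /= mulr_suml mulr_sumr -!big_split /=; apply: eq_bigr => i _.
by field; rewrite gt_eqF.
Unshelve. all: by end_near.
Qed.

End Laplacian.

(** * Pointwise bounds on the expansion *)

Section KernelPointwise.
Variable R : realType.

(** With [u = 1 + alpha * i], the bound [1 + y <= expR y] gives
    [x ^+ i <= expR (3 - c0 * u)], and the exponential beats the power [M]
    of [u]. *)
Lemma pow_le_lam (c0 x alpha : R) (N M i : nat) : 0 < c0 <= 1 -> 0 <= x -> x <= 1 - c0 * (alpha - N%:R^-1) + N%:R^-1 ->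
  (i <= N)%N -> (1 <= N)%N -> (1 <= M)%N -> 0 <= alpha ->
  x ^+ i <= expR 3 * (M%:R / c0) ^+ M * lam alpha i ^+ M.
Proof.
move=> /andP[c00 c01] x0 xle iN N1 M1 al0.
have N0 : 0 < N%:R :> R by rewrite ltr0n.
have M0 : 0 < M%:R :> R by rewrite ltr0n.
have iN1 : i%:R / N%:R <= 1 :> R by rewrite ler_pdivrMr// mul1r ler_nat.
have iN0 : 0 <= i%:R / N%:R :> R by rewrite divr_ge0.
pose u := 1 + alpha * i%:R.
have u0 : 0 < u by rewrite ltr_pwDl// mulr_ge0.
have h1 : x ^+ i <= expR (3 - c0 * u).
  apply: (@le_trans _ _ (expR (- c0 * (alpha - N%:R^-1) + N%:R^-1) ^+ i)).
    rewrite lerXn2r// ?nnegrE ?expR_ge0//; apply: le_trans (expR_ge1Dx _).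
    by apply: le_trans xle _; rewrite mulNr addrA.
  rewrite -expRM_natl ler_expR /u.
  rewrite [leLHS](_ : _ = - c0 * (alpha * i%:R) + (1 + c0) * (i%:R / N%:R)); last by ring.
  have : (1 + c0) * (i%:R / N%:R) <= 2.
    by apply: le_trans (_ : 2 * 1 <= _); [apply: ler_pM => //; lra|lra].
  lra.
apply: le_trans h1 _; rewrite expRD -mulrA ler_wpM2l ?expR_ge0//.
have h2 : (c0 * u / M%:R) ^+ M <= expR (c0 * u).
  rewrite [X in expR X](_ : _ = M%:R * (c0 * u / M%:R)); last by field; rewrite gt_eqF.
  have y0 : 0 <= c0 * u / M%:R by rewrite divr_ge0// mulr_ge0// ltW.
  rewrite expRM_natl lerXn2r// ?nnegrE ?expR_ge0//.
  by apply: le_trans (expR_ge1Dx _); rewrite lerDr.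
rewrite expRN (_ : (M%:R / c0) ^+ M * _ = ((c0 * u / M%:R) ^+ M)^-1).
  by rewrite lef_pV2 ?posrE ?expR_gt0// exprn_gt0// divr_gt0// mulr_gt0.
by rewrite /lam -/u -exprMn -exprVn; congr (_ ^+ M); rewrite invf_div invfM; ring.
Qed.

(** The kernel at [k] has total mass [1 - a (k) + O (b) a (k) + O (b / N)], so
    that its powers decay like those of [expR (- a (k) - 1 / N)]. The point
    [a (k) = 2] is excluded because there the mass could be [-1]. *)
Lemma kernel_pointwise (theta eta : R) (M : nat) : 2 < theta -> 0 < eta <= 1 -> (2 <= M)%N ->
  exists b1 C : R, [/\ 0 < b1, 0 < C &
  forall (b a z : R) (N : nat) (g G l E F : nat -> R), 0 <= b <= b1 -> 0 <= a <= 2 - eta -> (1 <= N)%N ->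
  g 1%N = z -> G 1%N = z * (1 - a) -> G 0%N = 0 ->
  (forall m, (2 <= m <= N)%N -> [/\ `|g m| <= b * m%:R `^ (- theta), `|G m| <= b * m%:R `^ (- theta),
     `|l m| <= b * m%:R `^ (- (theta - 1)) & `|G m - g m - a * l m| <= b * a * m%:R `^ (- (theta - 1))]) ->
  `|\sum_(1 <= m < N.+1) g m - 1| <= b * N%:R `^ (- (theta - 1)) ->
  E 0%N = 1 -> (forall i, (1 <= i <= N)%N -> `|E i| <= b * i%:R `^ (- theta)) -> F = conv G F + E ->
  `|F N| <= C * ((1 + a * N%:R)^-1 ^+ M + N%:R `^ (- (theta - 2)) * (1 + a * N%:R)^-1 ^+ 2)].
Proof.
move=> th2 /andP[eta0 eta1] M2.
pose c0 := eta / 4.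
have c00 : 0 < c0 by rewrite divr_gt0.
pose R0 := 2 + expR 3 * (M%:R / c0) ^+ M.
have R02 : 2 <= R0 by rewrite lerDl mulr_ge0 ?expR_ge0// exprn_ge0// divr_ge0// ltW.
have R01 : 1 <= R0 by lra.
have [b1 [C [b10 C0 H]]] := renewal_bound th2 M2 R01.
pose S := 2 + 2 * (theta - 2)^-1.
have i0 : 0 < (theta - 2)^-1 by rewrite invr_gt0; lra.
have S0 : 2 <= S by rewrite /S; lra.
pose bb := Num.min b1 (c0 / S).
have bb0 : 0 < bb by rewrite lt_min b10 divr_gt0//; lra.
exists bb, C; split => // b a z N g G l E F /andP[b0 bbb] /andP[a0 a2] N1 g1 G1 G0 Hm Hs E0 HE HF.
have bb1 : b <= b1 by apply: le_trans bbb _; rewrite ge_min lexx.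
have bS : b * S <= c0.
  by rewrite -ler_pdivlMr; [apply: le_trans bbb _; rewrite ge_min lexx orbT|lra].
have b1' : b <= 1 by (have h : b * 2 <= b * S by rewrite ler_wpM2l//); rewrite /c0 in bS; move: h bS eta1; only_lra.
have N0 : 0 < N%:R :> R by rewrite ltr0n.
have Ni : 0 < (N%:R^-1 : R) <= 1 by rewrite invr_gt0 N0 invf_le1// ler1n.
have NN : N%:R `^ (- (theta - 1)) <= N%:R^-1 :> R.
  by rewrite -powR_inv1 ?(ltW N0)// ler_powR ?ler1n//; move: th2; only_lra.
pose alpha := a + N%:R^-1; pose rho := \sum_(1 <= i < N.+1) G i.
have al : 0 < alpha <= 3 by rewrite /alpha; move: a0 a2 eta0 Ni; only_lra.
have Sg : `|\sum_(2 <= m < N.+1) g m| <= b.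
  apply: le_trans (ler_norm_sum _ _ _) _.
  apply: (@le_trans _ _ (\sum_(2 <= m < N.+1) b * m%:R `^ (- theta))).
    by apply: ler_sum_nat => m /andP[m2 mN]; have [] := Hm m _ => //; rewrite m2 -ltnS.
  rewrite -mulr_sumr -[leRHS]mulr1 ler_wpM2l//; apply: le_trans (sum_powR_tail _ _ _) _ => //; first by move: th2; only_lra.
  by rewrite powR1 mulr1 invf_le1; move: th2; only_lra.
have SG : `|\sum_(2 <= m < N.+1) (G m - g m)| <= 2 * b * a * (theta - 2)^-1.
  apply: le_trans (ler_norm_sum _ _ _) _.
  apply: (@le_trans _ _ (\sum_(2 <= m < N.+1) (2 * b * a) * m%:R `^ (- (theta - 1)))).
    apply: ler_sum_nat => m /andP[m2 mN]; have [|_ _ h1 h2] := Hm m; first by rewrite m2 -ltnS.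
    rewrite (_ : G m - g m = (G m - g m - a * l m) + a * l m); last by ring.
    apply: le_trans (ler_normD _ _) _; rewrite normrM (ger0_norm a0).
    by move: h2 (ler_wpM2l a0 h1); only_lra.
  rewrite -mulr_sumr ler_wpM2l ?mulr_ge0//; apply: le_trans (sum_powR_tail _ _ _) _ => //; first by move: th2; only_lra.
  by rewrite powR1 mulr1 (_ : theta - 1 - 1 = theta - 2)//; ring.
have rhoE : rho = \sum_(1 <= m < N.+1) g m - z * a + \sum_(2 <= m < N.+1) (G m - g m).
  by rewrite /rho !(@big_ltn _ _ _ 1)// sumrB G1 g1; ring.
have hz : `|z - 1| <= b / N%:R + b.
  have -> : z - 1 = (\sum_(1 <= m < N.+1) g m - 1) - \sum_(2 <= m < N.+1) g m.
    by rewrite (@big_ltn _ _ _ 1)// g1; ring.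
  apply: le_trans (ler_normB _ _) _; apply: lerD => //.
  by apply: le_trans Hs _; rewrite ler_wpM2l.
have hz2 : `|z - 1| <= 2 * b.
  by apply: le_trans hz _; have := ler_wpM2l b0 (andP Ni).2; only_lra.
have Hs' : `|\sum_(1 <= m < N.+1) g m - 1| <= b * N%:R^-1.
  by apply: le_trans Hs _; rewrite ler_wpM2l.
have Hrho : `|rho - (1 - a)| <= b * N%:R^-1 + a * (b * S).
  rewrite rhoE (_ : _ - (1 - a) = (\sum_(1 <= m < N.+1) g m - 1) - (z - 1) * a + \sum_(2 <= m < N.+1) (G m - g m)); last by ring.
  apply: le_trans (ler_normD _ _) _; have := ler_normB (\sum_(1 <= m < N.+1) g m - 1) ((z - 1) * a).
  rewrite normrM (ger0_norm a0); have := ler_wpM2r a0 hz2.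
  by move: SG Hs'; rewrite /S; only_lra.
have aS : a * (b * S) <= a * c0 by rewrite ler_wpM2l.
have rho1 : `|rho| <= 1 - c0 * a + N%:R^-1.
  have bN : b * N%:R^-1 <= N%:R^-1 by rewrite ler_piMl// ltW; case/andP: Ni.
  have ac : a * eta <= (2 - eta) * eta by rewrite ler_wpM2r// ltW.
  have aeta : a * eta <= a by rewrite ler_piMr.
  have sq := sqr_ge0 eta.
  move: Hrho; rewrite ler_norml ler_norml /c0 in aS * => /andP[h1 h2].
  by apply/andP; split; move: h1 h2 bN ac aeta sq aS a0 a2 eta0; only_lra.
have powb i : (i <= N)%N -> `|rho| ^+ i <= R0 * lam alpha i ^+ M.
  move=> iN; have l0 : 0 <= lam alpha i ^+ M.
    by rewrite exprn_ge0// /lam invr_ge0 addr_ge0// mulr_ge0// ltW//; case/andP: al.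
  apply: (@le_trans _ _ (expR 3 * (M%:R / c0) ^+ M * lam alpha i ^+ M)).
    apply: (@pow_le_lam c0 _ alpha N) => //; first by rewrite c00 /c0; move: eta1; only_lra.
    - by rewrite /alpha addrK.
    - exact: ltnW.
    - by case/andP: al => /ltW.
  by rewrite ler_wpM2r// /R0 lerDr.
have d1 : `|1 - rho| <= R0 * alpha.
  have : `|1 - rho| <= 2 * alpha.
    rewrite distrC (_ : rho - 1 = (rho - (1 - a)) - a); last by ring.
    apply: le_trans (ler_normB _ _) _; rewrite (ger0_norm a0) /alpha.
    have bN : b * N%:R^-1 <= N%:R^-1 by rewrite ler_piMl// ltW; case/andP: Ni.
    have : a * c0 <= a by rewrite ler_piMr// /c0; move: eta1; only_lra.
    by move: Hrho bN aS; case/andP: Ni; only_lra.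
  by move/le_trans; apply; rewrite ler_wpM2r// ltW; case/andP: al.
have := H alpha b rho N G E F al _ powb d1 erefl _ G0 E0 HF HE N.
rewrite b0 bb1 N1 leqnn => /(_ isT) h.
apply: le_trans (h _ isT) _; first by move=> i iN; have [] := Hm i iN.
have aN : 0 <= a * N%:R by rewrite mulr_ge0// ltW.
have lamle : 0 <= lam alpha N <= (1 + a * N%:R)^-1.
  rewrite /lam /alpha mulrDl mulVf ?gt_eqF// invr_ge0 addr_ge0// ?addr_ge0//=.
  by rewrite lef_pV2 ?posrE ?ltr_pwDl// ?addr_ge0// lerD2l lerDl.
case/andP: lamle => lam0 lamle.
rewrite ler_wpM2l ?(ltW C0)//; apply: lerD.
  by rewrite lerXn2r// nnegrE//; exact: le_trans lamle.
rewrite ler_wpM2l ?powR_ge0// lerXn2r// nnegrE//; exact: le_trans lamle.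
Qed.

(** Second moments grow at most linearly, like the number of terms in their
    renewal representation. *)
Lemma moment_bound (theta b z C : R) (n : nat) (l eh f h phi : nat -> R) :
  2 < theta -> 0 <= b <= 1 -> `|z| <= 2 -> 0 <= C ->
  l 0%N = 0 -> l 1%N = - z -> eh 0%N = 0 ->
  (forall m, (2 <= m <= n)%N -> `|l m| <= b * m%:R `^ (- (theta - 1))) ->
  (forall m, (1 <= m <= n)%N -> `|eh m| <= b * m%:R `^ (- (theta - 1))) ->
  (forall m, (m <= n)%N -> `|f m| <= C) -> (forall m, (m <= n)%N -> `|phi m| <= C) ->
  h = conv phi (conv l f + eh) ->
  `|h n| <= C * ((2 + (theta - 2)^-1) * C + 1) * n%:R.
Proof.
move=> th2 /andP[b0 b1] z2 C0 l0 l1 e0 Hl He Hf Hphi ->.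
have s0 : (conv l f + eh) 0%N = 0.
  by rewrite -[LHS]/(conv l f 0 + eh 0%N) conv0 l0 e0 mul0r addr0.
have i0 : 0 < (theta - 2)^-1 by rewrite invr_gt0; lra.
have S0 : 0 <= (2 + (theta - 2)^-1) * C + 1 by rewrite addr_ge0// mulr_ge0//; lra.
have sb j : (j <= n)%N -> `|(conv l f + eh) j| <= (2 + (theta - 2)^-1) * C + 1.
  case: j => [|j] jn; first by rewrite s0 normr0.
  rewrite -[X in `|X|]/(conv l f j.+1 + eh j.+1); apply: le_trans (ler_normD _ _) _; apply: lerD; last first.
    apply: le_trans (He _ _) _ => //.
    by rewrite mulr_ile1 ?powR_ge0// powR_nat_le1//; lra.
  rewrite conv_recl l0 mul0r add0r big_ltn//.
  apply: le_trans (ler_normD _ _) _; rewrite mulrDl; apply: lerD.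
    rewrite l1 normrM normrN; apply: ler_pM => //; apply: Hf; exact: leq_trans (leq_subr _ _) jn.
  apply: le_trans (ler_norm_sum _ _ _) _.
  apply: (@le_trans _ _ (\sum_(2 <= m < j.+2) m%:R `^ (- (theta - 1)) * C)).
    apply: ler_sum_nat => m /andP[m2 mj]; rewrite normrM; apply: ler_pM => //.
      apply: le_trans (Hl _ _) _; first by rewrite m2; nlia.
      by rewrite ler_piMl ?powR_ge0.
    apply: Hf; exact: leq_trans (leq_subr _ _) jn.
  rewrite -mulr_suml ler_wpM2r//; apply: le_trans (sum_powR_tail _ _ _) _ => //; first by lra.
  by rewrite powR1 mulr1 (_ : theta - 1 - 1 = theta - 2)//; ring.
rewrite convC conv_recl s0 mul0r add0r.
apply: le_trans (ler_norm_sum _ _ _) _.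
apply: (@le_trans _ _ (\sum_(1 <= i < n.+1) C * ((2 + (theta - 2)^-1) * C + 1))).
  apply: ler_sum_nat => i /andP[i1 ilt]; rewrite normrM mulrC; apply: ler_pM => //.
    by apply: Hphi; exact: leq_subr.
  by apply: sb; rewrite -ltnS.
by rewrite sumr_const_nat subn1 /= mulr_natr.
Qed.

End KernelPointwise.

(** * Second moments of the expansion *)

Section ModelMoments.
Variables (R : realType) (d : nat) (D : 'rV[int]_d -> R) (z : R).
Variables (f g e : nat -> 'rV[R]_d -> R).
Hypotheses (frec : forall k, cube k -> f 0%N k = 1 /\
    forall n, f n.+1 k = \sum_(1 <= m < n.+2) g m k * f (n.+1 - m)%N k + e n.+1 k)
  (g1D : forall k, cube k -> g 1%N k = z * Dhat D k)
  (fsym : forall n, cube_symmetric (f n)) (fC2 : forall n, C2_near0 (f n))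
  (gsym : forall n, (1 <= n)%N -> cube_symmetric (g n)) (gC2 : forall n, (1 <= n)%N -> C2_near0 (g n)).
Hypotheses (D01 : Dhat D 0 = 1) (DL : lap_quot (Dhat D) t @[t --> 0^'+] --> - sigma2 D)
  (s20 : 0 < sigma2 D).

Definition kern k m : R := if m is 0 then 0 else g m k.
(** Division by the variance of the step distribution makes the bounds on second
    derivatives independent of [L]. *)
Definition klap m : R := if m is 0 then 0 else (sigma2 D)^-1 * laplacian (g m) 0.
Definition flap n : R := (sigma2 D)^-1 * laplacian (f n) 0.

(** The contribution of [e] to the normalized second moments, defined as the
    remainder of the renewal equation that they satisfy. *)
Definition elap : nat -> R := flap - conv (kern 0) flap - conv klap (fun n => f n 0).

Lemma lap_quot_sum (T : Type) (r : seq T) (w : T -> 'rV[R]_d -> R) t :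
  lap_quot (fun k => \sum_(j <- r) w j k) t = \sum_(j <- r) lap_quot (w j) t.
Proof.
rewrite /lap_quot exchange_big /=; apply: eq_bigr => i _.
by rewrite -sumrB mulr_sumr mulr_suml.
Qed.

Lemma lap_quotZ c (w : 'rV[R]_d -> R) t : lap_quot (fun k => c * w k) t = c * lap_quot w t.
Proof. by rewrite /lap_quot mulr_sumr; apply: eq_bigr => i _; ring. Qed.

Lemma lap_quotB (u w : 'rV[R]_d -> R) t :
  lap_quot (fun k => u k - w k) t = lap_quot u t - lap_quot w t.
Proof. by rewrite /lap_quot -sumrB; apply: eq_bigr => i _; ring. Qed.

Lemma lap_quot_akD : lap_quot (akD D) t @[t --> 0^'+] --> sigma2 D.
Proof.
have -> : lap_quot (akD D) = fun t => - lap_quot (Dhat D) t.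
  by apply/funext => t; rewrite /lap_quot -sumrN; apply: eq_bigr => i _; rewrite /akD; ring.
by rewrite -[sigma2 D]opprK; exact: cvgN.
Qed.

Lemma flap0 : flap 0%N = 0.
Proof.
rewrite /flap (_ : laplacian _ 0 = 0) ?mulr0//.
have h := lap_quot_cvg (fC2 0) (@fsym 0).
have : lap_quot (f 0%N) t @[t --> 0^'+] --> (0 : R).
  apply: (@lap_quot_cvg_eq _ _ (fun=> 1)); first by move=> k kc; have [] := frec kc.
  have -> : lap_quot (fun _ : 'rV[R]_d => 1) = fun=> 0.
    by apply/funext => t; rewrite /lap_quot big1// => i _; rewrite subrr mulr0 mul0r.
  exact: cvg_cst.
by move/(cvg_unique _ h); apply.
Qed.

Lemma klap1 : klap 1%N = - z.
Proof.
rewrite /klap (_ : laplacian _ 0 = - z * sigma2 D); first by field; rewrite gt_eqF.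
have h := lap_quot_cvg (gC2 (leqnn 1)) (gsym (leqnn 1)).
have : lap_quot (g 1%N) t @[t --> 0^'+] --> - z * sigma2 D.
  apply: (@lap_quot_cvg_eq _ _ (fun k => z * Dhat D k)); first by move=> k /g1D.
  have -> : lap_quot (fun k => z * Dhat D k) = fun t => z * lap_quot (Dhat D) t.
    by apply/funext => t; exact: lap_quotZ.
  by rewrite mulNr -mulrN; apply: cvgM => //; exact: cvg_cst.
by move/(cvg_unique _ h); apply.
Qed.

Lemma elap0 : elap 0%N = 0.
Proof.
rewrite -[LHS]/(flap 0 - conv (kern 0) flap 0 - conv klap _ 0) !conv0 flap0.
by rewrite !mul0r !subr0.
Qed.

(** The difference quotients of [e] are at most [c] times those of [akD D], which
    tend to the variance. *)
Lemma elap_bound n c : 0 <= c ->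
  (forall k, cube k -> `|e n.+1 k - e n.+1 0| <= c * akD D k) -> `|elap n.+1| <= c.
Proof.
move=> c0 He.
pose w m k := g m k * f (n.+1 - m)%N k.
have cw m : (1 <= m)%N -> lap_quot (w m) t @[t --> 0^'+] -->
    laplacian (g m) 0 * f (n.+1 - m)%N 0 + g m 0 * laplacian (f (n.+1 - m)%N) 0.
  by move=> m1; apply: lap_quotM => //; [exact: gC2|exact: gsym].
have cs : lap_quot (fun k => \sum_(1 <= m < n.+2) w m k) t @[t --> 0^'+] -->
    \sum_(1 <= m < n.+2) (laplacian (g m) 0 * f (n.+1 - m)%N 0 + g m 0 * laplacian (f (n.+1 - m)%N) 0).
  have -> : lap_quot (fun k => \sum_(1 <= m < n.+2) w m k) =
      fun t => \sum_(1 <= m < n.+2) lap_quot (w m) t.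
    by apply/funext => t; exact: lap_quot_sum.
  rewrite big_nat_cond; under eq_fun do rewrite big_nat_cond.
  by apply: cvg_big => [|i /andP[/andP[i1 _] _]]; [exact: add_continuous|exact: cw].
have cf := lap_quot_cvg (fC2 n.+1) (@fsym n.+1).
set S := (\sum_(1 <= m < n.+2) _) in cs.
have ce : lap_quot (e n.+1) t @[t --> 0^'+] --> laplacian (f n.+1) 0 - S.
  apply: (@lap_quot_cvg_eq _ _ (fun k => f n.+1 k - \sum_(1 <= m < n.+2) w m k)).
    by move=> k kc; have [_ ->] := frec kc; rewrite addrAC subrr add0r.
  have -> : lap_quot (fun k => f n.+1 k - \sum_(1 <= m < n.+2) w m k) =
      fun t => lap_quot (f n.+1) t - lap_quot (fun k => \sum_(1 <= m < n.+2) w m k) t.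
    by apply/funext => t; exact: lap_quotB.
  exact: cvgB.
have E : elap n.+1 = (sigma2 D)^-1 * (laplacian (f n.+1) 0 - S).
  rewrite -[LHS]/(flap n.+1 - conv (kern 0) flap n.+1 - conv klap _ n.+1) !conv_recl !mul0r !add0r.
  rewrite /S big_split /= mulrBr /flap -!addrA; congr (_ + _); rewrite -opprD; congr (- _).
  rewrite mulrDr addrC !mulr_sumr; congr (_ + _).
    by apply: eq_big_nat => -[|m]// _; rewrite /klap mulrA.
  by apply: eq_big_nat => -[|m]// _; rewrite /kern mulrCA.
have ca : c * lap_quot (akD D) t @[t --> 0^'+] --> c * sigma2 D.
  by apply: cvgM; [exact: cvg_cst|exact: lap_quot_akD].
have a0 : akD D 0 = 0 by rewrite /akD D01 subrr.
have nb : \forall t \near 0^'+, `|lap_quot (e n.+1) t| <= c * lap_quot (akD D) t.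
  near=> t.
  have t0 : 0 < t by near: t; exact: nbhs_right_gt.
  have tc : forall i : 'I_d, cube (t *: 'e_i : 'rV[R]_d) by near: t; apply: near0_axes; exact: near0_in_cube.
  rewrite /lap_quot mulr_sumr; apply: le_trans (ler_norm_sum _ _ _) _; apply: ler_sum => i _.
  rewrite a0 subr0 !normrM normfV (ger0_norm (sqr_ge0 t)) (ger0_norm (ltW (ltr0Sn _ 1))).
  rewrite (_ : c * (2 * akD D (t *: 'e_i) / t ^+ 2) = 2 * (c * akD D (t *: 'e_i)) / t ^+ 2); last by ring.
  by rewrite ler_wpM2r ?invr_ge0 ?sqr_ge0// ler_wpM2l// He.
have h1 : laplacian (f n.+1) 0 - S <= c * sigma2 D.
  apply: ler_cvg_to ce ca _; near=> t; apply: le_trans (ler_norm _) _.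
  by near: t; exact: nb.
have h2 : - (c * sigma2 D) <= laplacian (f n.+1) 0 - S.
  apply: ler_cvg_to (cvgN ca) ce _; near=> t; rewrite lerNl; apply: le_trans (ler_norm _) _.
  by rewrite normrN; near: t; exact: nb.
rewrite E normrM gtr0_norm ?invr_gt0// ler_pdivrMl// mulrC ler_norml h1.
by rewrite andbT.
Unshelve. all: by end_near.
Qed.

Lemma flap_renewal : flap = conv (kern 0) flap + (conv klap (fun n => f n 0) + elap).
Proof. by rewrite /elap; apply/funext => n; rewrite !fctE; ring. Qed.

End ModelMoments.

Section Variance.
Variables (R : realType) (d : nat) (D : 'rV[int]_d -> R).

Lemma lap_quot_Dhat (u : 'rV[R]_d -> R) : C2_near0 u -> cube_symmetric u ->
  (forall k, cube k -> u k = Dhat D k) -> lap_quot (Dhat D) t @[t --> 0^'+] --> - sigma2 D.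
Proof.
move=> C2 su uD; rewrite /sigma2 opprK -(@laplacian_near _ _ u).
  by apply: (@lap_quot_cvg_eq _ _ u) => //; exact: lap_quot_cvg.
near=> k; apply: uD; near: k; exact: near0_in_cube.
Unshelve. all: by end_near.
Qed.

Hypotheses (D01 : Dhat D 0 = 1) (DL : lap_quot (Dhat D) t @[t --> 0^'+] --> - sigma2 D).

Lemma sigma2_gt0 (r c : R) : (0 < d)%N -> 0 < r -> 0 < c ->
  (forall k, cube k -> `|k| <= r -> c * sqnorm k <= akD D k) -> 0 < sigma2 D.
Proof.
move=> d0 r0 c0 H; apply: (@lt_le_trans _ _ (d%:R * (2 * c))).
  by rewrite !mulr_gt0 ?ltr0n.
have cc : (fun=> d%:R * (2 * c)) t @[t --> (0 : R)^'+] --> d%:R * (2 * c) by exact: cvg_cst.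
apply: ler_cvg_to cc (lap_quot_akD DL) _; near=> t.
have t0 : 0 < t by near: t; exact: nbhs_right_gt.
have tc : forall i : 'I_d, cube (t *: 'e_i : 'rV[R]_d) by near: t; apply: near0_axes; exact: near0_in_cube.
have tr : t <= r by near: t; exact: nbhs_right_le.
rewrite /lap_quot mulr_natl -[d in leLHS]card_ord -sumr_const; apply: ler_sum => i _.
have sE : sqnorm (t *: 'e_i : 'rV[R]_d) = t ^+ 2.
  rewrite /sqnorm (bigD1 i)//= big1 ?addr0; first by rewrite !mxE !eqxx mulr1.
  by move=> j ji; rewrite !mxE eqxx (negbTE ji) mulr0 expr0n.
rewrite /akD D01 subrr subr0 ler_pdivlMr ?exprn_gt0// -mulrA ler_wpM2l// -sE.
apply: H => //; apply/rV_norm_leP; first exact: ltW.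
move=> j; rewrite !mxE eqxx /=; case: eqP => _; rewrite ?mulr1 ?mulr0 ?normr0 ?(ltW r0)//.
by rewrite gtr0_norm.
Unshelve. all: by end_near.
Qed.

(** An isotropic quadratic form is determined by its trace, here half of the
    variance. *)
Lemma quad_sigma2 (eps : R) (i0 : 'I_d) k : (forall x, 0 <= D x) -> 0 < eps ->
  (\esum_(x in [set: 'rV[int]_d]) (znorm R x `^ (2 + 2 * eps) * D x)%:E < +oo)%E ->
  cube_symmetric (akD D) -> quad D k = sigma2 D / (2 * d%:R) * sqnorm k.
Proof.
move=> D0 eps0 Dm Ds; have iso := quad_isotropic D0 D01 eps0 Dm Ds i0.
have sE (i : 'I_d) : sqnorm ('e_i : 'rV[R]_d) = 1.
  rewrite /sqnorm (bigD1 i)//= big1 ?addr0; first by rewrite !mxE !eqxx expr1n.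
  by move=> j ji; rewrite !mxE eqxx (negbTE ji) expr0n.
have h : lap_quot (akD D) t @[t --> 0^'+] --> \sum_(i < d) 2 * quad D 'e_i.
  apply: cvg_fin_sum => i; under eq_fun do rewrite -mulrA.
  apply: cvgM; first exact: cvg_cst.
  have := @quad_cvg _ _ _ D0 D01 _ eps0 Dm 'e_i.
  by rewrite /akD D01 subrr; under [X in _ -> X @ _ --> _]eq_fun do rewrite subr0.
have d0 : (0 < d)%N by exact: leq_ltn_trans (ltn_ord i0).
have -> : sigma2 D = d%:R * (2 * quad D 'e_i0).
  have := cvg_unique _ (lap_quot_akD DL) h; move=> -> //.
  under eq_bigr do rewrite iso sE mulr1.
  by rewrite sumr_const card_ord [RHS]mulr_natl.
rewrite iso; congr (_ * _); field; rewrite pnatr_eq0 -lt0n d0//=.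
Qed.

End Variance.

(** * Locating the critical point *)

Section CriticalPoint.
Variables (R : realType) (theta b : R) (G : nat -> R -> R).
Hypotheses (th2 : 2 < theta) (b0 : 0 < b) (bS : b * (theta - 2)^-1 <= 1 / 2).

Definition kmass (N : nat) (z : R) : R := z + \sum_(2 <= m < N.+1) G m z.

Let tau (N : nat) : R := b * N%:R `^ (- (theta - 1)).

Let near_critical (N : nat) (z : R) : Prop :=
  forall j, (1 <= j <= N)%N -> `|kmass j z - 1| <= tau j.

Hypothesis Greg : forall (N : nat) z, 1 - b <= z <= 1 + b -> (1 <= N)%N -> near_critical N z ->
  forall m, (2 <= m <= N.+1)%N ->
  [/\ `|G m z| <= b * m%:R `^ (- theta), derivable (G m) z 1 &
      `|derive1 (G m) z| <= b * m%:R `^ (- (theta - 1))].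

(** Both extreme values of the mass are attained at the ends, so that the
    intermediate value theorem can cut out the next interval. *)
Let inv (N : nat) (p : R * R) : Prop :=
  [/\ 1 - b <= p.1, p.1 <= p.2, p.2 <= 1 + b,
      forall z, p.1 <= z <= p.2 -> near_critical N z &
      kmass N p.1 = 1 - tau N /\ kmass N p.2 = 1 + tau N].

Let tauS N : (1 <= N)%N -> tau N.+1 + b * N.+1%:R `^ (- theta) <= tau N.
Proof.
move=> N1; rewrite /tau -mulrDr ler_wpM2l ?(ltW b0)//.
have t1 : 0 < theta - 1 by move: th2; lra.
have := powR_succ_diff t1 N1; rewrite (_ : - (theta - 1) - 1 = - theta); last by ring.
have : N.+1%:R `^ (- theta) <= (theta - 1) * N.+1%:R `^ (- theta) :> R.
  by rewrite ler_peMl ?powR_ge0//; move: th2; lra.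
by lra.
Qed.

Lemma is_derive_kmass (N : nat) (z : R) : (forall m, (2 <= m <= N)%N -> derivable (G m) z 1) ->
  is_derive z 1 (kmass N) (1 + \sum_(2 <= m < N.+1) derive1 (G m) z).
Proof.
move=> dG; rewrite /kmass; apply: is_deriveD.
elim: N dG => [|N IH] dG.
  rewrite big_geq// (_ : (fun _ => _) = cst 0); first exact: is_derive_cst.
  by apply/funext => y; rewrite big_geq.
case: N IH dG => [|N] IH dG.
  rewrite big_geq// (_ : (fun _ => _) = cst 0); first exact: is_derive_cst.
  by apply/funext => y; rewrite big_geq.
rewrite (_ : (fun _ => _) = (fun y => \sum_(2 <= m < N.+2) G m y) + G N.+2); last first.
  by apply/funext => y; rewrite big_nat_recr.
rewrite big_nat_recr//=; apply: is_deriveD.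
  by apply: IH => m /andP[m2 mN]; apply: dG; rewrite m2 ltnW.
by apply: DeriveDef; [apply: dG; rewrite /= leqnn|rewrite derive1E].
Qed.

(** The mass of the truncated kernel is increasing in [z] with slope at least
    1 / 2 where the regularity bounds hold, and the tolerance [tau] shrinks
    more slowly than the mass can change when a term is added. *)
Let inv_step N p : (1 <= N)%N -> inv N p ->
  exists q, [/\ p.1 <= q.1, q.2 <= p.2 & inv N.+1 q].
Proof.
case: p => u w N1 /= [] /= hu huw hw Hz [mu mw].
have zin z : u <= z <= w -> 1 - b <= z <= 1 + b by move=> /andP[? ?]; apply/andP; split; lra.
have reg z m : u <= z <= w -> (2 <= m <= N.+1)%N -> _ :=
  fun zz => @Greg N z (zin z zz) N1 (Hz z zz) m.
have dH z : u <= z <= w -> is_derive z 1 (kmass N.+1) (1 + \sum_(2 <= m < N.+2) derive1 (G m) z).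
  by move=> zz; apply: is_derive_kmass => m mm; have [] := reg z m zz mm.
have dH0 z : u <= z <= w -> 0 <= 1 + \sum_(2 <= m < N.+2) derive1 (G m) z.
  move=> zz; have : `|\sum_(2 <= m < N.+2) derive1 (G m) z| <= 1 / 2.
    apply: le_trans (ler_norm_sum _ _ _) _.
    apply: (@le_trans _ _ (\sum_(2 <= m < N.+2) b * m%:R `^ (- (theta - 1)))).
      by apply: ler_sum_nat => m mm; have [] := reg z m zz mm.
    rewrite -mulr_sumr; apply: le_trans bS; rewrite ler_wpM2l ?(ltW b0)//.
    apply: le_trans (sum_powR_tail _ _ _) _ => //; first by move: th2; lra.
    by rewrite powR1 mulr1 (_ : theta - 1 - 1 = theta - 2)//; ring.
  by rewrite ler_norml => /andP[]; lra.
have cH x y : u <= x -> y <= w -> {within `[x, y], continuous (kmass N.+1)}.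
  move=> ux yw; apply: derivable_within_continuous => z; rewrite in_itv /= => /andP[xz zy].
  have zz : u <= z <= w by apply/andP; split; [exact: le_trans xz|exact: le_trans yw].
  by case: (dH z zz).
have mono x y : u <= x -> x <= y -> y <= w -> kmass N.+1 x <= kmass N.+1 y.
  move=> ux xy yw; have [|c] := @MVT_segment R (kmass N.+1) (fun z => 1 + \sum_(2 <= m < N.+2) derive1 (G m) z) x y xy _ (cH _ _ ux yw).
    move=> z; rewrite in_itv /= => /andP[xz zy]; apply: dH; apply/andP; split.
      by apply: le_trans ux (ltW xz).
    exact: le_trans (ltW zy) yw.
  rewrite in_itv /= => /andP[xc cy] E; rewrite -subr_ge0 E mulr_ge0 ?subr_ge0//.
  by apply: dH0; apply/andP; split; [exact: le_trans xc|exact: le_trans yw].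
have SE z : kmass N.+1 z = kmass N z + G N.+1 z by rewrite /kmass big_nat_recr//= addrA.
have gb z : u <= z <= w -> `|G N.+1 z| <= b * N.+1%:R `^ (- theta).
  by move=> zz; have [] := reg z N.+1 zz; rewrite ?ltnS ?N1 /=.
have tS := tauS N1.
have tp : 0 <= tau N.+1 by rewrite mulr_ge0 ?powR_ge0// ltW.
have lo : kmass N.+1 u <= 1 - tau N.+1.
  have := gb u; rewrite lexx huw => /(_ isT); rewrite ler_norml SE mu => /andP[_]; lra.
have hi : 1 + tau N.+1 <= kmass N.+1 w.
  have := gb w; rewrite lexx huw => /(_ isT); rewrite ler_norml SE mw => /andP[+ _]; lra.
have mm : kmass N.+1 u <= kmass N.+1 w by lra.
have [x xin mx] : exists2 c, c \in `[u, w] & kmass N.+1 c = 1 - tau N.+1.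
  apply: IVT => //; first exact: cH.
  by rewrite (min_idPl mm) (max_idPr mm); apply/andP; split; lra.
move: xin; rewrite in_itv /= => /andP[ux xw].
have mm2 : kmass N.+1 x <= kmass N.+1 w by lra.
have [y yin my] : exists2 c, c \in `[x, w] & kmass N.+1 c = 1 + tau N.+1.
  apply: IVT => //; first exact: cH.
  by rewrite (min_idPl mm2) (max_idPr mm2) mx; apply/andP; split; lra.
move: yin; rewrite in_itv /= => /andP[xy yw].
exists (x, y); split => //=; split => //=; try lra.
move=> z /andP[xz zy] j /andP[j1]; rewrite leq_eqVlt => /predU1P[->|jN]; last first.
  by apply: (Hz z); [apply/andP; split; lra|rewrite j1 -ltnS].
have h1 := mono x z ux xz ltac:(lra).
have h2 := mono z y ltac:(lra) zy yw.
by rewrite ler_norml; apply/andP; split; lra.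
Qed.

Lemma critical_point : exists2 z, 1 - b <= z <= 1 + b &
  forall j, (1 <= j)%N -> `|kmass j z - 1| <= b * j%:R `^ (- (theta - 1)).
Proof.
have /choice[F HF] : forall Np : nat * (R * R), exists q,
    (1 <= Np.1)%N -> inv Np.1 Np.2 -> [/\ Np.2.1 <= q.1, q.2 <= Np.2.2 & inv Np.1.+1 q].
  move=> [N p] /=; have [[N1 ip]|H] := pselect ((1 <= N)%N /\ inv N p).
    by have [q hq] := inv_step N1 ip; exists q.
  by exists p => N1 ip; case: H.
pose J := fix J n := if n is m.+1 then F (m.+1, J m) else (1 - b, 1 + b).
have m1 z : kmass 1 z = z by rewrite /kmass big_geq// addr0.
have tau1 : tau 1 = b by rewrite /tau powR1 mulr1.
have J0 : inv 1 (J 0%N).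
  split => //=; [by move: b0; lra| |by rewrite !m1 tau1].
  move=> z /andP[z1 z2] j; rewrite -eqn_leq => /eqP <-; rewrite m1 tau1 ler_norml.
  by apply/andP; split; lra.
have Jn n : inv n.+1 (J n).
  by elim: n => // n IH; have [_ _] := HF (n.+1, J n) isT IH.
have mono n m : (n <= m)%N -> (J n).1 <= (J m).1 /\ (J m).2 <= (J n).2.
  elim: m => [|m IH]; first by rewrite leqn0 => /eqP ->.
  rewrite leq_eqVlt => /predU1P[->//|nm].
  have [h1 h2] := IH nm; have [h3 h4 _] := HF (m.+1, J m) isT (Jn m).
  by split; [exact: le_trans h3|exact: le_trans h2].
have cross n m : (J n).1 <= (J m).2.
  have [h1 _] := mono n (maxn n m) (leq_maxl _ _).
  have [_ h2] := mono m (maxn n m) (leq_maxr _ _).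
  by have [_ h3 _ _ _] := Jn (maxn n m); apply: le_trans h1 (le_trans h3 h2).
pose z := sup (range (fun n => (J n).1)).
have zlo n : (J n).1 <= z.
  apply: ub_le_sup; last by exists n.
  by exists (J 0%N).2 => _ [m _ <-]; exact: cross.
have zhi n : z <= (J n).2.
  by apply: ge_sup; [exists (J 0%N).1, 0%N|move=> _ [m _ <-]; exact: cross].
exists z; first by have := zlo 0%N; have := zhi 0%N => /= -> ->.
move=> [//|j] _; have [_ _ _ H _] := Jn j.
by apply: (H z) => //; rewrite ?zlo ?zhi//= leqnn.
Qed.

End CriticalPoint.

(** * Closing the induction on time *)

Section Model.
Variables (R : realType) (d : nat).

Record walk (eta c1 CD L : R) (D : 'rV[int]_d -> R) : Prop := Walk {
  walk_ge0 : forall x, 0 <= D x;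
  walk_mass : Dhat D 0 = 1;
  walk_lap : lap_quot (Dhat D) t @[t --> 0^'+] --> - sigma2 D;
  walk_var : 0 < sigma2 D;
  walk_spread : forall x, D x <= CD * L `^ (- d%:R);
  walk_inner : forall k, cube k -> `|k| <= L^-1 -> c1 * L ^+ 2 * sqnorm k <= akD D k;
  walk_outer : forall k, cube k -> L^-1 <= `|k| -> eta <= akD D k;
  walk_upper : forall k, cube k -> akD D k <= 2 - eta }.

Record expansion (D : 'rV[int]_d -> R) (z : R) (f g e : nat -> 'rV[R]_d -> R) : Prop := Expansion {
  exp_rec : forall k, cube k -> f 0%N k = 1 /\
    forall n, f n.+1 k = \sum_(1 <= m < n.+2) g m k * f (n.+1 - m)%N k + e n.+1 k;
  exp_g1 : forall k, cube k -> g 1%N k = z * Dhat D k;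
  exp_e1 : forall k, cube k -> e 1%N k = 0;
  exp_fsym : forall n, cube_symmetric (f n);
  exp_fC2 : forall n, C2_near0 (f n);
  exp_gsym : forall n, (1 <= n)%N -> cube_symmetric (g n);
  exp_gC2 : forall n, (1 <= n)%N -> C2_near0 (g n) }.

(** One constant [b], which will be of the order of [beta], serves all the bounds
    and second derivatives are divided by the variance, so that [L] enters only
    through [b]. *)
Record regular (theta b : R) (D : 'rV[int]_d -> R) (g e : nat -> 'rV[R]_d -> R) (m : nat) : Prop := Regular {
  reg_g : forall k, cube k -> `|g m k| <= b * m%:R `^ (- theta);
  reg_e : forall k, cube k -> `|e m k| <= b * m%:R `^ (- theta);
  reg_de : forall k, cube k -> `|e m k - e m 0| <= b * akD D k * m%:R `^ (- (theta - 1));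
  reg_l : `|klap D g m| <= b * m%:R `^ (- (theta - 1));
  reg_dg : forall k, cube k ->
    `|g m k - g m 0 - akD D k * klap D g m| <= b * akD D k * m%:R `^ (- (theta - 1)) }.

Definition esrc (e : nat -> 'rV[R]_d -> R) k m : R := if m is 0 then 1 else e m k.

Lemma exp_conv D z f g e k : expansion D z f g e -> cube k ->
  (fun n => f n k) = conv (kern g k) (fun n => f n k) + esrc e k.
Proof. by move=> H kc; have [f0 fr] := exp_rec H kc; exact: renewal_recursion. Qed.

Lemma akD_ge0 eta c1 CD L D k : walk eta c1 CD L D -> 0 < eta -> 0 < c1 -> 1 <= L -> cube k ->
  0 <= akD D k.
Proof.
move=> W eta0 c10 L1 kc; have [h|h] := leP `|k| L^-1.
  apply: le_trans (walk_inner W kc h); have L0 : 0 <= L by lra.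
  rewrite !mulr_ge0 ?exprn_ge0// ?(ltW c10)//.
  by apply: sumr_ge0 => i _; exact: sqr_ge0.
by apply: le_trans (ltW eta0) (walk_outer W kc (ltW h)).
Qed.

Lemma akD0 D : Dhat D (0 : 'rV[R]_d) = 1 -> akD D (0 : 'rV[R]_d) = 0.
Proof. by rewrite /akD => ->; rewrite subrr. Qed.

Lemma Dhat_bounds (eta : R) D (k : 'rV[R]_d) : 0 < eta -> 0 <= akD D k -> akD D k <= 2 - eta ->
  0 <= akD D k <= 2 /\ `|Dhat D k| <= 1.
Proof. by rewrite ler_norml /akD => *; split; apply/andP; split; lra. Qed.

(** The bounds of [bounds_F] at time [N] follow from those on the kernel up to
    time [N], with a constant [K] that does not depend on the latter as long as
    they are small. This is what closes the induction on time. The pointwise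
    bound is used for [f] at every [k] and, at [k = 0], also for the resolvent,
    which expresses the second moments. *)
Lemma near_critical_bounds (theta eta c1 CD : R) :
  (0 < d)%N -> 2 < theta -> 0 < eta <= 1 -> 0 < c1 -> 0 < CD ->
  exists b1 K : R, [/\ 0 < b1, 1 < K &
  forall (L b z : R) (D : 'rV[int]_d -> R) (f g e : nat -> 'rV[R]_d -> R) (N : nat),
  1 <= L -> 0 <= b <= b1 -> walk eta c1 CD L D -> expansion D z f g e -> (1 <= N)%N ->
  (forall m, (2 <= m <= N)%N -> regular theta b D g e m) ->
  (forall j, (1 <= j <= N)%N ->
     `|\sum_(1 <= m < j.+1) kern g 0 m - 1| <= b * j%:R `^ (- (theta - 1))) ->
  [/\ forall p, 1 <= p -> (torus_norm p (fun k => (Dhat D k ^+ 2 * f N k)%R) <=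
         (K / (L `^ (d%:R / p) * N%:R `^ Num.min (d%:R / (2 * p)) theta))%:E)%E,
      `|f N 0| <= K & `|laplacian (f N) 0| <= K * sigma2 D * N%:R]].
Proof.
move=> d0 th2 /andP[eta0 eta1] c10 CD0.
pose M := (d + 2 + Num.bound theta)%N.
have M2 : (2 <= M)%N by rewrite /M; lia.
have dM : (d <= M)%N by rewrite /M; lia.
have thM : theta <= M%:R.
  apply: ltW; apply: (@lt_le_trans _ _ (Num.bound theta)%:R); first by apply: archi_boundP; lra.
  by rewrite ler_nat /M; lia.
have [b1 [C0 [b10 C00 HC0]]] := @kernel_pointwise R theta eta M th2 (introT andP (conj eta0 eta1)) M2.
have C00' := ltW C00; have CD0' : 0 <= 4 * CD by rewrite mulr_ge0// ltW.
have [Cl Cl0 HCl] := @lp_bound R d theta C0 c1 eta (4 * CD) M d0 th2 C00' c10 eta0 CD0' dM thM.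
pose Kc := 2 * C0 + 1.
have Kc0 : 0 <= Kc by rewrite /Kc; lra.
pose K1 := Kc * ((2 + (theta - 2)^-1) * Kc + 1).
have i0 : 0 < (theta - 2)^-1 by rewrite invr_gt0; lra.
have K10 : 0 <= K1.
  by rewrite /K1 mulr_ge0// addr_ge0// mulr_ge0//; move: i0; only_lra.
pose K := 2 + Cl + Kc + K1.
exists (Num.min b1 (1 / 2)), K; split; first by rewrite lt_min b10 divr_gt0.
  by rewrite /K; move: Cl0 Kc0 K10; only_lra.
move=> L b z D f g e N L1 /andP[b0]; rewrite le_min => /andP[bb1 b2] W X N1 Hreg Hcrit.
have a0 k : cube k -> 0 <= akD D k by exact: akD_ge0 W eta0 c10 L1.
have c0 : cube (0 : 'rV[R]_d) by exact: cube0.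
have D01 := walk_mass W.
have aD0 := akD0 D01.
have g1E k : cube k -> g 1%N k = z * (1 - akD D k).
  by move=> kc; rewrite (exp_g1 X kc) /akD; ring.
have g10 : g 1%N 0 = z by rewrite g1E// aD0 subr0 mulr1.
have bI : 0 <= b <= b1 by rewrite b0.
have ptw k n (E F : nat -> R) : cube k -> (1 <= n <= N)%N -> E 0%N = 1 ->
    (forall i, (1 <= i <= n)%N -> `|E i| <= b * i%:R `^ (- theta)) -> F = conv (kern g k) F + E ->
    `|F n| <= C0 * ((1 + akD D k * n%:R)^-1 ^+ M + n%:R `^ (- (theta - 2)) * (1 + akD D k * n%:R)^-1 ^+ 2).
  move=> kc /andP[n1 nN] E0 HE HF.
  apply: (HC0 b (akD D k) z n (kern g 0) (kern g k) (klap D g) E F) => //.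
  - by rewrite a0//= (walk_upper W kc).
  - exact: g1E.
  - move=> m /andP[m2 mn]; have [|rg _ _ rl rdg] := Hreg m; first by rewrite m2 (leq_trans mn).
    case: m m2 mn rg rl rdg => // m m2 mn rg rl rdg; split; [exact: rg|exact: rg|exact: rl|exact: rdg].
  - by apply: Hcrit; rewrite n1.
have e1b k : cube k -> forall i, (1 <= i <= N)%N -> `|esrc e k i| <= b * i%:R `^ (- theta).
  move=> kc [|[|i]]// iN; first by rewrite /= (exp_e1 X kc) normr0 mulr_ge0 ?powR_ge0.
  by have [_ re _ _ _] := Hreg i.+2 iN; exact: re.
have fptw k n : cube k -> (1 <= n <= N)%N ->
    `|f n k| <= C0 * ((1 + akD D k * n%:R)^-1 ^+ M + n%:R `^ (- (theta - 2)) * (1 + akD D k * n%:R)^-1 ^+ 2).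
  move=> kc nN; apply: (ptw k n (esrc e k) (fun n => f n k)) => //.
    move=> i /andP[i1 iN]; apply: e1b => //; rewrite i1 (leq_trans iN)//; by case/andP: nN.
  exact: exp_conv X kc.
have at0 n (x : R) : (1 <= n)%N ->
    x <= C0 * ((1 + akD D 0 * n%:R)^-1 ^+ M + n%:R `^ (- (theta - 2)) * (1 + akD D 0 * n%:R)^-1 ^+ 2) -> x <= Kc.
  move=> n1; rewrite aD0 mul0r addr0 invr1 !expr1n mulr1 => /le_trans; apply.
  have h : n%:R `^ (- (theta - 2)) <= 1 :> R by rewrite powR_nat_le1//; move: th2; only_lra.
  have := ler_wpM2l C00' h; rewrite /Kc; only_lra.
have f0b n : (n <= N)%N -> `|f n 0| <= Kc.
  case: n => [|n] nN; first by have [-> _] := exp_rec X c0; rewrite normr1 /Kc; move: C00; only_lra.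
  by apply: (@at0 n.+1) => //; apply: fptw.
have [phi Hphi] := @resolvent_exists R (kern g 0) erefl.
have phiE : phi = conv (kern g 0) phi + unit_seq.
  by rewrite -Hphi convBl conv_unit addrC subrK.
have phi0 : phi 0%N = 1.
  by rewrite phiE -[LHS]/(conv (kern g 0) phi 0 + 1) conv0 mul0r add0r.
have phib n : (n <= N)%N -> `|phi n| <= Kc.
  case: n => [|n] nN; first by rewrite phi0 normr1 /Kc; move: C00; only_lra.
  apply: (@at0 n.+1) => //; apply: (ptw 0 n.+1 unit_seq phi) => //.
  by move=> [|i]// _; rewrite /unit_seq /= normr0 mulr_ge0 ?powR_ge0.
have z2 : `|z| <= 2.
  have := Hcrit 1%N; rewrite N1 big_nat1 /= g10 powR1 mulr1 => /(_ isT) h.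
  rewrite -[z](subrK 1); apply: le_trans (ler_normD _ _) _; rewrite normr1; move: h b2; only_lra.
have bI' : 0 <= b <= 1 by rewrite b0 /=; move: b2; only_lra.
have DL := walk_lap W; have s20 := walk_var W.
split.
- move=> p p1.
  have CL0 : 0 < CD * L `^ (- d%:R) by rewrite mulr_gt0// powR_gt0//; move: L1; only_lra.
  have [G2 [mG2 G20 HG2 IG2]] := Dhat_sqr_majorant (walk_ge0 W) D01 CL0 (walk_spread W).
  apply: (@le_trans _ _ (Cl / (L `^ (d%:R / p) * N%:R `^ Num.min (d%:R / (2 * p)) theta))%:E).
    apply: (HCl L p N (akD D) (f N) (Dhat D) G2) => //.
    + move=> k kc; have [aU Dh1] := Dhat_bounds eta0 (a0 k kc) (walk_upper W kc); split => //.
      * exact: (walk_inner W kc).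
      * exact: (walk_outer W kc).
    + by move=> k kc; apply: fptw => //; rewrite N1 leqnn.
    + by rewrite mulrA in IG2.
  rewrite lee_fin ler_wpM2r ?invr_ge0 ?mulr_ge0 ?powR_ge0//.
  by rewrite /K; move: Kc0 K10; only_lra.
- by apply: le_trans (f0b N (leqnn N)) _; rewrite /K; move: Cl0 K10; only_lra.
have flapE := flap_renewal D f g.
have hren : flap D f = conv phi (conv (klap D g) (fun n => f n 0) + elap D f g).
  exact: renewal_unique Hphi (flap_renewal D f g).
have el0 : elap D f g 0 = 0 by apply: (elap0 D (exp_rec X) (exp_fsym X) (exp_fC2 X)).
have hb := @moment_bound R theta b z Kc N (klap D g) (elap D f g) (fun n => f n 0) (flap D f) phi
   th2 bI' z2 Kc0 erefl (klap1 (exp_g1 X) (exp_gsym X) (exp_gC2 X) DL s20) el0.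
have : `|flap D f N| <= K1 * N%:R.
  apply: hb => //.
  - by move=> m mm; have [_ _ _ rl _] := Hreg m mm.
  - move=> [//|[|m]] mN.
      rewrite powR1 mulr1; apply: (elap_bound (exp_rec X) (exp_fsym X) (exp_fC2 X) (exp_gsym X) (exp_gC2 X) D01 DL s20) => //.
      by move=> k kc; rewrite !(exp_e1 X)// subrr normr0 mulr_ge0// a0.
    apply: (elap_bound (exp_rec X) (exp_fsym X) (exp_fC2 X) (exp_gsym X) (exp_gC2 X) D01 DL s20).
      by rewrite mulr_ge0 ?powR_ge0.
    by move=> k kc; have [_ _ rde _ _] := Hreg m.+2 mN; rewrite mulrAC; exact: rde.
rewrite /flap normrM gtr0_norm ?invr_gt0// ler_pdivrMl// => h; apply: le_trans h _.
rewrite mulrCA mulrA ler_wpM2r// ler_wpM2r ?(ltW s20)//.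
by rewrite /K; move: Cl0 Kc0; only_lra.
Qed.

End Model.

(** * The critical point of the model *)

Section Assembly.
Variables (R : realType) (d : nat).

Lemma cube_flip i (k : 'rV[R]_d) : cube k -> cube (flip i k).
Proof.
rewrite /cube /= => /rV_norm_leP H; apply/rV_norm_leP; first exact: pi_ge0.
move=> j; rewrite mxE; case: ifP => _; rewrite ?normrN; apply: H; exact: pi_ge0.
Qed.

Lemma cube_perm (s : 'S_d) (k : 'rV[R]_d) : cube k -> cube (col_perm s k).
Proof.
rewrite /cube /= => /rV_norm_leP H; apply/rV_norm_leP; first exact: pi_ge0.
by move=> j; rewrite mxE; apply: H; exact: pi_ge0.
Qed.

Variables (theta eps pstar : R) (B : set R).
Variables (f g e : R -> nat -> 'rV[R]_d -> R -> R) (D : R -> 'rV[int]_d -> R).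
Hypotheses (Hrec : recursion f g e) (HS : assumption_S f g e) (HD : assumption_D theta eps f g e D).

Lemma first_terms L k z : 1 <= L -> cube k -> 0 < z ->
  [/\ f L 1%N k z = z * Dhat (D L) k, e L 1%N k z = 0 & g L 1%N k z = z * Dhat (D L) k].
Proof.
have [H _ _ _] := HD => L1 kc z0; have [_ /(_ k z kc z0)[h1 h2 h3]] := H L L1.
rewrite h2; move: h1 h3; rewrite /Dhat; case: (fourier (D L) k) => u w.
move=> /(congr1 (@complex.Re R)) /= -> /(congr1 (@complex.Re R)) /= ->.
by rewrite mul0r subr0.
Qed.

Lemma expansion_of L z : 1 <= L -> 0 < z ->
  expansion (D L) z (fun n k => f L n k z) (fun n k => g L n k z) (fun n k => e L n k z).
Proof.
move=> L1 z0; have [s1 s2 _ s4] := HS L1.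
split.
- by move=> k kc; exact: (Hrec L1 kc z0).
- by move=> k kc; have [] := first_terms L1 kc z0.
- by move=> k kc; have [] := first_terms L1 kc z0.
- by move=> n; exact: s1.
- by move=> n; have [] := s4 n z z0.
- by move=> n n1; have [] := s2 n z n1 z0.
- by move=> n n1; have [_ h] := s4 n z z0; exact: h.
Qed.

Lemma akD_symmetric L : 1 <= L -> cube_symmetric (akD (D L)).
Proof.
move=> L1 k kc; have [s1 _ _ _] := HS L1; have [h1 h2] := s1 1%N 1 ltr01 k kc.
have E k' : cube k' -> akD (D L) k' = 1 - f L 1%N k' 1.
  by move=> kc'; have [-> _ _] := first_terms L1 kc' ltr01; rewrite mul1r.
split=> [i|s]; first by rewrite !E ?h1//; exact: cube_flip.
by rewrite !E ?h2//; exact: cube_perm.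
Qed.

Lemma walk_of : (0 < d)%N -> exists eta c1 CD : R, [/\ 0 < eta <= 1, 0 < c1, 0 < CD &
  forall L, 1 <= L -> walk eta c1 CD L (D L)].
Proof.
move=> d0; have [H1 [_ H2] [C H3] [eta [c1 [c2 [eta0 c10 _ H4]]]]] := HD.
have m0 : 0 < Num.min eta 1 by rewrite lt_min eta0 ltr01.
exists (Num.min eta 1), c1, (Num.max C 1); split => //.
- by rewrite m0 ge_min lexx orbT.
- by rewrite lt_max ltr01 orbT.
move=> L L1; have [D0 _] := H1 L L1.
have D01 : Dhat (D L) 0 = 1 by have [h _] := H2 L L1; rewrite /Dhat h.
have L0 : 0 < L by lra.
have X := expansion_of L1 ltr01.
have DL : lap_quot (Dhat (D L)) t @[t --> 0^'+] --> - sigma2 (D L).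
  apply: lap_quot_Dhat (exp_fC2 X 1%N) (exp_fsym X 1%N) _ => k kc.
  by have [-> _ _] := first_terms L1 kc ltr01; rewrite mul1r.
have inner k : cube k -> `|k| <= L^-1 -> c1 * L ^+ 2 * sqnorm k <= akD (D L) k.
  by move=> kc kL; have [/(_ kL)/andP[]] := H4 L k L1 kc.
split => //.
- apply: (@sigma2_gt0 _ _ _ D01 DL L^-1 (c1 * L ^+ 2)) => //; first by rewrite invr_gt0.
  by rewrite mulr_gt0// exprn_gt0.
- move=> x; have [/(_ x) h _] := H3 L L1; apply: le_trans (ler_norm _) (le_trans h _).
  by rewrite ler_wpM2r ?powR_ge0// le_max lexx.
- move=> k kc kL; have [_ /(_ kL)/ltW h _] := H4 L k L1 kc; apply: le_trans h.
  by rewrite ge_min lexx.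
- move=> k kc; have [_ _ /ltW h] := H4 L k L1 kc; apply: le_trans h _.
  by rewrite lerB// ge_min lexx.
Qed.

(** The derivative in [z] serves to locate the critical point, the bounds with
    exponents [1 + t] serve the Gaussian limit. *)
Definition regular_at (b : R) L z (m : nat) : Prop :=
  [/\ regular theta b (D L) (fun n k => g L n k z) (fun n k => e L n k z) m,
      derivable (fun y => g L m 0 y) z 1,
      `|derive1 (fun y => g L m 0 y) z| <= b * m%:R `^ (- (theta - 1)) &
      forall t k, 0 <= t <= eps -> cube k ->
        `|g L m k z - g L m 0 z - akD (D L) k * klap (D L) (fun n k => g L n k z) m| <=
        b * akD (D L) k `^ (1 + t) * m%:R `^ (- theta + (1 + t))].

Lemma regular_of (K L z CE CG : R) (n : nat) (a0 : forall k, cube k -> 0 <= akD (D L) k) (s20 : 0 < sigma2 (D L)) :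
  0 < eps ->
  (forall k (m : nat), cube k -> (2 <= m <= n.+1)%N ->
        `|e L m k z| <= CE * beta d pstar L * m%:R `^ (- theta) /\
        `|e L m k z - e L m 0 z| <=
          CE * akD (D L) k * beta d pstar L * m%:R `^ (- theta + 1)) ->
  (forall k (m : nat), cube k -> (2 <= m <= n.+1)%N ->
        let s2 := sigma2 (D L) in
        let lap := laplacian (fun k' => g L m k' z) 0 in
        [/\ `|g L m k z| <= CG * beta d pstar L * m%:R `^ (- theta),
            `|lap| <= CG * s2 * beta d pstar L * m%:R `^ (- theta + 1),
            derivable (fun y => g L m 0 y) z 1,
            `|derive1 (fun y => g L m 0 y) z| <=
              CG * beta d pstar L * m%:R `^ (- theta + 1) &
            forall eps', 0 <= eps' <= eps ->
              `|g L m k z - g L m 0 z - akD (D L) k * s2^-1 * lap| <=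
                CG * beta d pstar L * akD (D L) k `^ (1 + eps') *
                m%:R `^ (- theta + (1 + eps'))]) ->
  forall m, (2 <= m <= n.+1)%N -> regular_at ((1 + `|CE| + `|CG|) * beta d pstar L) L z m.
Proof.
move=> eps0 hE hG m mn; set b := _ * _.
have be0 : 0 <= beta d pstar L by exact: powR_ge0.
have bE : CE * beta d pstar L <= b.
  by rewrite /b ler_wpM2r//; have := ler_norm CE; have := normr_ge0 CG; lra.
have bG : CG * beta d pstar L <= b.
  by rewrite /b ler_wpM2r//; have := ler_norm CG; have := normr_ge0 CE; lra.
have tE : - theta + 1 = - (theta - 1) by ring.
have c0 := cube0 R d.
have up (C y u : R) : C <= b -> 0 <= u -> y <= C * u -> y <= b * u.
  by move=> Cb u0 /le_trans; apply; rewrite ler_wpM2r.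
have kE : klap (D L) (fun n k => g L n k z) m = (sigma2 (D L))^-1 * laplacian (fun k' => g L m k' z) 0.
  by case: m mn => // m.
have full t k : 0 <= t <= eps -> cube k ->
        `|g L m k z - g L m 0 z - akD (D L) k * klap (D L) (fun n k => g L n k z) m| <=
        b * akD (D L) k `^ (1 + t) * m%:R `^ (- theta + (1 + t)).
  move=> tt kc; have [_ _ _ _ /(_ t tt) h] := hG k m kc mn.
  rewrite [X in `|_ - X|](_ : _ = akD (D L) k / sigma2 (D L) * laplacian (fun k' => g L m k' z) 0); last first.
    by rewrite kE mulrA.
  have u0 : 0 <= akD (D L) k `^ (1 + t) * m%:R `^ (- theta + (1 + t)) by rewrite mulr_ge0 ?powR_ge0.
  by rewrite -[leRHS]mulrA; apply: (up _ _ _ bG u0); rewrite [leRHS]mulrA.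
have [_ hl dG hdG _] := hG 0 m c0 mn.
split => //; last by rewrite tE in hdG; apply: up hdG => //; exact: powR_ge0.
split.
- by move=> k kc; have [h _ _ _ _] := hG k m kc mn; apply: up h => //; exact: powR_ge0.
- by move=> k kc; have [h _] := hE k m kc mn; apply: up h => //; exact: powR_ge0.
- move=> k kc; have [_ h] := hE k m kc mn; rewrite -mulrA -tE.
  by apply: (@up (CE * beta d pstar L)) => //; [rewrite mulr_ge0 ?powR_ge0 ?a0|rewrite mulrA (mulrAC CE)].
- rewrite kE normrM gtr0_norm ?invr_gt0// ler_pdivrMl// -tE.
  apply: le_trans hl _; rewrite (_ : CG * _ * _ * _ = CG * beta d pstar L * (sigma2 (D L) * m%:R `^ (- theta + 1))); last by ring.
  by rewrite [leRHS]mulrCA ler_wpM2r// mulr_ge0 ?powR_ge0// ltW.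
- move=> k kc; have := full 0 k; rewrite lexx (ltW eps0) => /(_ isT kc).
  by rewrite addr0 powRr1 ?a0// tE.
Qed.

(** The bounds on [f] up to time [N] give the regularity of the kernel up to time
    [N + 1], and this gives the bounds on [f] at time [N + 1]. *)
Lemma near_critical_regular (K b L z : R) (N : nat) :
  (forall (n : nat), (1 <= n)%N -> (forall m, (1 <= m <= n)%N -> bounds_F theta B f D K L z m) ->
     forall m, (2 <= m <= n.+1)%N -> regular_at b L z m) ->
  (forall (n : nat), (1 <= n)%N -> (forall m, (2 <= m <= n)%N -> regular_at b L z m) ->
     (forall j, (1 <= j <= n)%N ->
       `|kmass (fun m y => g L m 0 y) j z - 1| <= b * j%:R `^ (- (theta - 1))) ->
     bounds_F theta B f D K L z n) ->
  (forall j, (1 <= j <= N)%N ->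
    `|kmass (fun m y => g L m 0 y) j z - 1| <= b * j%:R `^ (- (theta - 1))) ->
  (forall m, (1 <= m <= N)%N -> bounds_F theta B f D K L z m) /\
  ((1 <= N)%N -> forall m, (2 <= m <= N.+1)%N -> regular_at b L z m).
Proof.
move=> Hr Hb; elim: N => [|N IH] Hk; first by split=> // m /andP[m1]; rewrite leqNgt m1.
have [|F1 R1] := IH.
  by move=> j /andP[j1 jN]; apply: Hk; rewrite j1 ltnW.
have F2 : forall m, (1 <= m <= N.+1)%N -> bounds_F theta B f D K L z m.
  move=> m /andP[m1]; rewrite leq_eqVlt => /predU1P[->|mN]; last by apply: F1; rewrite m1.
  apply: Hb => //; case: N R1 {IH Hk F1} => [|N] R1 m'; first by move=> /andP[m2 m3]; lia.
  exact: R1.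
by split=> // _; apply: Hr.
Qed.

Lemma kmass_kern L z j : 1 <= L -> 0 < z -> (1 <= j)%N ->
  \sum_(1 <= m < j.+1) kern (fun n k => g L n k z) 0 m = kmass (fun m y => g L m 0 y) j z.
Proof.
move=> L1 z0 j1; rewrite big_ltn// /kmass; congr (_ + _).
  have [_ _ /= ->] := first_terms L1 (cube0 R d) z0.
  have [_ [_ H2] _ _] := HD; have [h _] := H2 L L1.
  by rewrite /Dhat h /= mulr1.
by apply: eq_big_nat => -[|m].
Qed.

(** The critical point for one value of [L], together with all the bounds that
    hold there. The constant [K] of [bounds_F] is fixed before [L], so that [b],
    a multiple of [beta], can be made small by taking [L] large. *)
Lemma critical_expansion (b0 : R) : (0 < d)%N -> 2 < theta -> 1 <= pstar -> B `<=` `[1, pstar] ->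
  assumption_E theta pstar B f e D -> assumption_G theta eps pstar B f g D -> 0 < b0 ->
  exists L0 c K : R, [/\ 0 < L0, 0 < c, 0 < K & forall L, 1 <= L -> L0 <= L ->
    let b := c * beta d pstar L in b <= b0 /\
    exists z, [/\ 0 < z,
      forall m, (2 <= m)%N -> regular_at b L z m,
      forall j, (1 <= j)%N ->
        `|\sum_(1 <= m < j.+1) kern (fun n k => g L n k z) 0 m - 1| <= b * j%:R `^ (- (theta - 1)) &
      forall p n, 1 <= p -> (1 <= n)%N ->
        (torus_norm p (fun k => (Dhat (D L) k ^+ 2 * f L n k z)%R) <=
         (K / (L `^ (d%:R / p) * n%:R `^ Num.min (d%:R / (2 * p)) theta))%:E)%E]].
Proof.
move=> d0 th2 p1 Bp [LE [IE [Ce [[_ nE _] HE]]]] [LG [IG [Cg [[_ nG _] HG]]]] b00.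
have [eta [c1 [CD [etaI c10 CD0 W]]]] := walk_of d0.
have [b1 [K [b10 K1 HF]]] := near_critical_bounds d0 th2 etaI c10 CD0.
have [rE HrE] := nbhs_ex nE; have [rG HrG] := nbhs_ex nG.
have eps0 : 0 < eps by have [_ [/andP[]]] := HD.
have i0 : 0 < (theta - 2)^-1 by rewrite invr_gt0; lra.
pose r0 := Num.min rE%:num rG%:num.
have r00 : 0 < r0 by rewrite lt_min !gt0.
(* [r0 / 2] keeps [z] in both neighbourhoods of 1, [1 / 2] keeps it positive, and
   the last bound makes the mass increasing in [z]. *)
pose bm := Num.min (Num.min b0 b1) (Num.min (r0 / 2) (Num.min (1 / 2) ((theta - 2) / 2))).
have bm0 : 0 < bm by rewrite !lt_min b00 b10 !divr_gt0//; lra.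
pose c := 1 + `|Ce K| + `|Cg K|.
have c0 : 0 < c by rewrite /c ltr_wpDr// ltr_wpDr.
pose ex := d%:R / pstar.
have ex0 : 0 < ex by rewrite divr_gt0 ?ltr0n//; lra.
(* For [L >= Lb] the constant [c * beta] is at most [bm]. *)
pose Lb := (c / bm) `^ ex^-1.
have cb0 : 0 < c / bm by rewrite divr_gt0.
exists (1 + `|LE| + `|LG| + Lb), c, K; split => //.
- by rewrite -!addrA ltr_wpDr// !addr_ge0// powR_ge0.
- by lra.
move=> L L1 LL; set b := c * _.
have LbL : Lb <= L by have := normr_ge0 LE; have := normr_ge0 LG; move: LL; lra.
have LEL : LE <= L by have := ler_norm LE; have := normr_ge0 LG; have := powR_ge0 (c / bm) ex^-1; move: LL; rewrite /Lb; lra.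
have LGL : LG <= L by have := ler_norm LG; have := normr_ge0 LE; have := powR_ge0 (c / bm) ex^-1; move: LL; rewrite /Lb; lra.
have bbm : b <= bm.
  rewrite /b /beta -/ex powRN ler_pdivrMr ?powR_gt0//; last by lra.
  rewrite -ler_pdivrMl// mulrC.
  have h : Lb `^ ex <= L `^ ex by apply: ge0_ler_powR; rewrite ?nnegrE ?powR_ge0 ?(ltW ex0)//; lra.
  by apply: le_trans h; rewrite -powRrM mulVf ?gt_eqF// powRr1// ltW.
have bpos : 0 < b by rewrite mulr_gt0// powR_gt0//; lra.
move: (bbm); rewrite /bm !le_min => /andP[/andP[bb0 bb1] /andP[br /andP[bh bt]]].
split => //.
have s20 := walk_var (W L L1).
have a0 k : cube k -> 0 <= akD (D L) k.
  by apply: akD_ge0 (W L L1) _ c10 L1; case/andP: etaI.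
have zin z : 1 - b <= z <= 1 + b -> [/\ IE z, IG z & 0 < z].
  move=> /andP[zl zh].
  have zb : `|1 - z| <= b by rewrite distrC ler_distl; apply/andP.
  have zr : `|1 - z| < r0 by apply: le_lt_trans zb _; lra.
  move: zr; rewrite lt_min => /andP[zE zG]; split; [exact: HrE|exact: HrG|lra].
have Hr z : 1 - b <= z <= 1 + b -> forall n, (1 <= n)%N ->
    (forall m, (1 <= m <= n)%N -> bounds_F theta B f D K L z m) ->
    forall m, (2 <= m <= n.+1)%N -> regular_at b L z m.
  move=> zz n n1 HFn; have [zE zG z0] := zin z zz.
  apply: regular_of => //.
    exact: (HE K L z n K1 L1 LEL zE n1 HFn).
  exact: (HG K L z n K1 L1 LGL zG n1 HFn).
have Hb z : 1 - b <= z <= 1 + b -> forall n, (1 <= n)%N -> (forall m, (2 <= m <= n)%N -> regular_at b L z m) ->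
     (forall j, (1 <= j <= n)%N ->
       `|kmass (fun m y => g L m 0 y) j z - 1| <= b * j%:R `^ (- (theta - 1))) ->
     (forall p, 1 <= p -> (torus_norm p (fun k => (Dhat (D L) k ^+ 2 * f L n k z)%R) <=
         (K / (L `^ (d%:R / p) * n%:R `^ Num.min (d%:R / (2 * p)) theta))%:E)%E) /\
     bounds_F theta B f D K L z n.
  move=> zz n n1 HR HM; have [_ _ z0] := zin z zz.
  have [|||h1 h2 h3] := HF L b z (D L) _ _ _ n L1 _ (W L L1) (expansion_of L1 z0) n1.
    by rewrite ltW.
    by move=> m mn; have [] := HR m mn.
    by move=> j /andP[j1 jn]; rewrite kmass_kern//; apply: HM; rewrite j1.
  split => //; split => // p Bp'; apply: h1.
  by have := Bp p Bp'; rewrite /= in_itv /= => /andP[].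
have [z zz Hz] : exists2 z, 1 - b <= z <= 1 + b &
    forall j, (1 <= j)%N -> `|kmass (fun m y => g L m 0 y) j z - 1| <= b * j%:R `^ (- (theta - 1)).
  apply: critical_point => //.
    by rewrite ler_pdivrMr ?subr_gt0// mulrC mulrA mulr1.
  move=> N z zz N1 HN m mN.
  have [_ /(_ N1 m mN)[rg dG hdG _]] := @near_critical_regular K b L z N (Hr z zz)
    (fun n n1 h1 h2 => (Hb z zz n n1 h1 h2).2) HN.
  by split => //; apply: (reg_g rg); exact: cube0.
have [zE zG z0] := zin z zz.
have allreg m : (2 <= m)%N -> regular_at b L z m.
  move=> m2; have [_ h] := @near_critical_regular K b L z m (Hr z zz)
    (fun n n1 h1 h2 => (Hb z zz n n1 h1 h2).2) (fun j jm => Hz j ltac:(by case/andP: jm)).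
  by apply: h; rewrite ?m2 /=; nlia.
exists z; split => //.
- by move=> j j1; rewrite kmass_kern//; exact: Hz.
- move=> p n p1' n1; have [h _] := Hb z zz n n1 (fun m mn => allreg m ltac:(by case/andP: mn))
    (fun j jn => Hz j ltac:(by case/andP: jn)).
  exact: h.
Qed.

End Assembly.

(** * The Gaussian limit *)

Section GaussianTilt.
Variable R : realType.

Lemma nat_powR_unbounded (x s : R) : 0 < s -> exists n0 : nat, (1 <= n0)%N /\
  forall n : nat, (n0 <= n)%N -> x <= n%:R `^ s.
Proof.
move=> s0; pose y := Num.max x 1.
have y0 : 0 < y by rewrite lt_max ltr01 orbT.
exists (Num.bound (y `^ s^-1)).+1; split => // n nn.
have h : y `^ s^-1 <= n%:R.
  apply: ltW; apply: (lt_le_trans (archi_boundP (powR_ge0 _ _))).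
  by rewrite ler_nat ltnW.
apply: (@le_trans _ _ y); first by rewrite le_max lexx.
apply: (@le_trans _ _ ((y `^ s^-1) `^ s)).
  by rewrite -powRrM mulVf ?gt_eqF// powRr1// ltW.
by apply: ge0_ler_powR; rewrite ?nnegrE ?powR_ge0//; exact: ltW.
Qed.

Lemma log_ratio_powR (gam t delta : R) : 0 <= gam -> 0 < delta < t -> forall n a, (1 <= n)%N ->
  0 <= a <= gam * n%:R^-1 * ln n%:R ->
  a `^ t <= (gam * (1 - delta / t)^-1) `^ t * n%:R `^ (- delta).
Proof.
move=> g0 /andP[d0 dt] n a n1 /andP[a0 an].
have t0 : 0 < t by lra.
pose tau := 1 - delta / t.
have tau0 : 0 < tau by rewrite subr_gt0 ltr_pdivrMr// mul1r.
have n0 : 0 < n%:R :> R by rewrite ltr0n.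
have h : a <= gam * tau^-1 * n%:R `^ (tau - 1).
  apply: le_trans an _; rewrite -!mulrA ler_wpM2l//.
  rewrite mulrC; apply: le_trans (ler_wpM2r _ (ln_le_powR tau0 n1)) _; first by rewrite invr_ge0 ltW.
  rewrite -mulrA ler_wpM2l ?invr_ge0 ?(ltW tau0)//.
  by rewrite (@powRB _ _ tau 1) ?(gt_eqF n0) ?implybT// powRr1// ltW.
have gt0 : 0 <= gam * tau^-1 by rewrite mulr_ge0// invr_ge0 ltW.
apply: (@le_trans _ _ ((gam * tau^-1 * n%:R `^ (tau - 1)) `^ t)).
  by apply: ge0_ler_powR; rewrite ?nnegrE ?(ltW t0)// mulr_ge0 ?powR_ge0.
rewrite powRM ?powR_ge0// -powRrM (_ : (tau - 1) * t = - delta)//.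
by rewrite /tau; field; rewrite gt_eqF.
Qed.

(** Since [a] is at most of order [ln n / n] and [t > delta], [a `^ t] is at most
    of order [n `^ (- delta)]. This turns the error in [tilt_kernel] into one
    that [tilt_close] admits, and makes the smallness condition of the latter
    hold from some [n0] on. *)
Lemma gaussian_tilt (theta t delta gam v B K Kf : R) (g l e f phi : nat -> R) :
  2 < theta -> 0 < delta < t -> t <= 1 -> 0 < gam -> 0 < v <= 2 -> 1 < theta - 1 - t - v * gam ->
  0 <= B -> 0 <= K -> 0 <= Kf ->
  conv (unit_seq - g) phi = unit_seq -> f = conv g f + e -> g 0%N = 0 -> e 0%N = 1 ->
  (forall n, \sum_(i < n.+1) `|dif phi i| <= K) -> (forall n, `|phi n| <= K) ->
  (forall n, \sum_(i < n.+1) `|dif f i| <= Kf) ->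
  (forall m, (1 <= m)%N -> `|g m| <= B * m%:R `^ (- theta)) ->
  (forall m, (1 <= m)%N -> `|l m| <= B * m%:R `^ (- (theta - 1))) ->
  (forall m, (1 <= m)%N -> `|e m| <= B * m%:R `^ (- theta)) ->
  (forall j, (1 <= j)%N ->
     `|\sum_(1 <= m < j.+1) (l m + v * (m%:R * g m))| <= B * j%:R `^ (- (theta - 2))) ->
  exists (n0 : nat) (C : R), [/\ (1 <= n0)%N, 0 <= C & forall (n : nat) (a : R) (G E F : nat -> R),
    (n0 <= n)%N -> 0 <= a <= gam * n%:R^-1 * ln n%:R -> G 0%N = 0 -> E 0%N = 1 -> F = conv G F + E ->
    (forall m, (1 <= m)%N ->
       `|G m - g m - a * l m| <= B * a `^ (1 + t) * m%:R `^ (- theta + (1 + t))) ->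
    (forall m, (1 <= m)%N -> `|E m - e m| <= B * a * m%:R `^ (- (theta - 1))) ->
    `|F n * expR (v * a) ^+ n - f n| <= C * (a * n%:R `^ (1 - delta))].
Proof.
move=> th2 /andP[d0 dt] t1 g0 /andP[v0 v2] tw B0 K0 Kf0 Hphi Hf gz ez Hdp Hp Hdf Hg Hl He Hv.
pose w := v * gam.
have w0 : 0 <= w by rewrite mulr_ge0// ltW.
have tw' : 1 < theta - 1 - t - w by exact: tw.
pose E0 := expR w.
have E01 : 1 <= E0 by rewrite -expR0 ler_expR.
have t0 : 0 < t by lra.
have d1 : 0 < delta < 1 by apply/andP; split; lra.
pose cg := (gam * (1 - delta / t)^-1) `^ t.
have cg0 : 0 <= cg by exact: powR_ge0.
pose X := 7 * B * E0 * (1 + (theta - 1 - t - w - 1)^-1).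
have X0 : 0 <= X.
  rewrite /X !mulr_ge0//; first by lra.
  by rewrite addr_ge0// invr_ge0; rewrite /w; lra.
pose B' := X * cg + B + 3 * B * E0.
have BE0 : 0 <= 3 * B * E0 by rewrite !mulr_ge0//; lra.
have Xcg0 : 0 <= X * cg by exact: mulr_ge0.
have B'0 : 0 <= B' by rewrite !addr_ge0.
pose Q := 2 * K * B' * (1 + 2 / (1 - delta)).
have p0 : 0 <= 1 + 2 / (1 - delta) by rewrite addr_ge0// divr_ge0//; lra.
have Q0 : 0 <= Q by rewrite !mulr_ge0.
have d20 : 0 < delta / 2 by lra.
have [n0 [n01 Hn0]] := nat_powR_unbounded (Q * (gam * (delta / 2)^-1)) d20.
pose s := theta - 1 - w.
have s1 : 1 < s by rewrite /s /w; move: tw t0; only_lra.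
have si0 : 0 <= 1 + (s - 1)^-1 by rewrite addr_ge0// invr_ge0; move: s1; only_lra.
exists n0, (K * B' * ((1 + 2 / (1 - delta)) * (2 * Kf + (1 + (s - 1)^-1)) + (1 + (s - 1)^-1))); split => //.
  have h1 : 0 <= 2 * Kf + (1 + (s - 1)^-1) by apply: addr_ge0 => //; exact: mulr_ge0.
  by apply: mulr_ge0; [exact: mulr_ge0|apply: addr_ge0 => //; exact: mulr_ge0].
move=> n a G E F nn aI Gz Ez HF HG HE.
have n1 : (1 <= n)%N by exact: leq_trans nn.
have n0p : 0 < n%:R :> R by rewrite ltr0n.
have [a0 an] := andP aI.
have gro m : (1 <= m <= n)%N -> expR (v * a) ^+ m <= E0 * m%:R `^ w.
  by move=> mn; exact: (tilt_growth (ltW g0) (ltW v0) mn an).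
have v0' : 0 < v <= 2 by rewrite v0.
have t0' : 0 < t <= 1 by rewrite t0.
have ker := @tilt_kernel R theta t w v a B E0 g l G e E n t0' w0 v0' a0 B0 E01 tw gro Hg Hl HG Hv He HE.
have ad : a `^ t <= cg * n%:R `^ (- delta) by apply: log_ratio_powR; rewrite ?(ltW g0)// d0.
apply: (@tilt_close R (expR (v * a)) g phi f e G F E K Kf B' a s delta n) => //.
- by rewrite ez.
- move=> j jn; have [h _] := ker j jn; apply: le_trans h _.
  have [j1 jn'] := andP jn; have jp : 0 < j%:R :> R by rewrite ltr0n.
  have nj : n%:R `^ (- delta) <= j%:R `^ (- delta) :> R by apply: powR_nat_anti => //; exact: ltW.
  have tj : j%:R `^ (- (theta - 2)) <= j%:R `^ (- delta) :> R by rewrite ler_powR ?ler1n//; move: tw' w0 dt; only_lra.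
  have aE : a `^ (1 + t) <= a * (cg * j%:R `^ (- delta)).
    have [->|an0] := eqVneq a 0; first by rewrite powR0 ?mul0r// gt_eqF//; move: t0; only_lra.
    rewrite powRD ?an0 ?implybT// powRr1// ler_wpM2l//; apply: le_trans ad _.
    by rewrite ler_wpM2l.
  have h1 := ler_wpM2l X0 aE.
  have h2 : B * a * j%:R `^ (- (theta - 2)) <= B * a * j%:R `^ (- delta) by rewrite ler_wpM2l// mulr_ge0.
  have h3 : 0 <= 3 * B * E0 * (a * j%:R `^ (- delta)) by rewrite mulr_ge0// mulr_ge0// powR_ge0.
  rewrite -/X; apply: le_trans (lerD h1 h2) _.
  rewrite (_ : B' * a * _ = X * (a * (cg * j%:R `^ (- delta))) + B * a * j%:R `^ (- delta) +
     3 * B * E0 * (a * j%:R `^ (- delta))); last by rewrite /B'; ring.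
  by rewrite lerDl.
- move=> j jn; have [_ h] := ker j jn; apply: le_trans h _.
  rewrite -/s ler_wpM2r ?powR_ge0// ler_wpM2r// /B' lerDr.
  exact: addr_ge0.
- have h : a * n%:R `^ (1 - delta) <= gam * (delta / 2)^-1 * n%:R `^ (- (delta / 2)).
    apply: (@le_trans _ _ (gam * n%:R^-1 * ((delta / 2)^-1 * n%:R `^ (delta / 2)) * n%:R `^ (1 - delta))).
      rewrite ler_wpM2r ?powR_ge0//; apply: le_trans an _.
      rewrite ler_wpM2l ?ln_le_powR// mulr_ge0 ?invr_ge0//; exact: ltW.
    rewrite -powR_inv1 ?(ltW n0p)//.
    rewrite (_ : gam * _ * (_ * _) * _ = gam * (delta / 2)^-1 *
      (n%:R `^ (-1) * n%:R `^ (delta / 2) * n%:R `^ (1 - delta))); last by ring.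
    rewrite -!powRD ?(gt_eqF n0p) ?implybT// (_ : -1 + _ + _ = - (delta / 2))//; by field.
  rewrite -/Q; apply: le_trans (ler_wpM2l Q0 h) _.
  rewrite mulrA; apply: le_trans (ler_wpM2r _ (Hn0 n nn)) _; first exact: powR_ge0.
  by rewrite -powRD ?(gt_eqF n0p) ?implybT// subrr powRr0.
Qed.

End GaussianTilt.

Lemma expR_sub1_norm_le (R : realType) (y : R) : `|expR y - 1| <= `|y| * expR `|y|.
Proof.
have [y0|y0] := leP 0 y.
  have := @expR_sub1_le R y 1 y0; rewrite ltr01 lexx powRr1// => /(_ isT).
  by rewrite (ger0_norm y0) ger0_norm// subr_ge0 -expR0 ler_expR.
have h := expR_ge1Dx y; have h2 : expR y <= 1 by rewrite -expR0 ler_expR ltW.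
rewrite ler0_norm ?subr_le0// ltr0_norm// (@le_trans _ _ (- y))//; first by lra.
by rewrite ler_peMr ?oppr_ge0 ?(ltW y0)// -expR0 ler_expR oppr_ge0 ltW.
Qed.

(** The tilted sequence converges to the amplitude; [expR (v a n)] is then
    replaced by the Gaussian, at the cost of the deviation of [a] from its
    quadratic part. *)
Lemma gaussian_replace (R : realType) (delta gamma e1 Cq C1 c S dd K3 sM : R) :
  0 < delta < e1 -> 0 < gamma -> 0 <= Cq -> 0 <= C1 -> 0 < c -> 0 < S -> 0 < dd -> 0 <= K3 -> 0 <= sM ->
  exists2 C : R, 0 <= C & forall (n : nat) (v A a s F f0 y0 : R), (1 <= n)%N ->
    1 / 2 <= v <= 2 -> 1 / 2 <= A <= 2 -> 0 <= a -> a <= gamma * n%:R^-1 * ln n%:R ->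
    0 <= s <= sM -> c * s <= a -> `|a - S / dd * s| <= Cq * s `^ (1 + e1) ->
    `|F * expR (v * a) ^+ n - f0| <= C1 * (a * n%:R `^ (1 - delta)) ->
    `|f0 - A| <= K3 * y0 -> 0 <= y0 <= 1 ->
    exists r1 r2 : R, [/\ `|r1| <= C * (v * S * n%:R * s * n%:R `^ (- delta)), `|r2| <= C * y0 &
      F = A * expR (- (v * S * n%:R * s / dd)) * (1 + r1 + r2)].
Proof.
move=> /andP[d0 de] g0 Cq0 C10 cL0 S0 dd0 K30 sM0.
have e10 : 0 < e1 by lra.
pose Ca := S / dd + Cq * sM `^ e1.
have Ca0 : 0 <= Ca by rewrite addr_ge0 ?mulr_ge0 ?powR_ge0// ?invr_ge0 ltW.
pose Z := (gamma * (1 - delta / e1)^-1) `^ e1.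
have Z0 : 0 <= Z by exact: powR_ge0.
pose X0 := 2 * Cq * (c^-1 `^ e1 * Z).
have X00 : 0 <= X0 by rewrite !mulr_ge0// powR_ge0.
pose X1 := X0 * (c^-1 * gamma * delta^-1).
have X10 : 0 <= X1.
  by rewrite mulr_ge0// mulr_ge0 ?mulr_ge0 ?invr_ge0// ltW.
pose R1 := 2 * K3.
have R10 : 0 <= R1 by rewrite mulr_ge0.
have EX0 : 0 <= expR X1 by exact: expR_ge0.
pose Y := X0 * expR X1 * (1 + R1) + expR X1 * 2 * (C1 * Ca).
have R11 : 0 <= 1 + R1 by exact: addr_ge0.
have CCa : 0 <= C1 * Ca by exact: mulr_ge0.
have Y0 : 0 <= Y.
  by apply: addr_ge0; apply: mulr_ge0 => //; exact: mulr_ge0.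
pose C2 := 2 / S * Y.
have C20 : 0 <= C2 by rewrite mulr_ge0// divr_ge0// ltW.
exists (C2 + R1); first by rewrite addr_ge0.
move=> n v A a s F f0 y0 n1 /andP[v1 v2] /andP[A1 A2] aa an /andP[ss sM1] Hin hq HT f1 /andP[y00 y01].
have np : 0 < n%:R :> R by rewrite ltr0n.
have v0 : 0 < v by apply: lt_le_trans v1; rewrite divr_gt0.
have v21 : 1 <= 2 * v by move: v1; rewrite ler_pdivrMr// mulrC.
have A0 : 0 < A by apply: lt_le_trans A1; rewrite divr_gt0.
have iA : A^-1 <= 2 by rewrite -[leRHS]invrK lef_pV2 ?posrE ?invr_gt0//; rewrite -div1r.
have iA0 : 0 <= A^-1 by rewrite invr_ge0 ltW.
have sa : s <= c^-1 * a by rewrite ler_pdivlMl.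
have s1e : s `^ (1 + e1) = s * s `^ e1.
  have [->|sn] := eqVneq s 0; first by rewrite powR0 ?mul0r// gt_eqF// addr_gt0.
  by rewrite powRD ?sn ?implybT// powRr1.
rewrite s1e in hq.
have ale : a <= Ca * s.
  have h : s `^ e1 <= sM `^ e1 by apply: ge0_ler_powR; rewrite ?nnegrE ?(ltW e10).
  have h2 : Cq * (s * s `^ e1) <= Cq * sM `^ e1 * s.
    by rewrite -mulrA ler_wpM2l// mulrC ler_wpM2r.
  by move: hq; rewrite ler_distl => /andP[_ hq]; rewrite /Ca mulrDl; apply: le_trans hq _; rewrite lerD2l.
pose nd : R := n%:R `^ (- delta).
have nd0 : 0 < nd by rewrite powR_gt0.
have aI : 0 <= a <= gamma * n%:R^-1 * ln n%:R by rewrite aa.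
have dI : 0 < delta < e1 by rewrite d0.
have ade : a `^ e1 <= Z * nd by exact: (log_ratio_powR (ltW g0) dI n1 aI).
have se : s `^ e1 <= c^-1 `^ e1 * (Z * nd).
  apply: (@le_trans _ _ ((c^-1 * a) `^ e1)).
    by apply: ge0_ler_powR; rewrite ?nnegrE ?(ltW e10)// mulr_ge0// invr_ge0 ltW.
  by rewrite powRM ?invr_ge0 ?(ltW cL0)// ler_wpM2l ?powR_ge0.
pose w := n%:R * s * nd.
have w0 : 0 <= w by rewrite mulr_ge0 ?mulr_ge0// ltW.
pose x := v * a * n%:R - v * S * n%:R * s / dd.
have xb : `|x| <= X0 * w.
  rewrite /x (_ : _ - _ = v * n%:R * (a - S / dd * s)); last by field; rewrite gt_eqF.
  have vn0 : 0 <= v * n%:R by rewrite mulr_ge0// ltW.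
  rewrite normrM (ger0_norm vn0); apply: le_trans (ler_wpM2l vn0 hq) _.
  rewrite (_ : X0 * w = 2 * n%:R * (Cq * (s * (c^-1 `^ e1 * (Z * nd))))); last by rewrite /X0 /w; ring.
  have cs0 : 0 <= Cq * (s * s `^ e1) by rewrite mulr_ge0// mulr_ge0// powR_ge0.
  apply: ler_pM => //; first by rewrite ler_wpM2r// ltW.
  by rewrite ler_wpM2l// ler_wpM2l.
have wb : w <= c^-1 * gamma * delta^-1.
  have hl := ln_le_powR d0 n1.
  have h : n%:R * s <= c^-1 * gamma * delta^-1 * n%:R `^ delta.
    apply: (@le_trans _ _ (n%:R * (c^-1 * (gamma * n%:R^-1 * (delta^-1 * n%:R `^ delta))))).
      rewrite ler_wpM2l ?(ltW np)//; apply: le_trans sa _; rewrite ler_wpM2l ?invr_ge0 ?(ltW cL0)//.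
      apply: le_trans an _; rewrite ler_wpM2l// mulr_ge0 ?invr_ge0//; exact: ltW.
    by rewrite le_eqVlt; apply/orP; left; apply/eqP; field; rewrite !gt_eqF.
  rewrite /w; apply: le_trans (ler_wpM2r (ltW nd0) h) _.
  have ndE : n%:R `^ delta * nd = 1 by rewrite /nd -powRD ?(gt_eqF np) ?implybT// subrr powRr0.
  by rewrite -(mulrA _ _ nd) ndE mulr1.
have xX1 : `|x| <= X1 by apply: le_trans xb _; rewrite ler_wpM2l.
pose u := expR (- x) - 1.
have ub : `|u| <= X0 * w * expR X1.
  rewrite /u; apply: le_trans (expR_sub1_norm_le _) _; rewrite normrN.
  by apply: ler_pM => //; rewrite ?expR_ge0// ler_expR.
have eb : `|1 + u| <= expR X1.
  rewrite /u addrC subrK ger0_norm ?expR_ge0// ler_expR; apply: le_trans xX1.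
  by rewrite -normrN ler_norm.
pose y := F * expR (v * a) ^+ n - f0.
have yb : `|y| <= C1 * Ca * w.
  apply: le_trans HT _; rewrite -mulrA ler_wpM2l//.
  have -> : n%:R `^ (1 - delta) = n%:R * nd :> R.
    by rewrite powRD ?(gt_eqF np) ?implybT// powRr1// ltW.
  rewrite /w (_ : Ca * _ = Ca * s * (n%:R * nd)); last by ring.
  by rewrite ler_wpM2r// mulr_ge0// ltW.
pose r := (f0 - A) / A.
have rb : `|r| <= R1 * y0.
  rewrite /r normrM normfV (gtr0_norm A0) mulrC /R1 -mulrA.
  by apply: ler_pM.
have rb1 : `|1 + r| <= 1 + R1.
  apply: le_trans (ler_normD _ _) _; rewrite normr1 lerD2l; apply: le_trans rb _.
  by rewrite ler_piMr.
exists (u * (1 + r) + (1 + u) * (y / A)), r; split.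
- have : `|u * (1 + r) + (1 + u) * (y / A)| <= Y * w.
    apply: le_trans (ler_normD _ _) _; rewrite !normrM normfV (gtr0_norm A0).
    rewrite (_ : Y * w = X0 * w * expR X1 * (1 + R1) + expR X1 * (C1 * Ca * w * 2)); last by rewrite /Y; ring.
    by apply: lerD; apply: ler_pM => //; rewrite ?mulr_ge0//; apply: ler_pM.
  move/le_trans; apply.
  apply: (@le_trans _ _ (C2 * (v * S * n%:R * s * nd))).
    rewrite (_ : C2 * _ = 2 * v * (Y * w)); last by rewrite /C2 /w; field; rewrite gt_eqF.
    by rewrite ler_peMl// mulr_ge0.
  rewrite ler_wpM2r ?lerDl// mulr_ge0 ?(ltW nd0)// mulr_ge0// mulr_ge0 ?(ltW np)//.
  by rewrite mulr_ge0// ltW.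
- by apply: le_trans rb _; rewrite ler_wpM2r// lerDr.
have E0 : expR (v * a) ^+ n * expR (- (v * S * n%:R * s / dd)) * expR (- x) = 1.
  rewrite -expRM_natl -!expRD (_ : _ + _ + _ = 0) ?expR0//.
  by rewrite /x; field; rewrite gt_eqF.
have -> : 1 + (u * (1 + r) + (1 + u) * (y / A)) + r = expR (- x) * ((f0 + y) / A).
  by rewrite /u /r; field; rewrite gt_eqF.
have -> : f0 + y = F * expR (v * a) ^+ n by rewrite /y addrC subrK.
transitivity (F * (expR (v * a) ^+ n * expR (- (v * S * n%:R * s / dd)) * expR (- x))).
  by rewrite E0 mulr1.
by field; rewrite gt_eqF.
Qed.

Section AtCritical.
Variables (R : realType) (d : nat) (theta b z eta c1 CD L : R) (D : 'rV[int]_d -> R).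
Variables (f g e : nat -> 'rV[R]_d -> R).
Hypotheses (th2 : 2 < theta) (b0 : 0 <= b) (small : 100 * b * ctail theta ^+ 4 <= 1).
Hypotheses (eta0 : 0 < eta) (c10 : 0 < c1) (L1 : 1 <= L) (W : walk eta c1 CD L D) (X : expansion D z f g e).
Hypotheses (Hreg : forall m, (2 <= m)%N -> regular theta b D g e m)
  (Hcrit : forall j, (1 <= j)%N ->
     `|\sum_(1 <= m < j.+1) kern g 0 m - 1| <= b * j%:R `^ (- (theta - 1))).

Definition kernel_mean : R := sum1 (fun m => m%:R * g m 0).
Definition amplitude : R := (1 + sum1 (fun m => e m 0)) / kernel_mean.
Definition diffusivity : R := - (sum1 (fun m => laplacian (g m) 0) / (sigma2 D * kernel_mean)).

Let g0 m := g m 0.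
Let l m := (sigma2 D)^-1 * laplacian (g m) 0.
Let e0 m := e m 0.
Let c0 : cube (0 : 'rV[R]_d). Proof. exact: cube0. Qed.
Let s20 : 0 < sigma2 D. Proof. exact: walk_var W. Qed.

Let klapE m : (1 <= m)%N -> klap D g m = l m.
Proof. by case: m. Qed.

Let g1 : g0 1%N = z.
Proof. by rewrite /g0 (exp_g1 X)// (walk_mass W) mulr1. Qed.

Let l1 : l 1%N = - z.
Proof.
by rewrite -klapE// (klap1 (exp_g1 X) (exp_gsym X) (exp_gC2 X) (walk_lap W) s20).
Qed.

Let Hg m : (2 <= m)%N -> `|g0 m| <= b * m%:R `^ (- theta).
Proof. by move=> m2; apply: (reg_g (Hreg m2)). Qed.

Let Hgm m : (2 <= m)%N -> `|m%:R * g0 m| <= b * m%:R `^ (- (theta - 1)).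
Proof.
move=> m2; have m0 : 0 < m%:R :> R by rewrite ltr0n ltnW.
rewrite normrM normr_nat (_ : - (theta - 1) = 1 - theta); last by ring.
rewrite powRD ?(gt_eqF m0) ?implybT// powRr1 ?(ltW m0)// mulrCA ler_wpM2l ?(ltW m0)//.
exact: Hg.
Qed.

Let Hl m : (2 <= m)%N -> `|l m| <= b * m%:R `^ (- (theta - 1)).
Proof. by move=> m2; rewrite -klapE 1?ltnW//; exact: (reg_l (Hreg m2)). Qed.

Let He m : (1 <= m)%N -> `|e0 m| <= b * m%:R `^ (- theta).
Proof.
case: m => [|[|m]]// _; last by apply: (reg_e (@Hreg m.+2 _)).
by rewrite /e0 (exp_e1 X)// normr0 mulr_ge0 ?powR_ge0.
Qed.

Let a0 k : cube k -> 0 <= akD D k.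
Proof. exact: (akD_ge0 W eta0 c10 L1). Qed.

Let Heh m : (1 <= m)%N -> `|elap D f g m| <= b * m%:R `^ (- (theta - 1)).
Proof.
case: m => [|m]// _.
apply: (elap_bound (exp_rec X) (exp_fsym X) (exp_fC2 X) (exp_gsym X) (exp_gC2 X) (walk_mass W) (walk_lap W) s20).
  by rewrite mulr_ge0 ?powR_ge0.
case: m => [|m] k kc.
  by rewrite !(exp_e1 X)// subrr normr0 !mulr_ge0 ?powR_ge0// a0.
by rewrite mulrAC; exact: (reg_de (@Hreg m.+2 _)).
Qed.

Let Ht n : (1 <= n)%N -> `|ktail g0 n| <= b * n%:R `^ (- (theta - 1)).
Proof.
move=> n1; rewrite /ktail distrC (_ : \sum_(1 <= m < n.+1) g0 m = \sum_(1 <= m < n.+1) kern g 0 m); first exact: Hcrit.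
by apply: eq_big_nat => -[|m].
Qed.

Let phi := projT1 (cid (@resolvent_exists R (kern g 0) erefl)).

Let Hphi : conv (unit_seq - (fun m => if m is 0 then 0 else g0 m)) phi = unit_seq.
Proof. exact: projT2 (cid (@resolvent_exists R (kern g 0) erefl)). Qed.

Let Hf : (fun n => f n 0) = conv (fun m => if m is 0 then 0 else g0 m) (fun n => f n 0) +
  (fun m => if m is 0 then 1 else e0 m).
Proof. exact: exp_conv X c0. Qed.

Let Hh : flap D f = conv (fun m => if m is 0 then 0 else g0 m) (flap D f) +
  (conv (fun m => if m is 0 then 0 else l m) (fun n => f n 0) + (fun m => if m is 0 then 0 else elap D f g m)).
Proof.
rewrite {1}(flap_renewal D f g); congr (_ + (_ + _)); apply/funext => -[|m] //.
exact: (elap0 D (exp_rec X) (exp_fsym X) (exp_fC2 X)).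
Qed.

Lemma sum1Z (c : R) (u : nat -> R) : summable1 u ->
  summable1 (fun m => c * u m) /\ sum1 (fun m => c * u m) = c * sum1 u.
Proof.
move=> su; have E : psum1 (fun m => c * u m) = fun N => c * psum1 u N.
  by apply/funext => N; rewrite /psum1 mulr_sumr.
have h : psum1 (fun m => c * u m) n @[n --> \oo] --> c * sum1 u.
  by rewrite E; apply: cvgM => //; exact: cvg_cst.
by split; [apply/cvg_ex; eexists; exact: h|apply/cvg_lim].
Qed.

Lemma norm_powR_eq0 (x C s : R) : 0 <= C -> 0 < s ->
  (forall n, (1 <= n)%N -> `|x| <= C * n%:R `^ (- s)) -> x = 0.
Proof.
move=> C0 sp H; apply/eqP; rewrite -normr_eq0 eq_le normr_ge0 andbT leNgt; apply/negP => x0.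
have [n0 [n1 Hn]] := nat_powR_unbounded ((C + 1) / `|x|) sp.
have h := Hn n0 (leqnn _); have np : 0 < n0%:R `^ s :> R by rewrite powR_gt0// ltr0n.
have := H n0 n1; rewrite powRN ler_pdivlMr//; apply/negP; rewrite -ltNge.
by move: h; rewrite ler_pdivrMr// mulrC; apply: lt_le_trans; rewrite ltrDl.
Qed.

Let lsumE : summable1 (fun m => laplacian (g m) 0) /\ sum1 l = (sigma2 D)^-1 * sum1 (fun m => laplacian (g m) 0).
Proof.
have t1 : 1 < theta - 1 by move: th2; lra.
have [sl _] := sum1_tail t1 b0 Hl.
have [sL _] := sum1Z (sigma2 D) sl.
have E : (fun m => sigma2 D * l m) = fun m => laplacian (g m) 0.
  by apply/funext => m; rewrite /l mulrA mulfV ?gt_eqF// mul1r.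
rewrite E in sL; split => //.
by have [_ <-] := sum1Z (sigma2 D)^-1 sL.
Qed.

Let diffE : diffusivity = - (sum1 l / kernel_mean).
Proof. by have [_ ->] := lsumE; rewrite /diffusivity invfM; ring. Qed.

Lemma amplitude_bounds : 1 / 2 <= amplitude <= 2.
Proof. exact: (critical_amplitude_bounds th2 b0 small Hg He Ht). Qed.

Lemma diffusivity_bounds : 1 / 2 <= diffusivity <= 2.
Proof. rewrite diffE; exact: (critical_diffusivity_bounds th2 b0 small g1 l1 Hg Hl Ht). Qed.

Lemma diffusivity_near1 : `|diffusivity - 1| <= 6 * b * ctail theta.
Proof. rewrite diffE; exact: (critical_diffusivity_near1 th2 b0 small g1 l1 Hg Hl Ht). Qed.

Lemma critical_sums : [/\ summable1 (fun m => g m 0), summable1 (fun m => e m 0),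
   summable1 (fun m => laplacian (g m) 0), summable1 (fun m => m%:R * g m 0) &
   1 = sum1 (fun m => g m 0)].
Proof.
have t1 : 1 < theta by move: th2; lra.
have [sg tg] := sum1_tail t1 b0 Hg.
have [se _] := sum1_tail t1 b0 (fun m m2 => He (ltnW m2)).
have [sl _] := lsumE.
have t2 : 1 < theta - 1 by move: th2; lra.
have [sm _] := sum1_tail t2 b0 Hgm.
split => //; apply/eqP; rewrite eq_sym -subr_eq0; apply/eqP.
have t3 : 0 < theta - 1 by lra.
have i0 : 0 <= (theta - 1)^-1 by rewrite invr_ge0 ltW.
apply: (@norm_powR_eq0 _ (b * (theta - 1)^-1 + b) (theta - 1)) => //.
  by rewrite addr_ge0// mulr_ge0.
move=> n n1; rewrite mulrDl -/g0.
rewrite (_ : _ - 1 = (sum1 g0 - \sum_(1 <= m < n.+1) g0 m) - ktail g0 n); last by rewrite /ktail; ring.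
apply: le_trans (ler_normB _ _) _; apply: lerD; [exact: tg|exact: Ht].
Qed.

Lemma second_moment_ratio delta n : 0 < delta < 1 -> delta < theta - 2 -> (1 <= n)%N ->
  exists2 r : R, `|r| <= (8 * 36 * ctail theta ^+ 4 * (2 + 2 / (1 - delta)) + 20 * ctail theta ^+ 3) * b * n%:R `^ (- delta) &
  - laplacian (f n) 0 / f n 0 = diffusivity * sigma2 D * n%:R * (1 + r).
Proof.
move=> d01 dth n1.
have [r hr E] := critical_ratio th2 b0 small g1 l1 Hg Hl He Heh Ht Hphi Hf Hh d01 dth n1.
exists r => //; rewrite diffE -[LHS]mulr1 -[X in _ * X](mulfV (lt0r_neq0 s20)).
transitivity (sigma2 D * (- flap D f n / f n 0)); first by rewrite /flap; ring.
by rewrite E; ring.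
Qed.

(** The bound is not uniform in [n]; it serves the finitely many times before the
    asymptotic estimates apply. *)
Lemma expansion_bounded n : exists2 C : R, 0 <= C & forall m k, (m <= n)%N -> cube k -> `|f m k| <= C.
Proof.
elim: n => [|n [C C0 IH]].
  exists 1 => // m k; rewrite leqn0 => /eqP -> kc.
  by have [-> _] := exp_rec X kc; rewrite normr1.
have gb m k : (1 <= m)%N -> cube k -> `|g m k| <= 3 * `|z| + b.
  move=> m1 kc; case: m m1 => [|[|m]]// _.
    rewrite (exp_g1 X kc) normrM; apply: (@le_trans _ _ (`|z| * 3)); last by rewrite mulrC lerDl.
    rewrite ler_wpM2l//; have := a0 kc; have := walk_upper W kc; rewrite /akD ler_norml => ? ?.
    by apply/andP; split; move: eta0; lra.
  apply: le_trans (reg_g (@Hreg m.+2 _) kc) _ => //.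
  apply: (@le_trans _ _ b); last by rewrite lerDr mulr_ge0.
  by rewrite ler_piMr// powR_nat_le1//; move: th2; lra.
have eb m k : (1 <= m)%N -> cube k -> `|e m k| <= b.
  move=> m1 kc; case: m m1 => [|[|m]]// _; first by rewrite (exp_e1 X kc) normr0.
  apply: le_trans (reg_e (@Hreg m.+2 _) kc) _ => //.
  by rewrite ler_piMr// powR_nat_le1//; move: th2; lra.
have M0 : 0 <= 3 * `|z| + b by rewrite addr_ge0// mulr_ge0.
exists (C + ((3 * `|z| + b) * C *+ n.+1 + b)).
  by rewrite !addr_ge0// mulrn_wge0// mulr_ge0.
move=> m k; rewrite leq_eqVlt => /predU1P[-> kc|mn kc]; last first.
  apply: le_trans (IH m k mn kc) _; rewrite lerDl addr_ge0// mulrn_wge0// mulr_ge0//.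
have [_ ->] := exp_rec X kc; apply: le_trans (ler_normD _ _) _.
apply: le_trans (lerD (ler_norm_sum _ _ _) (eb n.+1 k isT kc)) _.
apply: (@le_trans _ _ (\sum_(1 <= i < n.+2) (3 * `|z| + b) * C + b)).
  rewrite lerD2r; apply: ler_sum_nat => i /andP[i1 i2]; rewrite normrM.
  apply: ler_pM => //; first exact: gb.
  by apply: IH => //; nlia.
by rewrite sumr_const_nat subn1 /= lerDr.
Qed.

Variable eps : R.
Hypotheses (eps0 : 0 < eps) (veps : 6 * b * ctail theta <= theta - 2 - eps).
Hypothesis Hdg : forall m t k, (2 <= m)%N -> 0 <= t <= eps -> cube k ->
  `|g m k - g m 0 - akD D k * klap D g m| <= b * akD D k `^ (1 + t) * m%:R `^ (- theta + (1 + t)).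

Let v := diffusivity.
Let A := amplitude.

Lemma tilted_expansion gamma delta : 0 < gamma < Num.min 1 eps -> 0 < delta < Num.min 1 eps - gamma ->
  exists (n0 : nat) (C : R), [/\ (1 <= n0)%N, 0 <= C & forall n k, (n0 <= n)%N -> cube k ->
    akD D k <= gamma * n%:R^-1 * ln n%:R ->
    `|f n k * expR (v * akD D k) ^+ n - f n 0| <= C * (akD D k * n%:R `^ (1 - delta))].
Proof.
move=> /andP[g0' gm] /andP[d0 dm].
have m1 : Num.min 1 eps <= 1 by rewrite ge_min lexx.
have me : Num.min 1 eps <= eps by rewrite ge_min lexx orbT.
have /andP[v1 v2] : 1 / 2 <= v <= 2 by exact: diffusivity_bounds.
have vg : v * gamma <= gamma + (theta - 2 - eps).
  have : v - 1 <= theta - 2 - eps.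
    by apply: le_trans (ler_norm _) (le_trans diffusivity_near1 veps).
  have he : 0 <= theta - 2 - eps.
    apply: le_trans veps; rewrite mulr_ge0 ?mulr_ge0//.
    by have [_ _ h] := ctail_bounds th2; lra.
  move=> h; have h2 : (v - 1) * gamma <= (theta - 2 - eps) * 1.
    apply: (@le_trans _ _ ((theta - 2 - eps) * gamma)); first by rewrite ler_wpM2r// ltW.
    by rewrite ler_wpM2l//; lra.
  lra.
(* The exponent [t] is to exceed [delta], for the rate, and to stay below
   [theta - 2 - v * gamma], so that the tilted kernel is summable after a loss
   of [t]. There is room for it because [v] is close to 1. *)
pose mm := Num.min (Num.min 1 eps) (theta - 2 - v * gamma).
have dmm : delta < mm by rewrite lt_min; apply/andP; split; lra.
pose t := (delta + mm) / 2.
have mm1 : mm <= Num.min 1 eps by rewrite ge_min lexx.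
have mm2 : mm <= theta - 2 - v * gamma by rewrite ge_min lexx orbT.
have dt : 0 < delta < t by rewrite d0 /t /=; lra.
have tmm : t < mm by rewrite /t; lra.
have t1 : t <= 1 by lra.
have te : 0 <= t <= eps by apply/andP; split; lra.
pose K := ctail theta.
have [_ iK K4] := ctail_bounds th2.
have K0 : 0 <= K by rewrite /K; lra.
have i0 : 0 < (theta - 2)^-1 by rewrite invr_gt0; move: th2; lra.
pose B := b + `|z| + 3 * b * (theta - 2)^-1.
have bi0 : 0 <= 3 * b * (theta - 2)^-1 by rewrite mulr_ge0 ?mulr_ge0// ltW.
have bB : b <= B by rewrite /B -addrA lerDl addr_ge0.
have zB : `|z| <= B by move: b0 bi0; rewrite /B; lra.
have B0 : 0 <= B by move: b0 bB; lra.
pose Kf := K * (1 + b * (1 + (theta - 1)^-1)).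
have j0 : 0 < (theta - 1)^-1 by rewrite invr_gt0; move: th2; lra.
have Kf0 : 0 <= Kf by rewrite mulr_ge0// addr_ge0// mulr_ge0// addr_ge0// ltW.
have dsum := critical_increment_sum th2 b0 small Ht Hphi.
have HgB m : (1 <= m)%N -> `|kern g 0 m| <= B * m%:R `^ (- theta).
  case: m => [|[|m]]// _; first by rewrite powR1 mulr1 -[kern _ _ _]/(g0 1) g1.
  by apply: le_trans (@Hg m.+2 _) _ => //; rewrite ler_wpM2r ?powR_ge0.
have HlB m : (1 <= m)%N -> `|l m| <= B * m%:R `^ (- (theta - 1)).
  case: m => [|[|m]]// _; first by rewrite powR1 mulr1 l1 normrN.
  by apply: le_trans (@Hl m.+2 _) _ => //; rewrite ler_wpM2r ?powR_ge0.
have HeB m : (1 <= m)%N -> `|esrc e 0 m| <= B * m%:R `^ (- theta).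
  case: m => [|m]// _.
  by apply: le_trans (@He m.+1 _) _ => //; rewrite ler_wpM2r ?powR_ge0.
have th1 : 1 < theta - 1 by move: th2; lra.
have [_ tl] := sum1_tail th1 b0 Hl.
have [_ tm] := sum1_tail th1 b0 Hgm.
have mu0 : kernel_mean != 0.
  have /andP[+ _] := @mean_bounds R theta b g0 th2 b0 small Hg Ht; rewrite -/kernel_mean => h.
  by rewrite gt_eqF// (lt_le_trans _ h)// divr_gt0.
have HvB j : (1 <= j)%N ->
    `|\sum_(1 <= m < j.+1) (l m + v * (m%:R * kern g 0 m))| <= B * j%:R `^ (- (theta - 2)).
  move=> j1; have jE : theta - 1 - 1 = theta - 2 by ring.
  have -> : \sum_(1 <= m < j.+1) (l m + v * (m%:R * kern g 0 m)) =
     - (sum1 l - \sum_(1 <= m < j.+1) l m) - v * (kernel_mean - \sum_(1 <= m < j.+1) m%:R * g0 m).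
    have E : \sum_(1 <= m < j.+1) v * (m%:R * kern g 0 m) = v * \sum_(1 <= m < j.+1) m%:R * g0 m.
      by rewrite mulr_sumr; apply: eq_big_nat => -[|m].
    rewrite big_split /= E.
    have : sum1 l = - (v * kernel_mean) by rewrite /v diffE mulNr divfK ?opprK.
    by move=> ->; ring.
  apply: le_trans (ler_normB _ _) _; rewrite normrN normrM ger0_norm; last by lra.
  have h1 := tl j j1; have h2 := tm j j1; rewrite jE in h1 h2.
  have h3 : v * `|kernel_mean - \sum_(1 <= m < j.+1) m%:R * g0 m| <= 2 * (b * (theta - 2)^-1 * j%:R `^ (- (theta - 2))).
    by apply: ler_pM => //; lra.
  apply: le_trans (lerD h1 h3) _.
  rewrite (_ : _ + _ = 3 * b * (theta - 2)^-1 * j%:R `^ (- (theta - 2))); last by ring.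
  by rewrite ler_wpM2r ?powR_ge0// /B lerDr addr_ge0.
have Hdf n : \sum_(i < n.+1) `|dif (fun n => f n 0) i| <= Kf.
  have fE : (fun n => f n 0) = conv phi (fun m => if m is 0 then 1 else e0 m) by exact: renewal_unique Hphi Hf.
  rewrite fE dif_conv; apply: le_trans (sum_conv_le _ _ _) _.
  apply: ler_pM => //; [exact: sumr_ge0|exact: sumr_ge0|].
  rewrite big_ord_recl /= normr1 lerD2l.
  rewrite -(big_mkord xpredT (fun i => `|e0 i.+1|)).
  rewrite (_ : \sum_(0 <= i < n) `|e0 i.+1| = \sum_(1 <= i < n.+1) `|e0 i|); last by rewrite big_add1.
  apply: (@le_trans _ _ (\sum_(1 <= i < n.+1) b * i%:R `^ (- theta))).
    by apply: ler_sum_nat => i /andP[i1 _]; exact: He.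
  by rewrite -mulr_sumr ler_wpM2l// sum_powR_le// (lt_trans _ th2)// ltr1n.
have v0' : 0 < v <= 2 by rewrite v2 andbT; apply: lt_le_trans v1; rewrite divr_gt0.
have tw : 1 < theta - 1 - t - v * gamma by lra.
have [n0 [C [n01 C0 H]]] := @gaussian_tilt R theta t delta gamma v B K Kf (kern g 0) l (esrc e 0) (fun n => f n 0) phi
  th2 dt t1 g0' v0' tw B0 K0 Kf0 Hphi Hf erefl erefl dsum (critical_bounded th2 b0 small Ht Hphi) Hdf
  HgB HlB HeB HvB.
exists n0, C; split => // n k nn kc an.
have ak0 := a0 kc.
apply: (H n (akD D k) (kern g k) (esrc e k) (fun n => f n k)) => //.
- by rewrite ak0.
- exact: exp_conv X kc.
- move=> [|[|m]]// _.
    rewrite l1 /= (exp_g1 X kc) -/(g0 1) g1 (_ : _ - _ - _ = 0) ?normr0 ?mulr_ge0 ?powR_ge0//.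
    by rewrite /akD; ring.
  rewrite -klapE//; apply: le_trans (@Hdg m.+2 t k _ te kc) _ => //.
  by rewrite -!mulrA ler_wpM2r// mulr_ge0 ?powR_ge0.
- move=> [|[|m]]// _.
    by rewrite /= !(exp_e1 X)// subrr normr0 !mulr_ge0 ?powR_ge0.
  apply: le_trans (reg_de (@Hreg m.+2 _) kc) _ => //.
  by rewrite -!mulrA ler_wpM2r// mulr_ge0 ?powR_ge0.
Qed.

Variable Cq : R.
Hypotheses (Cq0 : 0 <= Cq) (Hq : forall k, cube k ->
  `|akD D k - sigma2 D / (2 * d%:R) * sqnorm k| <= Cq * sqnorm k `^ (1 + Num.min 1 eps)).

Lemma sqnorm_cube_le (k : 'rV[R]_d) : cube k -> 0 <= sqnorm k <= d%:R * pi ^+ 2.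
Proof.
move=> kc; apply/andP; split; first by apply: sumr_ge0 => i _; exact: sqr_ge0.
rewrite mulr_natl -[d in leRHS]card_ord -sumr_const; apply: ler_sum => i _.
rewrite -real_normK ?num_real// lerXn2r ?nnegrE ?pi_ge0//.
by move/rV_norm_leP: kc; apply; exact: pi_ge0.
Qed.

(** [gamma * ln n / n] is eventually below [eta], which puts [k] into the ball
    where [a] is comparable to the square of [k]. *)
Lemma small_inner gamma : 0 < gamma -> exists n0 : nat, (1 <= n0)%N /\ forall n k, (n0 <= n)%N -> cube k ->
  akD D k <= gamma * n%:R^-1 * ln n%:R -> c1 * L ^+ 2 * sqnorm k <= akD D k.
Proof.
move=> g0'; have h2 : 0 < 1 / 2 :> R by rewrite divr_gt0.
have [n0 [n01 H]] := nat_powR_unbounded (2 * gamma / eta + 1) h2.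
exists n0.+1; split => // n k nn kc an.
have n1 : (1 <= n)%N by exact: leq_trans nn.
have np : 0 < n%:R :> R by rewrite ltr0n.
apply: (walk_inner W kc); rewrite leNgt; apply/negP => /ltW kL.
have ae := walk_outer W kc kL.
have := ln_le_powR h2 n1; rewrite invf_div divr1 => hl.
have := H n (ltnW nn); set y := n%:R `^ (1 / 2) in hl * => hy.
have y2 : y * y = n%:R.
  by rewrite /y -powRD ?(gt_eqF np) ?implybT// -splitr powRr1// ltW.
have yp : 0 < y by rewrite powR_gt0.
have : eta <= gamma * 2 / y.
  apply: le_trans ae (le_trans an _); rewrite -y2 invfM.
  rewrite (_ : gamma * 2 / y = gamma * (y^-1 * y^-1) * (2 * y)); last by field; rewrite gt_eqF.
  rewrite y2 ler_wpM2l//; apply: mulr_ge0; first exact: ltW.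
  by apply: mulr_ge0; rewrite invr_ge0 ltW.
rewrite ler_pdivlMr// => h; have : 2 * gamma / eta + 1 <= 2 * gamma / eta.
  apply: le_trans hy _; by rewrite ler_pdivlMr// mulrC (mulrC 2).
by rewrite gerDl ler10.
Qed.

Let fA n : (1 <= n)%N -> `|f n 0 - A| <= 5 * ctail theta ^+ 3 * b * n%:R `^ (- (theta - 2)).
Proof. exact: (critical_f_rate th2 b0 small Hg He Ht Hphi Hf). Qed.

Lemma gaussian_limit gamma delta : (0 < d)%N ->
  0 < gamma < Num.min 1 eps -> 0 < delta < Num.min 1 eps - gamma ->
  exists2 C : R, 0 <= C & forall n k, (1 <= n)%N -> cube k ->
    akD D k <= gamma * n%:R^-1 * ln n%:R -> exists r1 r2 : R,
    [/\ `|r1| <= C * (v * sigma2 D * n%:R * sqnorm k * n%:R `^ (- delta)),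
        `|r2| <= C * n%:R `^ (- (theta - 2)) &
        f n k = A * expR (- (v * sigma2 D * n%:R * sqnorm k / (2 * d%:R))) * (1 + r1 + r2)].
Proof.
move=> dp gI dI; have /andP[g0' gm] := gI; have /andP[d0 dm] := dI.
have [n1 [C1 [n11 C10 H1]]] := tilted_expansion gI dI.
have [n2 [n21 H2]] := small_inner g0'.
have vI : 1 / 2 <= v <= 2 by exact: diffusivity_bounds.
have AI : 1 / 2 <= A <= 2 by exact: amplitude_bounds.
have e1d : 0 < delta < Num.min 1 eps by rewrite d0 /=; move: dm g0'; lra.
have cL0 : 0 < c1 * L ^+ 2.
  by rewrite mulr_gt0// exprn_gt0//; apply: lt_le_trans L1.
have K30 : 0 <= 5 * ctail theta ^+ 3 * b.
  rewrite mulr_ge0// mulr_ge0// exprn_ge0//.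
  by have [_ _ h] := ctail_bounds th2; apply: le_trans h.
have dd0 : 0 < 2 * d%:R :> R by rewrite mulr_gt0// ltr0n.
have sM0 : 0 <= d%:R * pi ^+ 2 :> R by rewrite mulr_ge0// sqr_ge0.
have [Cg Cg0 HG] := gaussian_replace e1d g0' Cq0 C10 cL0 s20 dd0 K30 sM0.
(* Before time [N] the whole deviation is put into [r2], since [n ^ (2 - theta)]
   is bounded below there. *)
pose N := maxn n1 n2.
have [Cf Cf0 Hfb] := expansion_bounded N.
pose Qm := 2 * sigma2 D * N%:R * (d%:R * pi ^+ 2) / (2 * d%:R).
pose Cs := (2 * Cf * expR Qm + 1) * N%:R `^ (theta - 2).
have Cs0 : 0 <= Cs by rewrite mulr_ge0 ?powR_ge0// addr_ge0// mulr_ge0 ?expR_ge0// mulr_ge0.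
exists (Cg + Cs); first exact: addr_ge0.
move=> n k n1' kc an; have np : 0 < n%:R :> R by rewrite ltr0n.
have /andP[ss sM1] := sqnorm_cube_le kc.
have [v1 v2] := andP vI; have [A1 A2] := andP AI.
have v0 : 0 < v by apply: lt_le_trans v1; rewrite divr_gt0.
have A0 : 0 < A by apply: lt_le_trans A1; rewrite divr_gt0.
have t20 : 0 <= theta - 2 by rewrite subr_ge0 ltW.
have q0 : 0 <= v * sigma2 D * n%:R * sqnorm k.
  by apply: mulr_ge0 => //; apply: mulr_ge0 => //; apply: mulr_ge0; exact: ltW.
have [nN|Nn] := leqP N n.
  have [nn1 nn2] : (n1 <= n)%N /\ (n2 <= n)%N by move: nN; rewrite /N geq_max => /andP[].
  have y1 : 0 <= (n%:R `^ (- (theta - 2)) : R) <= 1 by rewrite powR_ge0 /= powR_nat_le1.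
  have sI : 0 <= sqnorm k <= d%:R * pi ^+ 2 by rewrite ss.
  have [r1 [r2 [h1 h2 h3]]] := HG n v A (akD D k) (sqnorm k) (f n k) (f n 0) _ n1' vI AI (a0 kc) an
    sI (H2 n k nn2 kc an) (Hq kc) (H1 n k nn1 kc an) (fA n1') y1.
  exists r1, r2; split => //; [apply: le_trans h1 _|apply: le_trans h2 _].
    by rewrite ler_wpM2r ?lerDl// mulr_ge0 ?powR_ge0.
  by rewrite ler_wpM2r ?lerDl// powR_ge0.
pose q := v * sigma2 D * n%:R * sqnorm k / (2 * d%:R).
have qQ : q <= Qm.
  rewrite /q /Qm ler_wpM2r ?invr_ge0 ?(ltW dd0)//.
  have h1 : v * sigma2 D <= 2 * sigma2 D by rewrite ler_wpM2r// ltW.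
  have h2 : n%:R <= N%:R :> R by rewrite ler_nat ltnW.
  have vs0 : 0 <= v * sigma2 D by apply: mulr_ge0; exact: ltW.
  have vn0 : 0 <= v * sigma2 D * n%:R by apply: mulr_ge0 => //; exact: ltW.
  apply: ler_pM => //; apply: ler_pM => //; exact: ltW.
have den0 : A * expR (- q) != 0 by rewrite mulf_neq0 ?gt_eqF// expR_gt0.
exists 0, (f n k / (A * expR (- q)) - 1); split.
- by rewrite normr0 mulr_ge0 ?addr_ge0// mulr_ge0// powR_ge0.
- have fb := Hfb n k (ltnW Nn) kc.
  have h1 : `|f n k / (A * expR (- q)) - 1| <= 2 * Cf * expR Qm + 1.
    apply: le_trans (ler_normB _ _) _; rewrite normr1 lerD2r normrM normfV.
    have Aq0 : 0 <= A * expR (- q) by apply: mulr_ge0; [exact: ltW|exact: expR_ge0].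
    rewrite (ger0_norm Aq0).
    rewrite invfM -expRN opprK mulrA; apply: ler_pM; rewrite ?expR_ge0//.
    - by rewrite mulr_ge0// invr_ge0 ltW.
    - rewrite mulrC; apply: ler_pM => //; first by rewrite invr_ge0 ltW.
      by rewrite -[leRHS]invrK lef_pV2 ?posrE ?invr_gt0//; rewrite -div1r.
    - by rewrite ler_expR.
  apply: le_trans h1 _.
  apply: (@le_trans _ _ (Cs * n%:R `^ (- (theta - 2)))); last by rewrite ler_wpM2r ?powR_ge0// lerDr.
  rewrite /Cs -[leRHS]mulrA ler_peMr//; first by rewrite addr_ge0// mulr_ge0 ?expR_ge0// mulr_ge0.
  rewrite powRN ler_pdivlMr ?powR_gt0// mul1r; apply: ge0_ler_powR; rewrite ?nnegrE//.
  by rewrite ler_nat ltnW.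
- by rewrite addr0 addrC subrK -/q mulrCA mulfV// mulr1.
Qed.

End AtCritical.

Lemma sqnormZ (R : realType) d (c : R) (k : 'rV[R]_d) : sqnorm (c *: k) = c ^+ 2 * sqnorm k.
Proof. by rewrite /sqnorm mulr_sumr; apply: eq_bigr => i _; rewrite mxE exprMn. Qed.

Theorem theorem2p1 (R : realType) (d : nat) (dc theta eps pstar : R)
    (B : set R) (f g e : R -> nat -> 'rV[R]_d -> R -> R)
    (D : R -> 'rV[int]_d -> R)
    (d_gt0 : (0 < d)%N) (d_gt_dc : dc < d%:R) (theta_gt2 : 2 < theta)
    (pstar_ge1 : 1 <= pstar) (B_neq0 : B !=set0)
    (B_sub : B `<=` `[1, pstar])
    (Hrec : recursion f g e)
    (HS : assumption_S f g e)
    (HD : assumption_D theta eps f g e D)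
    (HE : assumption_E theta pstar B f e D)
    (HG : assumption_G theta eps pstar B f g D) :
  exists (L0 : R) (zc A v : R -> R),
    [/\ 0 < L0,
        forall L, 1 <= L -> L0 <= L -> [/\ 0 < zc L, 0 < A L & 0 < v L] &
    [/\ (* (a) *)
        forall L gamma delta, 1 <= L -> L0 <= L ->
          0 < gamma < Num.min 1 eps ->
          0 < delta < Num.min 1 eps - gamma ->
          exists C : R, forall (n : nat) (k : 'rV[R]_d), (1 <= n)%N ->
            let k' := (Num.sqrt (v L * sigma2 (D L) * n%:R))^-1 *: k in
            cube k' -> akD (D L) k' <= gamma * n%:R^-1 * ln n%:R ->
            exists r1 r2 : R,
              [/\ `|r1| <= C * (sqnorm k * n%:R `^ (- delta)),
                  `|r2| <= C * n%:R `^ (- theta + 2) &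
                  f L n k' (zc L) =
                    A L * expR (- (sqnorm k / (2 * d%:R))) * (1 + r1 + r2)],
        (* (b) *)
        forall gamma delta,
          0 < gamma < Num.min 1 eps ->
          0 < delta < Num.min 1 eps - gamma ->
          exists C : R, forall L (n : nat), 1 <= L -> L0 <= L -> (1 <= n)%N ->
            exists2 r : R, `|r| <= C * (beta d pstar L * n%:R `^ (- delta)) &
              - laplacian (fun k => f L n k (zc L)) 0 / f L n 0 (zc L) =
                v L * sigma2 (D L) * n%:R * (1 + r),
        (* (c) *)
        forall p : R, 1 <= p ->
          exists C : R, forall L (n : nat), 1 <= L -> L0 <= L -> (1 <= n)%N ->
            (torus_norm p (fun k => (Dhat (D L) k ^+ 2 * f L n k (zc L))%R) <=
             (C / (L `^ (d%:R / p) *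
                   n%:R `^ Num.min (d%:R / (2 * p)) theta))%:E)%E &
        (* (d) *)
        forall L, 1 <= L -> L0 <= L ->
          let g0 m := g L m 0 (zc L) in
          let e0 m := e L m 0 (zc L) in
          let lap0 m := laplacian (fun k => g L m k (zc L)) 0 in
          [/\ [/\ summable1 g0, summable1 e0, summable1 lap0 &
                  summable1 (fun m => m%:R * g0 m)],
              1 = sum1 g0,
              A L = (1 + sum1 e0) / sum1 (fun m => m%:R * g0 m) &
              v L = - (sum1 lap0 /
                       (sigma2 (D L) * sum1 (fun m => m%:R * g0 m)))]]].
Proof.
have [_ [/andP[eps0 epsth] HF] _ _] := HD.
pose K := ctail theta.
have K0 : 0 < K by have [_ _ h] := ctail_bounds theta_gt2; apply: lt_le_trans h.
(* The first bound makes the estimates at the critical point available, the second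
   one keeps [v - 1] below [theta - 2 - eps]. *)
pose b0 := Num.min (100 * K ^+ 4)^-1 ((theta - 2 - eps) / (6 * K)).
have b00 : 0 < b0.
  rewrite lt_min invr_gt0 mulr_gt0 ?exprn_gt0//= divr_gt0 ?mulr_gt0//.
  by rewrite subr_gt0.
have [L0 [c [Kc [L00 c0 Kc0 HL]]]] :=
  critical_expansion Hrec HS HD d_gt0 theta_gt2 pstar_ge1 B_sub HE HG b00.
have [eta [c1 [CD [/andP[eta0 _] c10 _ HW]]]] := walk_of Hrec HS HD d_gt0.
pose b L := c * beta d pstar L.
have bnn L : 0 <= b L by rewrite mulr_ge0 ?powR_ge0// ltW.
have /choice[zc Hz] : forall L, exists z, 1 <= L -> L0 <= L -> [/\ 0 < z,
    forall m, (2 <= m)%N -> regular_at theta eps g e D (b L) L z m,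
    forall j, (1 <= j)%N ->
      `|\sum_(1 <= m < j.+1) kern (fun n k => g L n k z) 0 m - 1| <= b L * j%:R `^ (- (theta - 1)) &
    forall p n, 1 <= p -> (1 <= n)%N ->
      (torus_norm p (fun k => (Dhat (D L) k ^+ 2 * f L n k z)%R) <=
       (Kc / (L `^ (d%:R / p) * n%:R `^ Num.min (d%:R / (2 * p)) theta))%:E)%E].
  move=> L; have [[L1 LL]|H] := pselect (1 <= L /\ L0 <= L).
    by have [_ [z Pz]] := HL L L1 LL; exists z.
  by exists 0 => L1 LL; case: H.
have small L : 1 <= L -> L0 <= L -> 100 * b L * K ^+ 4 <= 1 /\ 6 * b L * K <= theta - 2 - eps.
  move=> L1 LL; have [+ _] := HL L L1 LL; rewrite -/(b L) le_min => /andP[h1 h2]; split.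
    rewrite (_ : _ * _ = b L * (100 * K ^+ 4)); last by ring.
    by rewrite -ler_pdivlMr ?div1r// mulr_gt0// exprn_gt0.
  rewrite (_ : _ * _ = b L * (6 * K)); last by ring.
  by rewrite -ler_pdivlMr// mulr_gt0.
pose gz L n k := g L n k (zc L).
pose ez L n k := e L n k (zc L).
pose fz L n k := f L n k (zc L).
have HX L (L1 : 1 <= L) (LL : L0 <= L) : expansion (D L) (zc L) (fz L) (gz L) (ez L).
  by have [z0 _ _ _] := Hz L L1 LL; exact: (expansion_of Hrec HS HD).
have Hreg L (L1 : 1 <= L) (LL : L0 <= L) m (m2 : (2 <= m)%N) : regular theta (b L) (D L) (gz L) (ez L) m.
  by have [_ /(_ m m2)[h _ _ _] _ _] := Hz L L1 LL; exact: h.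
have Hcr L (L1 : 1 <= L) (LL : L0 <= L) j (j1 : (1 <= j)%N) :
    `|\sum_(1 <= m < j.+1) kern (gz L) 0 m - 1| <= b L * j%:R `^ (- (theta - 1)).
  by have [_ _ h _] := Hz L L1 LL; exact: h.
exists L0, zc, (fun L => amplitude (gz L) (ez L)), (fun L => diffusivity (D L) (gz L)).
split => //.
  move=> L L1 LL; have [z0 _ _ _] := Hz L L1 LL; have [s1 _] := small L L1 LL; split => //.
    have /andP[h _] := amplitude_bounds theta_gt2 (bnn L) s1 (HX L L1 LL) (Hreg L L1 LL) (Hcr L L1 LL).
    by apply: lt_le_trans h; rewrite divr_gt0.
  have /andP[h _] := diffusivity_bounds theta_gt2 (bnn L) s1 (HW L L1) (HX L L1 LL) (Hreg L L1 LL) (Hcr L L1 LL).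
  by apply: lt_le_trans h; rewrite divr_gt0.
split.
- move=> L gamma delta L1 LL gI dI; have [s1 s2] := small L L1 LL.
  have W := HW L L1; have [_ mom] := HF L L1.
  have e1 : 0 < Num.min 1 eps <= 1 by rewrite lt_min ltr01 eps0 ge_min lexx.
  have e1e : Num.min 1 eps <= eps by rewrite ge_min lexx orbT.
  have [Cq Cq0 HCq] := akD_quad (walk_ge0 W) (walk_mass W) eps0 mom e1 e1e.
  have Hq k : cube k -> `|akD (D L) k - sigma2 (D L) / (2 * d%:R) * sqnorm k| <= Cq * sqnorm k `^ (1 + Num.min 1 eps).
    move=> kc; rewrite -(quad_sigma2 (walk_mass W) (walk_lap W) (Ordinal d_gt0) k (walk_ge0 W) eps0 mom) //.
    exact: (akD_symmetric HS HD).
  have Hdg m t k : (2 <= m)%N -> 0 <= t <= eps -> cube k ->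
      `|gz L m k - gz L m 0 - akD (D L) k * klap (D L) (gz L) m| <=
      b L * akD (D L) k `^ (1 + t) * m%:R `^ (- theta + (1 + t)).
    by move=> m2 tt kc; have [_ /(_ m m2)[_ _ _ h] _ _] := Hz L L1 LL; exact: h.
  have [C C0 HC] := gaussian_limit theta_gt2 (bnn L) s1 eta0 c10 L1 W (HX L L1 LL) (Hreg L L1 LL) (Hcr L L1 LL)
    s2 Hdg Cq0 Hq d_gt0 gI dI.
  exists C => n k n1 k' kc an; have [r1 [r2 [h1 h2 h3]]] := HC n k' n1 kc an.
  have /andP[v1 _] := diffusivity_bounds theta_gt2 (bnn L) s1 W (HX L L1 LL) (Hreg L L1 LL) (Hcr L L1 LL).
  have sE : diffusivity (D L) (gz L) * sigma2 (D L) * n%:R * sqnorm k' = sqnorm k.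
    have x0 : 0 < diffusivity (D L) (gz L) * sigma2 (D L) * n%:R.
      rewrite mulr_gt0 ?ltr0n// mulr_gt0 ?(walk_var W)//.
      by apply: lt_le_trans v1; rewrite divr_gt0.
    rewrite /k' sqnormZ mulrA exprVn sqr_sqrtr; last exact: ltW.
    by rewrite mulfV ?mul1r// gt_eqF.
  rewrite sE in h1 h3; exists r1, r2; split => //.
  by rewrite (_ : - theta + 2 = - (theta - 2))//; ring.
- move=> gamma delta /andP[g0 _] /andP[d0 dm].
  have m1 : Num.min 1 eps <= 1 by rewrite ge_min lexx.
  have me : Num.min 1 eps <= eps by rewrite ge_min lexx orbT.
  have d1 : 0 < delta < 1 by apply/andP; split; lra.
  have dth : delta < theta - 2 by lra.
  pose Q := 8 * 36 * K ^+ 4 * (2 + 2 / (1 - delta)) + 20 * K ^+ 3.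
  exists (Q * c) => L n L1 LL n1; have [s1 _] := small L L1 LL.
  have [r hr E] := second_moment_ratio theta_gt2 (bnn L) s1 eta0 c10 L1 (HW L L1) (HX L L1 LL)
    (Hreg L L1 LL) (Hcr L L1 LL) d1 dth n1.
  exists r => //; apply: le_trans hr _.
  by rewrite -/K -/Q /b -!mulrA.
- move=> p p1; exists Kc => L n L1 LL n1.
  by have [_ _ _ h] := Hz L L1 LL; exact: h.
- move=> L L1 LL g0 e0 lap0.
  have [h1 h2 h3 h4 h5] := critical_sums theta_gt2 (bnn L) (HW L L1) (HX L L1 LL) (Hreg L L1 LL) (Hcr L L1 LL).
  by split.
Qed.
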